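(* Let $r\ge1$. Let $u\in H^1_0(\Omega)\cap H^{r+2}_{\mathcal P}(\Omega)$ be the solution of $$-(\alpha u')'+\beta u'+\gamma u=f\ \text{ in }\Omega,\qquad u(a)=u(b)=0,$$ and let $u_{\mathcal P}\in U^r_{\mathcal P}$ be the solution of the finite volume scheme $a_{\mathcal P}(u_{\mathcal P},w)=\int_a^bfw\,dx$ for all $w\in V_{\mathcal P'}$, where the mesh size $h$ is sufficiently small. Then $$\|u-u_{\mathcal P}\|_{L^2(\Omega)}\le C\,h^{r+1}\,\|u\|_{r+2,\mathcal P},$$ where the constant $C>0$ is independent of $\mathcal P$ (and of $u$).
   Context: Coefficients. $\Omega=(a,b)$ is an interval; $\alpha,\beta,\gamma\in L^\infty(\bar\Omega)$, $\alpha\ge\alpha_0>0$, $\gamma-\tfrac12\beta'\ge\kappa>0$; $f$ is a real-valued function on $\bar\Omega$. Primal mesh. For $a=x_0<\dots<x_N=b$ put $\tau_i=[x_{i-1},x_i]$, $h_i=x_i-x_{i-1}$, $h=\max_ih_i$, $\mathcal P=\{\tau_i\}_{i=1}^N$. The trial space is $U^r_{\mathcal P}=\{v\in C(\Omega): v|_{\tau_i}$ is a polynomial of degree $\le r$ for each $i$, $v(a)=v(b)=0\}$. Broken spaces: $H^m_{\mathcal P}(\Omega)=\{v\in C(\Omega): v|_{\tau_i}\in H^m(\tau_i)\ \forall i\}$ with norm $\|v\|_{m,\mathcal P}^2=\sum_{j=0}^m\sum_i\|v^{(j)}\|_{L^2(\tau_i)}^2$. Dual mesh. Let $G_1<\dots<G_r$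 be the zeros in $[-1,1]$ of the Legendre polynomial of degree $r$; $g_{i,j}=\tfrac12(x_i+x_{i-1}+h_iG_j)$ for $1\le i\le N$, $1\le j\le r$, and $g_{i,r+1}=g_{i+1,1}$ for $1\le i\le N-1$. Put $r_i=r$ for $i\le N-1$ and $r_N=r-1$. The test space $V_{\mathcal P'}$ consists of $w=\sum_{i=1}^N\sum_{j=1}^{r_i}w_{i,j}\chi_{[g_{i,j},g_{i,j+1}]}$, $w_{i,j}\in\mathbb R$, where $\chi$ denotes a characteristic function. With $w_{1,0}=0$, $w_{N,r}=0$, $w_{i,0}=w_{i-1,r}$ ($2\le i\le N$), the jumps are $[w_{i,j}]=w_{i,j}-w_{i,j-1}$ for $1\le i\le N$, $1\le j\le r$. Bilinear form. $$a_{\mathcal P}(v,w)=\sum_{i=1}^N\sum_{j=1}^r[w_{i,j}]\,\alpha(g_{i,j})v'(g_{i,j})+\sum_{i=1}^N\sum_{j=1}^{r_i}w_{i,j}\int_{g_{i,j}}^{g_{i,j+1}}\big(\beta v'+\gamma v\big)\,dx .$$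
   Formalization: β is assumed to lie in H^1(Ω), so β' is in L²; with β' merely integrable (β=-sgn(x)|x|^s, s<1/2) the estimate fails. Also α is bounded and ≥α_0 at every point, the flux αu' is continuous and equals α times u' wherever u is differentiable, and f is integrable. *)

(* Defs.v *)
From HB Require Import structures.
From mathcomp Require Import all_boot all_order all_algebra.
From mathcomp Require Import all_classical all_reals all_analysis.

Set Implicit Arguments.
Unset Strict Implicit.
Unset Printing Implicit Defensive.

Import Order.TTheory GRing.Theory Num.Theory.
Import numFieldNormedType.Exports.

Local Open Scope classical_set_scope.
Local Open Scope ring_scope.

Section Sobolev.
Context {R : realType}.
Implicit Types (c d : R) (v g phi : R -> R).

(** f \_ D is the extension by 0 of f outside D. *)
Definition Lp (p : \bar R) c d v : Prop :=
  v \_ `]c, d[%classic \in Lfun lebesgue_measure p.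

Definition L2norm c d v : R :=
  fine (Lnorm lebesgue_measure 2%:E (EFin \o (v \_ `]c, d[%classic))).

(** The support is closed and lies in a bounded open interval, so it is
    compact. *)
Definition C1c c d phi : Prop :=
  [/\ forall x, derivable phi x 1,
      continuous (derive1 phi) &
      closure [set x | phi x != 0] `<=` `]c, d[%classic].

Definition is_wderiv c d v g : Prop :=
  [/\ Lp 1%E c d v, Lp 1%E c d g &
      forall phi, C1c c d phi ->
        \int[lebesgue_measure]_(x in `]c, d[) (v x * derive1 phi x) =
        - \int[lebesgue_measure]_(x in `]c, d[) (g x * phi x)].

Definition wderivable c d v : Prop := exists g, is_wderiv c d v g.

(** A weak derivative is unique up to a null set; [get] selects one, when
    there is one. *)
Definition wderiv c d v : R -> R := get [set g | is_wderiv c d v g].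

Definition wderivn c d (j : nat) v : R -> R := iter j (wderiv c d) v.

(** The Sobolev space H^m(c, d). *)
Definition sobolev (m : nat) c d v : Prop :=
  (forall j, (j < m)%N -> wderivable c d (wderivn c d j v)) /\
  (forall j, (j <= m)%N -> Lp 2%:E c d (wderivn c d j v)).

(** H^1_0(c, d), each class being represented by its continuous
    representative on [c, d]. *)
Definition sobolev10 c d v : Prop :=
  [/\ {within `[c, d], continuous v}, sobolev 1 c d v, v c = 0 & v d = 0].

End Sobolev.

Section Mesh.
Context {R : realType}.
Implicit Types (a b : R) (x : nat -> R) (N : nat).

Definition mesh a b N x : Prop :=
  [/\ x 0%N = a, x N = b & forall i, (i < N)%N -> x i < x i.+1].

Definition mesh_size N x : R :=
  \big[Num.max/0]_(1 <= i < N.+1) (x i - x i.-1).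

Definition broken_sobolev (m : nat) a b N x (v : R -> R) : Prop :=
  {within `]a, b[, continuous v} /\
  (forall i, (1 <= i <= N)%N -> sobolev m (x i.-1) (x i) v).

Definition broken_norm (m : nat) N x (v : R -> R) : R :=
  Num.sqrt (\sum_(0 <= j < m.+1) \sum_(1 <= i < N.+1)
    L2norm (x i.-1) (x i) (wderivn (x i.-1) (x i) j v) ^+ 2).

Definition trial_space (r : nat) a b N x (v : R -> R) : Prop :=
  [/\ {within `]a, b[, continuous v},
      forall i, (1 <= i <= N)%N -> exists2 p : {poly R}, (size p <= r.+1)%N &
        forall y, y \in `[x i.-1, x i] -> v y = p.[y],
      v a = 0 & v b = 0].

End Mesh.

Section Scheme.
Context {R : realType}.
Implicit Types (x G : nat -> R) (N r : nat) (w : nat -> nat -> R).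

(** Rodrigues' formula. *)
Definition legendre r : {poly R} :=
  ((2 ^ r * r`!)%:R)^-1 *: derivn r (('X^2 - 1) ^+ r).

(** G 1 < ... < G r; the other values of G are irrelevant. *)
Definition legendre_zeros r G : Prop :=
  (forall j, (1 <= j <= r)%N -> -1 <= G j <= 1 /\ root (legendre r) (G j)) /\
  (forall j, (1 <= j < r)%N -> G j < G j.+1).

Definition gauss_pt x G r (i j : nat) : R :=
  let aff i j := 2^-1 * (x i + x i.-1 + (x i - x i.-1) * G j) in
  if (j <= r)%N then aff i j else aff i.+1 1%N.

(** The number r_i of dual cells attached to the i-th element. *)
Definition ncells N r (i : nat) : nat := if i == N then r.-1 else r.

(** An element of the test space is given by its coefficients w i j for
    1 <= i <= N and 1 <= j <= ncells N r i; this is the function itself. *)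
Definition test_fun N x G r w : R -> R := fun y =>
  \sum_(1 <= i < N.+1) \sum_(1 <= j < (ncells N r i).+1)
    w i j * \1_(`[gauss_pt x G r i j, gauss_pt x G r i j.+1]%classic) y.

(** w extended by w_{1,0} = 0, w_{N,r} = 0 and w_{i,0} = w_{i-1,r}. *)
Definition coef N r w (i j : nat) : R :=
  if j == 0%N then (if i == 1%N then 0 else w i.-1 r)
  else if (i == N) && (j == r) then 0 else w i j.

Definition jump N r w (i j : nat) : R := coef N r w i j - coef N r w i j.-1.

(** [derive1 v] is used for v in the trial space, which is differentiable off
    the nodes; the Gauss points are not nodes. *)
Definition fv_form (alpha beta gamma : R -> R) N x G r (v : R -> R) w : R :=
  \sum_(1 <= i < N.+1) \sum_(1 <= j < r.+1)
    jump N r w i j *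
      (alpha (gauss_pt x G r i j) * derive1 v (gauss_pt x G r i j))
  + \sum_(1 <= i < N.+1) \sum_(1 <= j < (ncells N r i).+1)
    w i j * \int[lebesgue_measure]_(y in
        `[gauss_pt x G r i j, gauss_pt x G r i j.+1])
          (beta y * derive1 v y + gamma y * v y).

Definition fv_solution a b (alpha beta gamma f : R -> R) N x G r
    (uP : R -> R) : Prop :=
  trial_space r a b N x uP /\
  forall w, fv_form alpha beta gamma N x G r uP w =
    \int[lebesgue_measure]_(y in `[a, b]) (f y * test_fun N x G r w y).

(** The weak form of - (alpha u')' + beta u' + gamma u = f on ]a, b[.  The
    flux alpha u' is the function sigma, whose weak derivative is
    beta u' + gamma u - f.  As alpha is only bounded and the scheme samples
    alpha u' at single points, the equality sigma = alpha u' holds at every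
    point where u is differentiable, not just almost everywhere (for
    continuous alpha the two amount to the same when u is piecewise C^1). *)
Definition bvp_solution a b (alpha beta gamma f u : R -> R) : Prop :=
  sobolev10 a b u /\
  exists sigma : R -> R,
    [/\ {within `]a, b[, continuous sigma},
        forall y, y \in `]a, b[ -> derivable u y 1 ->
          sigma y = alpha y * derive1 u y &
        is_wderiv a b sigma
          (fun y => beta y * derive1 u y + gamma y * u y - f y)].

End Scheme.

(* Main.v *)
Require Import Defs.
From HB Require Import structures.
From mathcomp Require Import all_boot all_order all_algebra.
From mathcomp Require Import ring lra zify.
From mathcomp Require Import all_classical all_reals all_analysis.
From mathcomp Require Import measurable_realfun ess_sup_inf.
From mathcomp Require polyrcf polyorder.
Import Order.TTheory GRing.Theory Num.Theory.
Import numFieldNormedType.Exports.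
Local Open Scope classical_set_scope.
Local Open Scope ring_scope.

(** Let [uI] be the piecewise polynomial that agrees with [u] at the nodes and
    is, on each element, a Taylor polynomial of degree r + 1 whose top term has
    been traded for a multiple of the Lobatto polynomial.  The derivative of the
    latter vanishes at the Gauss points, so that [uI'] approximates [u'] there to
    order h^(r+1), one order better than elsewhere.  Put [theta = uP - uI] and
    [rho = u - uI].

    Integrating the equation from a, and summing the scheme by parts, gives for
    [e = u - uP] and [Z_e(t) = int_a^t (beta e' + gamma e)]

      sum_ij [w_ij] (alpha e' - Z_e)(g_ij) = 0   for every test function w.

    Take for [w_ij] the weighted values of [theta'] at the Gauss points: they sum
    to 0 because the quadrature integrates [theta'] exactly.  The terms in
    [alpha theta'] form a discrete H^1 norm.  The terms in [Z_theta] agree, up to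
    O(h) times that norm, with int theta' Z_theta = - int (gamma - beta'/2)
    theta^2 <= 0.  The remaining terms involve [rho'] only at the Gauss points
    and are O(h^(r+1)); hence so are [theta] and [rho - theta = u - uP]. *)

(** * Gauss quadrature *)

(** No duality argument is involved: the extra order of [rho'] at the Gauss points makes [theta]
    small already in the discrete H^1 norm, and since [theta] vanishes at a this norm bounds its sup
    norm.

    The obstacle is Z_rho, which sees [rho'] away from the Gauss points, where it is one order
    worse. Integration by parts gives Z_rho = beta rho + int (gamma - beta') rho, in which only
    [rho] occurs; beta' being merely square integrable, the integral is estimated by Cauchy-Schwarz
    on each element.

    Local errors have size h_i^r sqrt(h_i) times an L^2 norm over the element. The missing sqrt(h_i)
    is supplied by the weights h_i of the discrete norm when the elements are summed, so the
    constant does not depend on ratios of element sizes.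

    Null sets need care: beta and gamma are exchanged for a continuous representative [B] and a
    truncation [gam], whereas the flux must be identified at each single Gauss point. Apart from h
    <= 1, the smallness of h lets the coercive term absorb the quadrature error of Z_theta. *)

Section PolyIntegral.
Context {R : realType}.
Implicit Types p q s : {poly R}.

(** The constant coefficient is a division by [0%:R], hence 0: this is the antiderivative that
    vanishes at 0. *)
Definition antideriv p : {poly R} := \poly_(i < (size p).+1) (p`_i.-1 / i%:R).

Lemma coef_antideriv p i : (antideriv p)`_i = p`_i.-1 / i%:R.
Proof.
rewrite /antideriv coef_poly; case: ltnP => // hi.
by rewrite nth_default ?mul0r//; case: i hi.
Qed.

Lemma deriv_antideriv p : (antideriv p)^`() = p.
Proof.
by apply/polyP => i; rewrite coef_deriv coef_antideriv/= -[LHS]mulr_natr divfK// pnatr_eq0.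
Qed.

Lemma antideriv_deriv q : antideriv q^`() = q - (q`_0)%:P.
Proof.
apply/polyP => -[|i]; rewrite coef_antideriv coefB coefC/=.
  by rewrite invr0 mulr0 subrr.
by rewrite coef_deriv subr0 -[_ *+ _]mulr_natr mulfK// pnatr_eq0.
Qed.

(** The integral over [-1, 1], kept algebraic so that orthogonality and quadrature need no measure
    theory. *)
Definition polyint p : R := (antideriv p).[1] - (antideriv p).[-1].

Lemma polyint_deriv q : polyint q^`() = q.[1] - q.[-1].
Proof. by rewrite /polyint antideriv_deriv !hornerE; ring. Qed.

Lemma polyint_is_linear : linear_for *%R polyint.
Proof.
move=> k p q; rewrite -[in LHS](deriv_antideriv p) -[in LHS](deriv_antideriv q).
rewrite -derivZ -derivD polyint_deriv /polyint !hornerD !hornerZ.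
by rewrite mulrBr opprD addrACA.
Qed.

HB.instance Definition _ := GRing.isLinear.Build R {poly R} R _ polyint
  polyint_is_linear.

Lemma polyint_parts p q : p.[1] = 0 -> p.[-1] = 0 ->
  polyint (p^`() * q) = - polyint (p * q^`()).
Proof.
move=> p1 pN1; apply/eqP; rewrite -addr_eq0 -raddfD/= -derivM polyint_deriv.
by rewrite !hornerM p1 pN1 !mul0r subrr.
Qed.

(** The antiderivative is nondecreasing on [-1, 1] by the mean value theorem; with equal end values
    it would be constant there, hence a constant polynomial, and [p] would be 0. *)
Lemma polyint_gt0 p : p != 0 -> (forall x, -1 <= x <= 1 -> 0 <= p.[x]) ->
  0 < polyint p.
Proof.
move=> p0 pge; set q := antideriv p.
have mono x y : -1 <= x -> x <= y -> y <= 1 -> q.[x] <= q.[y].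
  move=> x1; rewrite le_eqVlt => /predU1P[->//|xy] y1; rewrite -subr_ge0.
  have [c /itvP cxy ->] := polyrcf.poly_mvt q xy.
  rewrite mulr_ge0 ?subr_ge0 1?(ltW xy)// deriv_antideriv; apply: (pge c).
  by apply/andP; split; [apply: le_trans x1 _|apply: le_trans y1]; rewrite cxy.
have N11 : -1 <= 1 :> R by lra.
rewrite /polyint -/q subr_gt0 lt_neqAle mono// andbT.
apply: contra p0 => /eqP q1; rewrite -(deriv_antideriv p) -/q.
suff -> : q = (q.[1])%:P by rewrite derivC.
apply/eqP; rewrite -subr_eq0; apply/eqP.
(* The points 1/(i+1) are distinct points of [-1, 1], one for each coefficient, hence more roots
   than the degree allows. *)
pose rs := [seq (i.+1%:R : R)^-1 | i <- iota 0 (size (q - (q.[1])%:P))].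
apply: (@roots_geq_poly_eq0 _ _ rs); last by rewrite size_map size_iota.
  apply/allP => x /mapP[i _ ->]; rewrite /root !hornerE subr_eq0 eq_le.
  have i0 : 0 < i.+1%:R^-1 :> R by rewrite invr_gt0 ltr0n.
  have i1 : i.+1%:R^-1 <= 1 :> R by rewrite invf_le1 ?ltr0n// ler1n.
  have iN1 : -1 <= i.+1%:R^-1 :> R by rewrite (le_trans _ (ltW i0))// lerN10.
  by rewrite mono//= -[leLHS]q1 mono.
by rewrite map_inj_uniq ?iota_uniq// => i j /invr_inj/eqP; rewrite eqr_nat => /eqP[].
Qed.

Lemma horner_bound p : exists2 M, 0 <= M & forall x, -1 <= x <= 1 -> `|p.[x]| <= M.
Proof.
exists (\sum_(i < size p) `|p`_i|); first by apply: sumr_ge0.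
move=> x x1; rewrite horner_coef (le_trans (ler_norm_sum _ _ _))//.
apply: ler_sum => i _; rewrite normrM ler_piMr// normrX exprn_ile1//.
by rewrite ler_norml.
Qed.

End PolyIntegral.

Section Gauss.
Context {R : realType}.
Context (r : nat) (G : nat -> R).
Context (r_gt0 : (0 < r)%N) (hG : legendre_zeros r G).
Implicit Types (p q s : {poly R}) (x : R).

(** Up to a factor, this is the antiderivative of [legendre r] vanishing at both
    ends of [-1, 1]. *)
Definition lobatto : {poly R} := (('X^2 - 1) ^+ r)^`(r.-1).

(** Each derivation costs at most one factor X^2 - 1, so a positive power of it survives k < r
    derivations. *)
Lemma derivn_X2 k x : (k < r)%N -> x ^+ 2 = 1 ->
  ((('X^2 - 1 : {poly R}) ^+ r)^`(k)).[x] = 0.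
Proof.
move=> kr x1.
suff [q ->] : exists q, (('X^2 - 1 : {poly R}) ^+ r)^`(k) = ('X^2 - 1) ^+ (r - k) * q.
  rewrite hornerM horner_exp !hornerE x1 subrr expr0n subn_eq0 leqNgt kr/=.
  by rewrite mul0r.
elim: k kr => [|k IH] kr; first by exists 1; rewrite subn0 mulr1 derivn0.
have [q qE] := IH (ltnW kr).
rewrite derivnS qE derivM deriv_exp -[(r - k)%N]prednK ?subn_gt0 1?ltnW//.
rewrite subnS; set n := (r - k).-1.
eexists ((('X^2 - 1)^`() *+ n.+1) * q + ('X^2 - 1) * q^`()).
rewrite /= (exprS _ n); move: (deriv (_ - _)) (deriv q) (_ ^+ n) => d q' e.
by rewrite -[d *+ _]mulr_natr -[_ *+ n.+1]mulr_natr; ring.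
Qed.

Lemma lobatto1 : lobatto.[1] = 0.
Proof. by rewrite derivn_X2 ?expr1n// prednK. Qed.

Lemma lobattoN1 : lobatto.[-1] = 0.
Proof. by rewrite derivn_X2 ?sqrrN ?expr1n// prednK. Qed.

Lemma lobatto_deriv : lobatto^`() = (2 ^ r * r`!)%:R *: legendre r.
Proof.
rewrite /lobatto -derivnS prednK// /legendre scalerA divff ?scale1r//.
Qed.

Lemma size_legendre : size (legendre r : {poly R}) = r.+1.
Proof.
rewrite /legendre size_scale ?invr_eq0 ?pnatr_eq0 -?lt0n ?muln_gt0 ?expn_gt0 ?fact_gt0//.
have sz k (p : {poly R}) : size p^`(k) = (size p - k)%N.
  by elim: k => [|k IH]; rewrite ?derivn0 ?subn0// derivnS polyorder.size_deriv IH subnS.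
have s2 : size ('X^2 - 1 : {poly R}) = 3%N by rewrite size_XnsubC.
have := size_exp ('X^2 - 1 : {poly R}) r; rewrite s2 sz/=.
have : size (('X^2 - 1 : {poly R}) ^+ r) != 0%N.
  by rewrite size_poly_eq0 expf_neq0// -size_poly_eq0 s2.
by move: (size _) => n; lia.
Qed.

(** By Rodrigues' formula and r integrations by parts, without boundary terms by [derivn_X2], all
    derivatives pass to [s], whose r-th derivative is 0. *)
Lemma polyint_legendre s : (size s <= r)%N -> polyint (legendre r * s) = 0.
Proof.
move=> sr.
have dn k : (k <= r)%N ->
    polyint ((('X^2 - 1) ^+ r)^`(k) * s) = (-1) ^+ k * polyint (('X^2 - 1) ^+ r * s^`(k)).
  elim: k s {sr} => [|k IH] s kr; first by rewrite !derivn0 expr0 mul1r.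
  rewrite derivnS polyint_parts; [|by rewrite derivn_X2 ?expr1n|
    by rewrite derivn_X2 ?sqrrN ?expr1n].
  by rewrite IH 1?ltnW// -derivSn [(-1) ^+ k.+1]exprS mulN1r mulNr.
have := dn r (leqnn r); rewrite (derivn_poly0 sr) mulr0 raddf0 mulr0.
rewrite /legendre -scalerAl linearZ/= => ->; exact: mulr0.
Qed.

Let Gs := [seq G i | i <- iota 1 r].

Lemma G_mono i j : (1 <= i)%N -> (i < j)%N -> (j <= r)%N -> G i < G j.
Proof.
have [_ Gm] := hG.
move=> i1; elim: j => // j IH; rewrite ltnS leq_eqVlt => /predU1P[<-|ij] jr.
  by apply: Gm; rewrite i1.
by rewrite (lt_trans (IH ij (ltnW jr)))// Gm// (leq_trans i1)//= ltnW.
Qed.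

Let uniq_Gs : uniq Gs.
Proof.
rewrite map_inj_in_uniq ?iota_uniq// => i j; rewrite !mem_iota => /andP[i1 ir] /andP[j1 jr] Gij.
by case: (ltngtP i j) => // ij; [have := G_mono _ _ i1 ij|have := G_mono _ _ j1 ij];
  rewrite Gij ltxx => /(_ ltac:(lia)).
Qed.

Let size_Gs : size Gs = r. Proof. by rewrite size_map size_iota. Qed.

Let mem_Gs j : (1 <= j <= r)%N -> G j \in Gs.
Proof. by move=> j1; apply: map_f; rewrite mem_iota; lia. Qed.

Lemma poly_eq_on_gauss p q : (size p <= r)%N -> (size q <= r)%N ->
  (forall j, (1 <= j <= r)%N -> p.[G j] = q.[G j]) -> p = q.
Proof.
move=> sp sq pq; apply/eqP; rewrite -subr_eq0; apply/eqP.
apply: (@roots_geq_poly_eq0 _ _ Gs) => //.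
  apply/allP => x /mapP[j]; rewrite mem_iota => jr ->.
  by rewrite /root !hornerE pq ?subrr//; lia.
by rewrite size_Gs (leq_trans (size_polyD _ _))// size_polyN geq_max sp.
Qed.

(** Exactness of Gauss quadrature up to degree 2r - 1: such a [p] is [legendre r] times a polynomial
    of degree less than r, to which [legendre r] is orthogonal. *)
Lemma polyint_vanish p : (size p <= r.*2)%N ->
  (forall j, (1 <= j <= r)%N -> p.[G j] = 0) -> polyint p = 0.
Proof.
move=> sp p0.
have Lroots : all (root (legendre r)) Gs.
  by apply/allP => x /mapP[j]; rewrite mem_iota => jr ->; apply: (hG.1 _ _).2; lia.
have uG : poly.uniq_roots Gs by rewrite uniq_rootsE.
have proots : all (root p) Gs.
  by apply/allP => x /mapP[j]; rewrite mem_iota => jr ->; rewrite /root p0//; lia.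
have [q pE] := uniq_roots_prod_XsubC proots uG.
have LE := all_roots_prod_XsubC (etrans size_legendre (congr1 S (esym size_Gs))) Lroots uG.
have L0 : lead_coef (legendre r : {poly R}) != 0.
  by rewrite lead_coef_eq0 -size_poly_eq0 size_legendre.
move: (lead_coef _) L0 LE => c c0 LE.
have -> : p = legendre r * (c^-1 *: q).
  by rewrite LE pE -scalerAr -scalerAl scalerA mulVf// scale1r mulrC.
apply: polyint_legendre; rewrite (leq_trans (size_scale_leq _ _))//.
have [->|q0] := eqVneq q 0; first by rewrite size_poly0.
move: sp; rewrite pE size_Mmonic ?monic_prod_XsubC//.
by rewrite size_prod_XsubC size_Gs; lia.
Qed.

Definition lagr j : {poly R} :=
  \prod_(k <- rem (G j) Gs) ((G j - k)^-1 *: ('X - k%:P)).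

Lemma size_lagr j : (1 <= j <= r)%N -> (size (lagr j) <= r)%N.
Proof.
move=> jr; rewrite /lagr scaler_prod (leq_trans (size_scale_leq _ _))//.
by rewrite size_prod_XsubC size_rem ?mem_Gs// size_Gs; lia.
Qed.

Lemma lagrE j k : (1 <= j <= r)%N -> (1 <= k <= r)%N -> (lagr j).[G k] = (j == k)%:R.
Proof.
move=> jr kr; rewrite /lagr horner_prod.
have [->|jk] := eqVneq j k.
  rewrite big_seq big1// => x; rewrite mem_rem_uniq// inE => /andP[xk _].
  by rewrite hornerZ hornerXsubC mulVf// subr_eq0 eq_sym.
apply/eqP; rewrite prodf_seq_eq0; apply/hasP; exists (G k).
  rewrite mem_rem_uniq// inE mem_Gs// andbT; apply: contra jk => /eqP Gjk.
  by case: (ltngtP j k) => // ij; [have := G_mono j k|have := G_mono k j];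
    rewrite Gjk ltxx => /(_ ltac:(lia) ltac:(lia) ltac:(lia)).
by rewrite /= hornerZ hornerXsubC subrr mulr0.
Qed.

Lemma lagr_interp p : (size p <= r)%N ->
  p = \sum_(1 <= j < r.+1) p.[G j] *: lagr j.
Proof.
move=> sp; apply: poly_eq_on_gauss => //.
  rewrite big_nat; elim/big_ind : _ => [|x y xr yr|j jr]; first by rewrite size_poly0.
    by rewrite (leq_trans (size_polyD _ _))// geq_max xr.
  by rewrite (leq_trans (size_scale_leq _ _))// size_lagr//; lia.
move=> k kr; rewrite horner_sum (bigD1_seq k) ?iota_uniq ?mem_index_iota//=.
rewrite hornerZ lagrE// eqxx mulr1 big_nat_cond big1 ?addr0// => i.
by rewrite hornerZ => /andP[ir ik]; rewrite lagrE ?(negbTE ik) ?mulr0//; lia.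
Qed.

Definition weight j : R := polyint (lagr j).

(** [lagr j] and its square agree at the Gauss points and have degree at most 2r - 2, so they have
    the same integral. *)
Lemma weight_gt0 j : (1 <= j <= r)%N -> 0 < weight j.
Proof.
move=> jr; have -> : weight j = polyint (lagr j ^+ 2).
  apply/eqP; rewrite -subr_eq0 /weight -raddfB; apply/eqP/polyint_vanish.
    rewrite (leq_trans (size_polyD _ _))// size_polyN geq_max.
    have := size_lagr _ jr; have := size_poly_exp_leq (lagr j) 2.
    by move: (size _) (size _) => m n; lia.
  by move=> k kr; rewrite hornerD hornerN horner_exp lagrE//; case: (j == k);
    rewrite ?expr1n ?expr0n/= subrr.
apply: polyint_gt0; last by move=> x _; rewrite horner_exp sqr_ge0.
rewrite expf_neq0//; apply/eqP => /(congr1 (horner^~ (G j)))/eqP.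
by rewrite lagrE// eqxx horner0 oner_eq0.
Qed.

Lemma gauss_quadrature q : (size q <= r.+1)%N ->
  q.[1] - q.[-1] = \sum_(1 <= j < r.+1) weight j * q^`().[G j].
Proof.
move=> sq; rewrite -polyint_deriv {1}(lagr_interp q^`()); last first.
  by rewrite polyorder.size_deriv; case: (size q) sq.
by rewrite raddf_sum; apply: eq_bigr => j _; rewrite /= linearZ mulrC.
Qed.

(** Equivalence of norms on polynomials of degree less than r; it lets the Gauss values of theta'
    control theta' everywhere. *)
Lemma lagr_bound : exists2 M, 0 < M & forall p x, (size p <= r)%N -> -1 <= x <= 1 ->
  `|p.[x]| <= M * \sum_(1 <= j < r.+1) `|p.[G j]|.
Proof.
have [M M0 HM] : exists2 M, 0 < M & forall j x, (1 <= j <= r)%N -> -1 <= x <= 1 ->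
    `|(lagr j).[x]| <= M.
  pose M j := sval (cid2 (horner_bound (lagr j))).
  exists (1 + \sum_(1 <= j < r.+1) M j).
    by rewrite ltr_pwDl// sumr_ge0// => j _; rewrite /M; case: cid2.
  move=> j x jr x1; rewrite (@le_trans _ _ (M j))//.
    by rewrite /M; case: cid2 => /= m _; apply.
  rewrite (bigD1_seq j) ?iota_uniq ?mem_index_iota//= addrCA lerDl addr_ge0//.
  by apply: sumr_ge0 => i _; rewrite /M; case: cid2.
exists M => // p x sp x1; rewrite {1}(lagr_interp p)// horner_sum mulr_sumr.
rewrite (le_trans (ler_norm_sum _ _ _))// big_nat [leRHS]big_nat; apply: ler_sum => j jr.
by rewrite hornerZ normrM mulrC ler_wpM2r// HM//; lia.
Qed.

Let legendre_endpoint (e : R) : e ^+ 2 = 1 -> ~~ root (legendre r) e.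
Proof.
move=> e1; apply/negP => /factor_theorem[q LE].
have q0 : q != 0.
  by apply/eqP => q0; have := size_legendre; rewrite LE q0 mul0r size_poly0.
have sq : (size q <= r)%N.
  have := size_legendre; rewrite LE size_Mmonic ?monicXsubC// size_XsubC addn2/=.
  by case=> ->.
have e0 : e != 0 by apply: contra_eq_neq e1 => ->; rewrite expr0n/= eq_sym oner_eq0.
(* The sign of [e (e - x) q(x)^2] is constant on [-1, 1]. *)
have : 0 < polyint (legendre r * (- e *: q)).
  have -> : legendre r * (- e *: q) = (- e *: ('X - e%:P)) * q ^+ 2.
    by rewrite LE -!scalerAl -!scalerAr; congr (_ *: _); ring.
  apply: polyint_gt0 => [|x /andP[x1 x2]].
    by rewrite mulf_neq0 ?expf_neq0// scaler_eq0 negb_or oppr_eq0 e0 polyXsubC_eq0.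
  rewrite hornerM hornerZ hornerXsubC horner_exp mulr_ge0 ?sqr_ge0//.
  by move/eqP: e1; rewrite sqrf_eq1 => /orP[/eqP ->|/eqP ->]; lra.
by rewrite polyint_legendre ?ltxx// (leq_trans (size_scale_leq _ _)).
Qed.

(** Strictness keeps the Gauss points of an element away from its nodes, where trial functions may
    have kinks. *)
Lemma G_itv j : (1 <= j <= r)%N -> -1 < G j < 1.
Proof.
move=> jr; have [/andP[G1 G2] Lj] := hG.1 j jr; rewrite !lt_neqAle G1 G2 !andbT.
have endpoint := legendre_endpoint.
apply/andP; (split; apply: contraTneq Lj) => [<-|->]; apply: endpoint;
  by rewrite ?sqrrN expr1n.
Qed.

Lemma size_lobatto : size lobatto = r.+2.
Proof.
have := polyorder.size_deriv lobatto.
rewrite lobatto_deriv size_scale ?size_legendre; first by case: (size _) => // n ->.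
by rewrite pnatr_eq0 -lt0n muln_gt0 expn_gt0 fact_gt0.
Qed.

Lemma quadrature_itv (c d : R) q : (size q <= r.+1)%N ->
  q.[d] - q.[c] = \sum_(1 <= j < r.+1)
    weight j * ((d - c) / 2) * q^`().[2^-1 * (d + c + (d - c) * G j)].
Proof.
move=> sq; pose A : {poly R} := ((d - c) / 2) *: 'X + ((d + c) / 2)%:P.
have AE t : A.[t] = 2^-1 * (d + c + (d - c) * t) by rewrite /A !hornerE; field.
have sA : (size A <= 2)%N.
  rewrite (leq_trans (size_polyD _ _))// geq_max (leq_trans (size_scale_leq _ _)) ?size_polyX//.
  by rewrite (leq_trans (size_polyC_leq1 _)).
have -> : q.[d] - q.[c] = (q \Po A).[1] - (q \Po A).[-1].
  by rewrite !horner_comp !AE; congr (q.[_] - q.[_]); field.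
rewrite gauss_quadrature; last first.
  have := size_comp_poly_leq q A; move: (size q) (size A) (size _) sq sA => m n k; nia.
apply: eq_bigr => j _; rewrite deriv_comp hornerM horner_comp AE.
by rewrite /A derivD derivZ derivX derivC addr0 hornerZ hornerC; ring.
Qed.

(** The constant is that of the reference interval, hence uniform over all elements of all
    meshes. *)
Lemma lagr_bound_itv : exists2 M, 0 < M & forall (c d : R) p x, c < d ->
  (size p <= r)%N -> c <= x <= d ->
  `|p.[x]| <= M * \sum_(1 <= j < r.+1) `|p.[2^-1 * (d + c + (d - c) * G j)]|.
Proof.
have [M M0 HM] := lagr_bound; exists M => // c d p x cd sp /andP[cx xd].
pose A : {poly R} := ((d - c) / 2) *: 'X + ((d + c) / 2)%:P.
have AE t : A.[t] = 2^-1 * (d + c + (d - c) * t) by rewrite /A !hornerE; field.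
have sA : (size A <= 2)%N.
  rewrite (leq_trans (size_polyD _ _))// geq_max (leq_trans (size_scale_leq _ _)) ?size_polyX//.
  by rewrite (leq_trans (size_polyC_leq1 _)).
have dc : d - c != 0 by rewrite subr_eq0 gt_eqF.
have dc0 : 0 < d - c by rewrite subr_gt0.
have xE : A.[(x *+ 2 - (d + c)) / (d - c)] = x by rewrite AE; field.
have := HM (p \Po A) ((x *+ 2 - (d + c)) / (d - c)).
rewrite horner_comp xE; under eq_bigr do rewrite horner_comp AE.
apply; last by rewrite ler_pdivlMr// ler_pdivrMr// mulN1r mul1r; lra.
have := size_comp_poly_leq p A; move: (size p) (size A) (size _) sp sA => m n k; nia.
Qed.

(** Under an affine change of variable the sup norm of the Lobatto polynomial is unchanged while its
    top coefficient is multiplied by (2/(d - c))^(r+1). Cancelling a given top coefficient by a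
    multiple of [L] therefore costs only O((d - c)^(r+1)). *)
Lemma lobatto_itv : exists l M : R, [/\ l != 0, 0 < M & forall c d : R, c < d ->
  exists L : {poly R}, [/\ (size L <= r.+2)%N, L`_r.+1 = l * (2 / (d - c)) ^+ r.+1,
    L.[c] = 0 /\ L.[d] = 0,
    forall j, (1 <= j <= r)%N -> L^`().[2^-1 * (d + c + (d - c) * G j)] = 0 &
    forall x, c <= x <= d -> `|L.[x]| <= M]].
Proof.
have [M M0 HM] := horner_bound lobatto.
exists (lead_coef lobatto), (M + 1); split; rewrite ?ltr_wpDl//.
  by rewrite lead_coef_eq0 -size_poly_eq0 size_lobatto.
move=> c d cd; have dc : d - c != 0 by rewrite subr_eq0 gt_eqF.
have dc0 : 0 < d - c by rewrite subr_gt0.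
pose B : {poly R} := (2 / (d - c)) *: ('X - ((d + c) / 2)%:P).
have BE t : B.[t] = (t *+ 2 - (d + c)) / (d - c).
  by rewrite /B !hornerE; field.
have k0 : 2 / (d - c) != 0 by rewrite mulf_neq0 ?invr_eq0// pnatr_eq0.
have sB : size B = 2%N by rewrite size_scale// size_XsubC.
have lB : lead_coef B = 2 / (d - c) by rewrite lead_coefZ lead_coefXsubC mulr1.
have sL : (size (lobatto \Po B)).-1 = r.+1.
  by rewrite size_comp_poly size_lobatto sB muln1.
exists (lobatto \Po B); split => [||||x /andP[cx xd]].
- by move: sL; case: (size _) => [//|n /= ->].
- by rewrite -[X in _`_X]sL -/(lead_coef _) lead_coef_comp ?sB// lB size_lobatto.
- rewrite !horner_comp !BE (_ : _ / _ = -1); last by field.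
  by rewrite (_ : _ / _ = 1) ?lobatto1 ?lobattoN1//; field.
- move=> j jr; rewrite deriv_comp hornerM horner_comp BE.
  rewrite (_ : _ / _ = G j); last by field.
  by rewrite lobatto_deriv hornerZ (eqP (hG.1 j jr).2) mulr0 mul0r.
- rewrite horner_comp BE (le_trans (HM _ _)) ?lerDl//.
  by rewrite ler_pdivlMr// ler_pdivrMr// mulN1r mul1r; lra.
Qed.

End Gauss.

(** * Integrals over intervals and absolutely continuous functions *)

Set Implicit Arguments.
Unset Strict Implicit.
Unset Printing Implicit Defensive.

Section IntervalIntegral.
Context {R : realType}.
Local Notation mu := (@lebesgue_measure R).
Implicit Types (a b c d x y k M : R) (f g h : R -> R).

Lemma ae_imp (P Q : R -> Prop) : (forall t, P t -> Q t) ->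
  {ae mu, forall t, P t} -> {ae mu, forall t, Q t}.
Proof. by move=> PQ; apply: negligibleS => t /= nQ /PQ. Qed.

Lemma ae_and (P Q : R -> Prop) : {ae mu, forall t, P t} -> {ae mu, forall t, Q t} ->
  {ae mu, forall t, P t /\ Q t}.
Proof.
move=> nP nQ; apply: negligibleS (negligibleU nP nQ) => t /= /not_andP[]; by [left|right].
Qed.

Definition L1 c d g : Prop := mu.-integrable `[c, d] (EFin \o g).

Definition intg c d g : R := \int[mu]_(t in `[c, d]) g t.

Lemma L1_oo c d g : L1 c d g <-> mu.-integrable `]c, d[ (EFin \o g).
Proof.
split => [|/integrableP[mg gfin]].
  by apply: integrableS => //; apply: subset_itv; rewrite bnd_simp.
have mg' : measurable_fun `[c, d] (EFin \o g).
  by apply/emeasurable_fun_itv_obnd_cbndP/emeasurable_fun_itv_bndo_bndcP.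
apply/integrableP; split => //.
by rewrite integral_itv_bndoo//; exact: measurableT_comp.
Qed.

Lemma L1_meas c d g : L1 c d g -> measurable_fun `]c, d[ g.
Proof. by move/L1_oo => /integrableP[/measurable_EFinP]. Qed.

Lemma intg_oo c d g : L1 c d g -> intg c d g = \int[mu]_(t in `]c, d[) g t.
Proof.
move=> /L1_meas mg; rewrite /intg /Rintegral integral_itv_bndoo//.
exact/measurable_EFinP.
Qed.

Lemma L1S c d x y g : c <= x -> y <= d -> L1 c d g -> L1 x y g.
Proof.
by move=> cx yd; apply: integrableS => //; apply: subset_itv; rewrite bnd_simp.
Qed.

Lemma L1_le c d f g : measurable_fun `]c, d[ f ->
  (forall t, c < t < d -> `|f t| <= `|g t|) -> L1 c d g -> L1 c d f.
Proof.
move=> mf fg /L1_oo gi; apply/L1_oo; by apply: le_integrable gi => //; exact/measurable_EFinP.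
Qed.

Lemma L1_eq c d f g : (forall t, c < t < d -> f t = g t) -> L1 c d f -> L1 c d g.
Proof.
move=> fg /L1_oo fi; apply/L1_oo; apply: eq_integrable fi => // t.
by rewrite inE/= in_itv/= => /fg ->.
Qed.

Lemma intg_eq c d f g : (forall t, c < t < d -> f t = g t) -> L1 c d f ->
  intg c d f = intg c d g.
Proof.
move=> fg fi; rewrite !intg_oo//; last exact: L1_eq fi.
by apply: eq_Rintegral => t; rewrite inE/= in_itv/= => /fg.
Qed.

Lemma L1D c d f g : L1 c d f -> L1 c d g -> L1 c d (fun t => f t + g t).
Proof. by move=> fi gi; apply: eq_integrable (integrableD _ fi gi). Qed.

Lemma L1Z c d k g : L1 c d g -> L1 c d (fun t => k * g t).
Proof. by move=> gi; exact: (integrableZl _ k gi). Qed.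

Lemma L1B c d f g : L1 c d f -> L1 c d g -> L1 c d (fun t => f t - g t).
Proof. by move=> fi gi; apply: eq_integrable (integrableB _ fi gi). Qed.

Lemma L1_norm c d g : L1 c d g -> L1 c d (fun t => `|g t|).
Proof. exact: integrable_norm. Qed.

Lemma L1_cst c d k : L1 c d (fun=> k).
Proof.
apply: measurable_bounded_integrable => //.
  by rewrite /= lebesgue_measure_itv/=; case: ifP => // _; rewrite -EFinD ltry.
exact: bounded_cst.
Qed.

Lemma L1_within c d g : {within `[c, d], continuous g} -> L1 c d g.
Proof. by move=> cg; apply: continuous_compact_integrable => //; exact: segment_compact. Qed.

Lemma within_bounded c d g : {within `[c, d], continuous g} ->
  exists2 M, 0 <= M & forall t, c <= t <= d -> `|g t| <= M.
Proof.
move=> cg; have [dc|cd] := ltP d c.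
  by exists 0 => // t; lra.
have cng : {within `[c, d], continuous (fun t => `|g t|)}.
  by move=> t; apply: continuous_comp; [exact: cg|exact: norm_continuous].
have [m _ Hm] := EVT_max cd cng.
by exists `|g m| => // t ct; apply: Hm; rewrite in_itv.
Qed.

Lemma L1M c d f g M : measurable_fun `]c, d[ f ->
  (forall t, c < t < d -> `|f t| <= M) -> L1 c d g -> L1 c d (fun t => f t * g t).
Proof.
move=> mf fM gi; apply: (@L1_le _ _ _ (fun t => M * g t)); last exact: L1Z.
  by apply: measurable_funM => //; exact: L1_meas.
move=> t ct; rewrite !normrM ler_wpM2r// (le_trans (fM t ct))//; exact: ler_norm.
Qed.

Lemma L1M_within c d f g : {within `[c, d], continuous f} -> L1 c d g ->
  L1 c d (fun t => f t * g t).
Proof.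
move=> cf; have [M _ fM] := within_bounded cf.
apply: (@L1M _ _ _ _ M); first exact: L1_meas (L1_within cf).
by move=> t ct; apply: fM; lra.
Qed.

Lemma intgD c d f g : L1 c d f -> L1 c d g ->
  intg c d (fun t => f t + g t) = intg c d f + intg c d g.
Proof. by move=> fi gi; exact: RintegralD. Qed.

Lemma intgB c d f g : L1 c d f -> L1 c d g ->
  intg c d (fun t => f t - g t) = intg c d f - intg c d g.
Proof. by move=> fi gi; exact: RintegralB. Qed.

Lemma intgZ c d k g : L1 c d g -> intg c d (fun t => k * g t) = k * intg c d g.
Proof. by move=> gi; exact: RintegralZl. Qed.

Lemma intg0 c d : intg c d (fun=> 0) = 0.
Proof.
transitivity (intg c d (fun t => 0 * 1)); last by rewrite (intgZ 0 (L1_cst c d 1)) mul0r.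
by congr intg; apply/funext => t; rewrite mul0r.
Qed.

Lemma intg_cst c d k : c <= d -> intg c d (fun=> k) = k * (d - c).
Proof.
rewrite le_eqVlt => /predU1P[<-|cd].
  by rewrite /intg set_itv1 Rintegral_set1 subrr mulr0.
by rewrite /intg Rintegral_cst//= lebesgue_measure_itv/= lte_fin cd -EFinD.
Qed.

Lemma intg_pt c g : intg c c g = 0.
Proof. by rewrite /intg set_itv1 Rintegral_set1. Qed.

Lemma intg_split c d x g : L1 c d g -> c <= x -> x <= d ->
  intg c d g = intg c x g + intg x d g.
Proof.
move=> gi cx xd; apply/eqP; rewrite addrC -subr_eq /intg; apply/eqP.
rewrite Rintegral_itvB ?bnd_simp//; apply: Rintegral_itv_obnd_cbnd.
by apply: integrableS gi => //; apply: subset_itv; rewrite bnd_simp.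
Qed.

Lemma intg_norm c d g : L1 c d g -> `|intg c d g| <= intg c d (fun t => `|g t|).
Proof. by move=> gi; exact: le_normr_Rintegral. Qed.

Lemma intg_ge0_ae c d g : L1 c d g -> {ae mu, forall t, c < t < d -> 0 <= g t} ->
  0 <= intg c d g.
Proof.
move=> gi g0; have ngi := L1_norm gi.
suff -> : intg c d g = intg c d (fun t => `|g t|) by exact: Rintegral_ge0.
rewrite !intg_oo// /Rintegral; congr fine; apply: ae_eq_integral => //.
- by apply/measurable_EFinP; exact: L1_meas gi.
- by apply/measurable_EFinP; exact: L1_meas ngi.
- apply: (ae_imp _ g0) => t gt0 /=; rewrite in_itv/= => /gt0 {}gt0.
  by rewrite ger0_norm.
Qed.

Lemma intg_le_ae c d f g : L1 c d f -> L1 c d g ->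
  {ae mu, forall t, c < t < d -> f t <= g t} -> intg c d f <= intg c d g.
Proof.
move=> fi gi fg; rewrite -subr_ge0 -intgB//; apply: intg_ge0_ae; first exact: L1B.
by apply: (ae_imp _ fg) => t tE /tE; rewrite subr_ge0.
Qed.

Lemma intg_le c d f g : L1 c d f -> L1 c d g ->
  (forall t, c < t < d -> f t <= g t) -> intg c d f <= intg c d g.
Proof. by move=> fi gi fg; apply: intg_le_ae => //; exact: aeW. Qed.

Lemma intg_ge0 c d g : (forall t, c <= t <= d -> 0 <= g t) -> 0 <= intg c d g.
Proof. by move=> g0; apply: Rintegral_ge0 => t /=; rewrite in_itv => /g0. Qed.

Lemma intg_bound c d g M : c <= d -> L1 c d g ->
  (forall t, c < t < d -> `|g t| <= M) -> `|intg c d g| <= M * (d - c).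
Proof.
move=> cd gi gM; rewrite (le_trans (intg_norm gi))// -intg_cst//.
by apply: intg_le => //; [exact: L1_norm|exact: L1_cst].
Qed.

(** Measurability of [g] is assumed because measurable means Borel here, a property that equality
    almost everywhere does not transfer. *)
Lemma L1_eq_ae c d f g : {ae mu, forall t, c < t < d -> f t = g t} ->
  measurable_fun `]c, d[ g -> L1 c d f -> L1 c d g.
Proof.
move=> fg mg /L1_oo/integrableP[mf fi]; apply/L1_oo/integrableP; split.
  exact/measurable_EFinP.
apply: le_lt_trans fi; rewrite le_eqVlt; apply/orP; left; apply/eqP.
apply: ae_eq_integral => //.
- by do 2 apply: measurableT_comp => //.
- exact: measurableT_comp.
- by apply: (ae_imp _ fg) => t tE /=; rewrite in_itv/= => /tE ->.
Qed.

Lemma intg_eq_ae c d f g : {ae mu, forall t, c < t < d -> f t = g t} ->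
  measurable_fun `]c, d[ g -> L1 c d f -> intg c d f = intg c d g.
Proof.
move=> fg mg fi; have gi := L1_eq_ae fg mg fi.
by apply/eqP; rewrite eq_le !intg_le_ae//; apply: (ae_imp _ fg) => t tE /tE ->.
Qed.

Lemma intg_subset c d x y g : L1 c d g -> c <= x -> x <= y -> y <= d ->
  (forall t, c <= t <= d -> 0 <= g t) -> intg x y g <= intg c d g.
Proof.
move=> gi cx xy yd g0; have xd := le_trans xy yd.
rewrite (intg_split gi cx xd) (intg_split (L1S cx (lexx d) gi) xy yd).
rewrite -[leLHS]add0r lerD ?lerDl//; apply: intg_ge0 => t ct; apply: g0; lra.
Qed.

Lemma L1_cat c x d g : c <= x -> x <= d -> L1 c x g -> L1 x d g -> L1 c d g.
Proof.
move=> cx xd /integrableP[m1 f1] /integrableP[m2 f2].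
have E : [set` `[c, d]] = `[c, x] `|` `]x, d].
  by rewrite -itv_bndbnd_setU ?bnd_simp.
have m2' : measurable_fun `]x, d] (EFin \o g) by exact/emeasurable_fun_itv_obnd_cbndP.
have m12 : measurable_fun (`[c, x] `|` `]x, d]) (EFin \o g) by apply/measurable_funU.
apply/integrableP; rewrite E; split => //; rewrite ge0_integral_setU//.
- rewrite lte_add_pinfty// integral_itv_obnd_cbnd//.
  exact: (measurableT_comp _ m2').
- exact: (measurableT_comp _ m12).
- apply/disj_setPS => y [/=]; rewrite 2!in_itv/= => /andP[_ yx] /andP[].
  by rewrite ltNge yx.
Qed.

End IntervalIntegral.

(** * Absolutely continuous functions and their product rule *)

Section Primitive.
Context {R : realType}.
Local Notation mu := (@lebesgue_measure R).
Implicit Types (a b c d x y k M : R) (f g v V F G : R -> R).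

(** Absolute continuity of [V] on [c, d], with derivative [v]. *)
Definition primitive c d V v : Prop := L1 c d v /\
  forall x y, c <= x -> x <= y -> y <= d -> V y - V x = intg x y v.

Lemma primitive_intg c d v : L1 c d v -> primitive c d (fun x => intg c x v) v.
Proof.
move=> vi; split=> // x y cx xy yd.
rewrite (@intg_split _ c y x)//; first by rewrite addrC addKr.
exact: L1S vi.
Qed.

Lemma primitiveS c d x y V v : c <= x -> y <= d -> primitive c d V v -> primitive x y V v.
Proof.
move=> cx yd [vi Vv]; split; first exact: L1S vi.
by move=> s t xs st ty; apply: Vv => //; lra.
Qed.

Lemma primitive_eq c d V W v w : (forall t, c <= t <= d -> V t = W t) ->
  (forall t, c < t < d -> v t = w t) -> primitive c d V v -> primitive c d W w.
Proof.
move=> VW vw [vi Vv]; split; first exact: L1_eq vi.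
move=> x y cx xy yd; rewrite -!VW; try lra; rewrite Vv//; apply: intg_eq.
  by move=> t xy'; apply: vw; lra.
exact: L1S vi.
Qed.

Lemma primitive_ae c d V v w : {ae mu, forall t, c < t < d -> v t = w t} ->
  measurable_fun `]c, d[ w -> primitive c d V v -> primitive c d V w.
Proof.
move=> vw mw [vi Vv]; split; first exact: L1_eq_ae vi.
move=> x y cx xy yd; rewrite Vv//; apply: intg_eq_ae.
- by apply: (ae_imp _ vw) => t tE xy'; apply: tE; lra.
- by apply: measurable_funS mw => //; apply: subset_itv; rewrite bnd_simp.
- exact: L1S vi.
Qed.

Lemma primitiveD c d V W v w : primitive c d V v -> primitive c d W w ->
  primitive c d (fun t => V t + W t) (fun t => v t + w t).
Proof.
move=> [vi Vv] [wi Ww]; split; first exact: L1D.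
move=> x y cx xy yd; rewrite intgD; [|exact: L1S vi|exact: L1S wi].
by rewrite -Vv// -Ww//; ring.
Qed.

Lemma primitive_shift c d V v k : primitive c d V v ->
  primitive c d (fun t => k + V t) v.
Proof.
by move=> [vi Vv]; split=> // x y cx xy yd; rewrite -Vv//; ring.
Qed.

Lemma primitiveB c d V W v w : primitive c d V v -> primitive c d W w ->
  primitive c d (fun t => V t - W t) (fun t => v t - w t).
Proof.
move=> [vi Vv] [wi Ww]; split; first exact: L1B.
move=> x y cx xy yd; rewrite intgB; [|exact: L1S vi|exact: L1S wi].
by rewrite -Vv// -Ww//; ring.
Qed.

Lemma primitive_cat c x d V v : c <= x -> x <= d ->
  primitive c x V v -> primitive x d V v -> primitive c d V v.
Proof.
move=> cx xd [v1 V1] [v2 V2]; have vi := L1_cat cx xd v1 v2; split => //.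
move=> s t cs st td; have [tx|xt] := leP t x; first exact: V1.
have [xs|sx] := leP x s; first exact: V2.
rewrite (@intg_split _ s t x) ?(ltW xt) ?(ltW sx)//; last exact: L1S vi.
by rewrite -V1 ?lexx// -?V2 ?lexx// ?(ltW xt) ?(ltW sx)//; ring.
Qed.

Lemma primitive_mesh (X : nat -> R) N V v : (forall i, (i < N)%N -> X i <= X i.+1) ->
  (forall i, (i < N)%N -> primitive (X i) (X i.+1) V v) -> primitive (X 0%N) (X N) V v.
Proof.
elim: N => [|N IH] mX Vv.
  split=> [|x y x0 xy y0].
    by apply/L1_oo; rewrite set_itv_ge ?bnd_simp ?ltxx//; exact: integrable_set0.
  have -> : x = y by apply/eqP; rewrite eq_le xy (le_trans y0).
  by rewrite intg_pt subrr.
apply: (@primitive_cat _ (X N)); last exact: Vv.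
- elim: N mX {IH Vv} => // N IH mX; rewrite (le_trans (IH _)) ?mX// => i iN.
  by rewrite mX// ltnS ltnW.
- exact: mX.
- by apply: IH => i iN; [apply: mX|apply: Vv]; rewrite ltnS ltnW.
Qed.

Lemma primitive_within c d V v : c <= d -> primitive c d V v ->
  {within `[c, d], continuous V}.
Proof.
move=> cd [vi Vv].
apply: (@subspace_eq_continuous _ _ _ (fun x => V c + intg c x v)).
  move=> x; rewrite inE/= in_itv/= => /andP[cx xd].
  by change (V c + intg c x v = V x); rewrite -Vv//; ring.
move=> x; apply: cvgD; first exact: cvg_cst.
exact: (parameterized_integral_continuous cd vi).
Qed.

Lemma primitive_horner c d (p : {poly R}) : primitive c d (horner p) (horner p^`()).
Proof.
have ch q A : {within A, continuous (horner (q : {poly R}))}.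
  exact/continuous_subspaceT/continuous_horner.
split; first exact/L1_within/ch.
move=> x y cx; rewrite le_eqVlt => /predU1P[->|xy] yd; first by rewrite intg_pt subrr.
rewrite /intg /Rintegral (@continuous_FTC2 _ _ (horner p))//.
- split.
  + by move=> t _; exact: derivable_horner.
  + by apply: cvg_at_right_filter; exact: continuous_horner.
  + by apply: cvg_at_left_filter; exact: continuous_horner.
- by move=> t _; rewrite derivE.
Qed.

Lemma primitive_uniq c d V W v : primitive c d V v -> primitive c d W v ->
  V c = W c -> forall t, c <= t <= d -> V t = W t.
Proof.
move=> [vi Vv] [_ Wv] VW t /andP[ct td].
have := Vv c t (lexx c) ct td; rewrite -(Wv c t (lexx c) ct td) VW; lra.
Qed.

Lemma eq0_bigO_inv (z K : R) : (forall n, `|z| <= K / n.+1%:R) -> z = 0.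
Proof.
move=> H; apply/eqP; rewrite -normr_le0 leNgt; apply/negP => z0.
have K0 : 0 < K by have := H 0%N; rewrite divr1; lra.
have := H (Num.truncn (K / `|z|)); rewrite leNgt => /negP; apply.
rewrite ltr_pdivrMr ?ltr0n// mulrC -ltr_pdivrMr//.
by rewrite truncnS_gt.
Qed.

(** Cut [c, d] into n+1 equal pieces: the lengths shrink like 1/(n+1) while the increments of [A]
    add up to a fixed number, so the increment of [D] is O(1/n). *)
Lemma sum_le_small (D A : R -> R) c d K : c <= d -> 0 <= K ->
  (forall x y, c <= x -> x <= y -> y <= d -> `|D y - D x| <= K * (y - x) * (A y - A x)) ->
  D d = D c.
Proof.
move=> cd K0 H; apply/eqP; rewrite -subr_eq0; apply/eqP.
apply: (@eq0_bigO_inv _ (K * (d - c) * (A d - A c))) => n.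
pose e := (d - c) / n.+1%:R; pose t i := c + e * i%:R.
have n0 : 0 < n.+1%:R :> R by rewrite ltr0n.
have e0 : 0 <= e by rewrite divr_ge0 ?subr_ge0// ltW.
have t0 : t 0%N = c by rewrite /t mulr0 addr0.
have tn : t n.+1 = d by rewrite /t /e divfK ?gt_eqF//; ring.
have tm i j : (i <= j)%N -> t i <= t j by move=> ij; rewrite lerD2l ler_wpM2l// ler_nat.
have -> : D d - D c = \sum_(0 <= i < n.+1) (D (t i.+1) - D (t i)).
  by rewrite (telescope_sumr (D \o t))//= t0 tn.
rewrite (le_trans (ler_norm_sum _ _ _))//.
have -> : K * (d - c) * (A d - A c) / n.+1%:R =
    \sum_(0 <= i < n.+1) K * e * (A (t i.+1) - A (t i)).
  by rewrite -mulr_sumr (telescope_sumr (A \o t))//= t0 tn /e; ring.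
rewrite big_nat [leRHS]big_nat; apply: ler_sum => i /= iN.
rewrite (le_trans (H _ _ _ (tm _ _ (leqnSn i)) _))//.
- by rewrite -t0 tm.
- by rewrite -tn tm.
- by have -> : t i.+1 - t i = e by rewrite /t -natr1; ring.
Qed.

(* The defect of the product rule over [x, y] is at most
   [(y - x) * intg x y |g|], hence vanishes by subdivision. *)
Lemma primitiveM c d F G f g M :
  primitive c d F f -> primitive c d G g -> (forall t, c < t < d -> `|f t| <= M) ->
  primitive c d (fun t => F t * G t) (fun t => f t * G t + F t * g t).
Proof.
move=> Ff Gg fM; have [dc|cd] := ltP d c.
  split; first by apply/L1_oo; rewrite set_itv_ge ?bnd_simp -?leNgt ?ltW//; exact: integrable_set0.
  by move=> x y; lra.
have cF := primitive_within cd Ff; have cG := primitive_within cd Gg.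
have [[fi FE] [gi GE]] := (Ff, Gg).
have fGi : L1 c d (fun t => f t * G t).
  by under eq_fun do rewrite mulrC; exact: L1M_within.
have Fgi : L1 c d (fun t => F t * g t) by exact: L1M_within.
split=> [|x y cx xy yd]; first exact: L1D.
(* For c = d the bound on [f] is vacuous and [M] may be negative. *)
have M0 : 0 <= M \/ c = d.
  have [->|] := eqVneq c d; first by right.
  move=> cd'; left; rewrite (le_trans _ (fM ((c + d) / 2) _))//.
  by move: cd cd'; rewrite le_eqVlt => /orP[->//|]; lra.
case: M0 => [M0|cd']; last first.
  have -> : x = y by apply/eqP; rewrite eq_le xy (le_trans yd)// -cd'.
  by rewrite intg_pt subrr.
pose D z := F z * G z - intg c z (fun t => f t * G t + F t * g t).
pose A z := intg c z (fun t => `|g t|).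
have iD z w : c <= z -> w <= d -> L1 z w (fun t => f t * G t + F t * g t).
  by move=> cz wd; apply: L1S (L1D fGi Fgi).
have ngi := L1_norm gi.
suff DE : D y = D x.
  have := intg_split (iD c y (lexx c) yd) cx xy; move: DE; rewrite /D; lra.
apply: (@sum_le_small D A x y (2 * M)) => //; first by lra.
move=> z w xz zw wy.
have cz := le_trans cx xz; have wd := le_trans wy yd.
have cw := le_trans cz zw; have zd := le_trans zw wd.
have AE : A w - A z = intg z w (fun t => `|g t|).
  rewrite /A (intg_split (L1S (lexx c) wd ngi) cz zw); ring.
have Fb s t : z <= s -> s <= t -> t <= w -> `|F t - F s| <= M * (w - z).
  move=> zs st tw; rewrite FE; [|lra..].
  rewrite (le_trans (@intg_bound _ _ _ _ M st _ _))//; first by apply: L1S fi; lra.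
    by move=> u su; apply: fM; lra.
  by rewrite ler_wpM2l//; lra.
have Gb s t : z <= s -> s <= t -> t <= w -> `|G t - G s| <= A w - A z.
  move=> zs st tw; rewrite GE; [|lra..].
  rewrite AE (le_trans (intg_norm _))//; first by apply: L1S gi; lra.
  by apply: intg_subset => //; apply: L1S ngi.
have gzw : L1 z w g by exact: L1S gi.
have fzw : L1 z w f by exact: L1S fi.
have fGzw : L1 z w (fun t => f t * G t) by exact: L1S fGi.
have Fgzw : L1 z w (fun t => F t * g t) by exact: L1S Fgi.
(* Freezing [F] at the right end and [G] at the left end is exact: F(w)(G(w) - G(z)) + G(z)(F(w) -
   F(z)) is the increment of the product. *)
have -> : D w - D z = intg z w (fun t => (F w - F t) * g t) +
                      intg z w (fun t => f t * (G z - G t)).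
  have -> : intg z w (fun t => (F w - F t) * g t) = F w * (G w - G z) - intg z w (fun t => F t * g t).
    rewrite GE// -intgZ// -intgB//; last exact: L1Z.
    by congr intg; apply/funext => t; rewrite mulrBl.
  have -> : intg z w (fun t => f t * (G z - G t)) = G z * (F w - F z) - intg z w (fun t => f t * G t).
    rewrite FE// -intgZ// -intgB//; last exact: L1Z.
    by congr intg; apply/funext => t; rewrite mulrBr [f t * G z]mulrC.
  have := intg_split (iD c w (lexx c) wd) cz zw; rewrite (intgD fGzw Fgzw) /D => ->.
  ring.
rewrite (le_trans (ler_normD _ _))//.
have -> : 2 * M * (w - z) * (A w - A z) =
  M * (w - z) * (A w - A z) + M * (A w - A z) * (w - z) by ring.
apply: lerD.
  have i1 : L1 z w (fun t => (F w - F t) * g t).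
    apply: L1_eq (L1B (L1Z (F w) gzw) Fgzw) => t _; ring.
  rewrite AE -intgZ; last exact: L1S ngi.
  rewrite (le_trans (intg_norm i1))//; apply: intg_le.
  - exact: L1_norm.
  - by apply: L1Z; exact: L1S ngi.
  - by move=> t zt; rewrite normrM ler_wpM2r// Fb//; lra.
apply: intg_bound => //.
  apply: L1_eq (L1B (L1Z (G z) fzw) fGzw) => t _; ring.
move=> t zt; rewrite normrM ler_pM// ?fM//; first lra.
by rewrite distrC Gb//; lra.
Qed.

End Primitive.

(** * Weak derivatives *)

Section WeakDerivative.
Context {R : realType}.
Local Notation mu := (@lebesgue_measure R).
Implicit Types (a b c d s t x y k M : R) (f g v w V F G psi : R -> R).

Lemma itv_not_negligible c d : c < d -> ~ mu.-negligible [set` `]c, d[].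
Proof.
move=> cd /negligibleP => /(_ (measurable_itv _)).
rewrite /= lebesgue_measure_itv/= lte_fin cd -EFinD => -[]; lra.
Qed.

Lemma Lp1_L1 c d v : Lp 1%E c d v <-> L1 c d v.
Proof.
rewrite /Lp L1_oo; split.
  move=> /Lfun1_integrable vi; apply/(integrable_mkcond _ _).2 => //.
  by rewrite restrict_EFin.
move=> /(integrable_mkcond _ _).1 => /(_ (measurable_itv _)).
by rewrite restrict_EFin => /Lfun1_integrable.
Qed.

Lemma intg_indep_up c d x psi : continuous psi -> c <= d -> d <= x ->
  (forall t, d <= t -> psi t = 0) -> intg c x psi = intg c d psi.
Proof.
move=> cpsi cd dx psi0.
have psiI p q : L1 p q psi by exact/L1_within/continuous_subspaceT.
rewrite (intg_split (psiI c x) cd dx) -[RHS]addr0; congr (_ + _).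
rewrite (@intg_eq _ _ _ _ (fun=> 0)) ?intg_cst ?mul0r// => t tx.
by apply: psi0; lra.
Qed.

(** Source of test functions: the primitive of a continuous function supported in [p, q] is constant
    beyond q, and mean zero makes that constant 0. *)
Lemma C1c_intg c d p q psi : c < p -> p <= q -> q < d -> continuous psi ->
  (forall x, x <= p \/ q <= x -> psi x = 0) -> intg c d psi = 0 ->
  C1c c d (fun x => intg c x psi) /\ (fun x => intg c x psi)^`()%classic = psi.
Proof.
move=> cp pq qd cpsi psi0 intpsi.
have psiI x y : L1 x y psi by exact/L1_within/continuous_subspaceT.
have phi0 x : x <= p -> intg c x psi = 0.
  move=> xp; have [xc|cx] := ltP x c.
    by rewrite /intg set_itv_ge ?Rintegral_set0// bnd_simp -ltNge.
  rewrite (@intg_eq _ _ _ _ (fun=> 0)) ?intg_cst ?mul0r// => t tx.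
  by apply: psi0; left; lra.
have phi1 x : q <= x -> intg c x psi = 0.
  move=> qx; rewrite -intpsi (@intg_indep_up c q x)//; [|lra|by move=> t qt; apply: psi0; right].
  by rewrite (@intg_indep_up c q d)//; [lra|lra|move=> t qt; apply: psi0; right].
have D x : derivable (fun x => intg c x psi) x 1 /\ (fun x => intg c x psi)^`()%classic x = psi x.
  have [cx|xc] := ltP c x.
    by have [] := @continuous_FTC1_closed _ psi c x (x + 1) (ltr_pwDr ltr01 (lexx x))
      (psiI _ _) cx (cpsi x).
  (* The fundamental theorem of calculus serves only to the right of c. For x <= c the primitive is
     identically 0 near x, because x < p. *)
  have near0 : \near x, (cst 0 : R -> R) x = intg c x psi.
    have xp : x < p by exact: le_lt_trans cp.
    by near=> y; rewrite phi0//; near: y; apply: filterS (lt_nbhsl xp) => y /ltW.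
  split; first by apply: near_eq_derivable near0 _; exact: derivable_cst.
  rewrite derive1E -(near_eq_derive _ near0) -derive1E derive1_cst psi0//; left; lra.
have DE : (fun x => intg c x psi)^`()%classic = psi.
  by apply/funext => x; case: (D x).
split=> //; split; first by move=> x; case: (D x).
  by rewrite DE.
apply: (@subset_trans _ `[p, q]); last by apply: subset_itv; rewrite bnd_simp.
rewrite [X in _ `<=` X](closure_id _).1; last exact: itv_closed.
apply: closureS => x /= /eqP x0; rewrite in_itv/=.
apply/andP; split; rewrite leNgt; apply/negP => /ltW; [move/phi0|move/phi1] => //.
Unshelve. all: by end_near. Qed.

(** The parabola with zeros at s and s + e; the factor 6/e gives it integral 1 over [s, s + e]. *)
Definition bumpP s e : {poly R} :=
  (6 / e) *: ((e^-1 *: ('X - s%:P)) * (1%:P - e^-1 *: ('X - s%:P))).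

(** The positive part of the parabola, in a form whose continuity is immediate. Continuity is all
    that is required of it, since test functions are primitives of differences of bumps. *)
Definition bump s e x := ((bumpP s e).[x] + `|(bumpP s e).[x]|) / 2.

Lemma bumpPE s e x : (bumpP s e).[x] = 6 / e * ((x - s) / e * (1 - (x - s) / e)).
Proof. by rewrite /bumpP hornerZ hornerM hornerD hornerN hornerZ hornerXsubC hornerC; ring. Qed.

Lemma bump_cont s e : continuous (bump s e).
Proof.
have ch := @continuous_horner R (bumpP s e).
move=> x; rewrite /bump; apply: cvgMl; apply: cvgD; first exact: ch.
by apply: cvg_norm; exact: ch.
Qed.

Lemma bump_out s e x : 0 < e -> x <= s \/ s + e <= x -> bump s e x = 0.
Proof.
move=> e0 H; rewrite /bump ler0_norm ?addrN ?mul0r// bumpPE.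
have e1 : 0 < 6 / e by rewrite divr_gt0.
rewrite pmulr_rle0//; case: H => H.
  rewrite mulr_le0_ge0// ?pmulr_lle0 ?invr_gt0// ?subr_le0// subr_ge0.
  by rewrite ler_pdivrMr// mul1r; lra.
rewrite mulr_ge0_le0// ?divr_ge0 ?(ltW e0)//; first by lra.
by rewrite subr_le0 ler_pdivlMr// mul1r; lra.
Qed.

Lemma bump_in s e x : 0 < e -> s <= x <= s + e ->
  bump s e x = (bumpP s e).[x] /\ 0 <= bump s e x <= 3 / 2 / e.
Proof.
move=> e0 /andP[sx xe].
set y := (x - s) / e.
have y0 : 0 <= y by rewrite divr_ge0 ?(ltW e0)// subr_ge0.
have y1 : y <= 1 by rewrite ler_pdivrMr// mul1r; lra.
have e1 : 0 < e^-1 by rewrite invr_gt0.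
have p0 : 0 <= (bumpP s e).[x].
  by rewrite bumpPE -/y mulr_ge0 ?divr_ge0 ?(ltW e0)// mulr_ge0// subr_ge0.
have bE : bump s e x = (bumpP s e).[x] by rewrite /bump ger0_norm//; field.
split=> //; rewrite bE p0/= bumpPE -/y.
have -> : 3 / 2 / e = 6 / e * 4^-1 by field; lra.
have yq : y * (1 - y) <= 4^-1 by have := sqr_ge0 (y - 2^-1); rewrite expr2; nra.
by apply: ler_wpM2l => //; rewrite divr_ge0// ltW.
Qed.

Lemma intg_bump s e : 0 < e -> intg s (s + e) (bump s e) = 1.
Proof.
move=> e0; pose y : {poly R} := e^-1 *: ('X - s%:P).
pose Q : {poly R} := 3 *: (y * y) - 2 *: (y * y * y).
have yE x : y.[x] = (x - s) / e by rewrite /y !hornerE; ring.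
have y' : y^`() = (e^-1)%:P.
  by rewrite /y derivZ derivXsubC alg_polyC.
have Q' : Q^`() = bumpP s e.
  rewrite /Q derivB !derivZ !derivM y' /bumpP -/y -!mul_polyC polyCM.
  by rewrite -[6](_ : 2 * 3 = _) ?polyCM; [ring|rewrite -natrM].
have := (primitive_horner s (s + e) Q).2 s (s + e) (lexx _) _ (lexx _).
rewrite Q' => /(_ _)/esym H.
rewrite -(@intg_eq _ _ _ (horner (bumpP s e))) ?H.
- clearbody y; have QE x : Q.[x] = 3 * (y.[x] * y.[x]) - 2 * (y.[x] * y.[x] * y.[x]).
    by rewrite /Q hornerD hornerN !hornerZ !hornerM.
  by rewrite !QE !yE; field; lra.
- by lra.
- by move=> t st; rewrite (bump_in e0 _).1//; lra.
- exact/L1_within/continuous_subspaceT/continuous_horner.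
Qed.

Lemma intg_bump_sub c d s e w : L1 c d w -> 0 < e -> c <= s -> s + e <= d ->
  intg c d (fun x => w x * bump s e x) = intg s (s + e) (fun x => w x * bump s e x).
Proof.
move=> wi e0 cs sd; have se : s <= s + e by lra.
have I x y : c <= x -> y <= d -> L1 x y (fun x => w x * bump s e x).
  move=> cx yd; under eq_fun do rewrite mulrC.
  by apply: L1M_within; [exact/continuous_subspaceT/bump_cont|exact: L1S wi].
have sd' : s <= d by lra.
rewrite (intg_split (I c d (lexx _) (lexx _)) cs sd') (intg_split (I s d cs (lexx _)) se sd).
have z x y : c <= x -> x <= y -> y <= d -> (y <= s \/ s + e <= x) ->
    intg x y (fun x => w x * bump s e x) = 0.
  move=> cx xy yd H; rewrite (@intg_eq _ _ _ _ (fun=> 0)) ?intg_cst ?mul0r//; last exact: I.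
  by move=> t xt; rewrite bump_out ?mulr0//; case: H => H; [left|right]; lra.
rewrite (z c s (lexx _) cs sd' (or_introl (lexx _))) add0r.
by rewrite (z _ _ (le_trans cs se) sd (lexx _) (or_intror (lexx _))) addr0.
Qed.

(** At a Lebesgue point the averages against these kernels converge to the value, because a kernel
    of width r is bounded by 3/(2r). *)
Lemma lebesgue_bump c d w s : L1 c d w -> c < s -> s < d ->
  lebesgue_pt (w \_ [set` `[c, d]]) s ->
  forall e, 0 < e -> exists2 r0, 0 < r0 & forall r, 0 < r -> r < r0 ->
    s + r < d /\ `|intg s (s + r) (fun x => w x * bump s r x) - w s| <= e.
Proof.
move=> wi cs sd ls e e0; set W := w \_ _ in ls.
(* The ball of radius 2r contains [s, s + r] and has length 4r; the 6 comes from 3/(2r) * (e/6) * 4r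
   = e. *)
have e6 : 0 < e / 6 by rewrite divr_gt0.
have /fine_cvgP[[d1 /= d10 H1] /cvgrPdist_lt/(_ _ e6)[d2 /= d20 H2]] := ls.
pose r0 := Num.min (Num.min d1 d2) (Num.min (s - c) (d - s)) / 2.
have r00 : 0 < r0 by rewrite divr_gt0// !lt_min d10 d20 !subr_gt0 cs sd.
exists r0 => // r r0' rr.
have : r * 2 < Num.min (Num.min d1 d2) (Num.min (s - c) (d - s)) by rewrite -ltr_pdivlMr.
rewrite !lt_min => /andP[/andP[rd1 rd2] /andP[rc rd]].
split; first by lra.
have r2 : 0 < r * 2 by rewrite mulr_gt0.
have bl z : r * 2 < z -> `|0 - r * 2| < z by rewrite sub0r normrN gtr0_norm.
have := H2 (r * 2) (bl _ rd2) r2; have := H1 (r * 2) (bl _ rd1) r2.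
have Ws : W s = w s.
  by rewrite /W patchE ifT// inE/= in_itv/=; lra.
have wiB : L1 (s - r * 2) (s + r * 2) (fun x => `|w x - w s|).
  by apply: L1_norm; apply: L1B; [apply: L1S wi; lra|exact: L1_cst].
have -> : davg W s (r * 2) =
    ((r * 4)^-1 * intg (s - r * 2) (s + r * 2) (fun x => `|w x - w s|))%:E.
  rewrite /davg /iavg lebesgue_measure_ball ?(ltW r2)// ball_itv.
  rewrite inver gt_eqF; last by rewrite mulr2n; lra.
  rewrite intg_oo// /Rintegral EFinM fineK; last first.
    by apply: integrable_fin_num => //; apply/L1_oo.
  congr (_ * _)%E; first by congr (_^-1%:E); rewrite mulr2n; ring.
  apply: eq_integral => x; rewrite inE/= in_itv/= => xs.
  by rewrite Ws /W patchE ifT// inE/= in_itv/=; lra.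
move=> _; rewrite /= sub0r normrN.
set J := intg (s - r * 2) _ _ => HJ.
have J0 : 0 <= J by apply: intg_ge0.
have {HJ} HJ : J <= e / 6 * (r * 4).
  move: HJ; rewrite ger0_norm ?mulr_ge0 ?invr_ge0//; last by lra.
  by rewrite mulrC ltr_pdivrMr; [exact: ltW|lra].
have ws : L1 s (s + r) w by apply: L1S wi; lra.
have cb : {within `[s, (s + r)], continuous (bump s r)}.
  exact/continuous_subspaceT/bump_cont.
have I1 : L1 s (s + r) (fun x => w x * bump s r x).
  by under eq_fun do rewrite mulrC; exact: L1M_within.
have I2 : L1 s (s + r) (fun x => w s * bump s r x) by apply: L1Z; exact: L1_within.
have -> : intg s (s + r) (fun x => w x * bump s r x) - w s =
    intg s (s + r) (fun x => w x * bump s r x - w s * bump s r x).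
  by rewrite intgB// intgZ ?intg_bump ?mulr1//; exact: L1_within.
rewrite (le_trans (intg_norm (L1B I1 I2)))//.
have wiS : L1 s (s + r) (fun x => `|w x - w s|) by apply: L1S wiB; lra.
apply: (@le_trans _ _ (3 / 2 / r * intg s (s + r) (fun x => `|w x - w s|))).
  rewrite -intgZ//; apply: intg_le; [by apply: L1_norm; exact: L1B|exact: L1Z|].
  move=> x xs; rewrite -mulrBl normrM mulrC ler_wpM2r//.
  have [|_ /andP[b0 b1]] := @bump_in s r x r0' _; first by lra.
  by rewrite ger0_norm.
have : intg s (s + r) (fun x => `|w x - w s|) <= J.
  by apply: intg_subset => //; lra.
have r3 : 0 < 3 / 2 / r by rewrite divr_gt0.
move=> /(fun H => le_trans H HJ) H; rewrite (le_trans (ler_wpM2l (ltW r3) H))//.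
by rewrite le_eqVlt; apply/orP; left; apply/eqP; field; lra.
Qed.

(* Du Bois-Reymond: [w = v - intg c _ g] is orthogonal to every difference of two
   bumps, hence takes the same value at any two Lebesgue points. *)
Lemma weak_primitive c d v g : c < d -> is_wderiv c d v g ->
  exists V, [/\ primitive c d V g,
    {ae mu, forall t, c < t < d -> v t = V t} &
    forall t, c < t < d -> {for t, continuous v} -> v t = V t].
Proof.
move=> cd [/Lp1_L1 vi /Lp1_L1 gi vg].
pose V0 := fun x => intg c x g; have V0g : primitive c d V0 g := primitive_intg gi.
have cV0 := primitive_within (ltW cd) V0g.
pose w x := v x - V0 x; have wi : L1 c d w by apply: L1B => //; exact: L1_within.
have bI s r x y : c <= x -> y <= d -> L1 x y (fun x => w x * bump s r x).
  move=> cx yd; under eq_fun do rewrite mulrC.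
  by apply: L1M_within; [exact/continuous_subspaceT/bump_cont|exact: L1S wi].
have key s t r : c < s -> s + r < d -> c < t -> t + r < d -> 0 < r ->
    intg s (s + r) (fun x => w x * bump s r x) = intg t (t + r) (fun x => w x * bump t r x).
  move=> cs sd ct td r0.
  pose psi x := bump s r x - bump t r x.
  have bi u p q : L1 p q (bump u r) by exact/L1_within/continuous_subspaceT/bump_cont.
  have cpsi : continuous psi by move=> x; apply: cvgB; exact: bump_cont.
  have bump1 u : c < u -> u + r < d -> intg c d (bump u r) = 1.
    move=> cu ud; rewrite -(@intg_bump u r r0).
    have := @intg_bump_sub c d u r (fun=> 1) (L1_cst _ _ _) r0 (ltW cu) (ltW ud).
    by rewrite (_ : (fun x => 1 * _) = bump u r)//; apply/funext => x; rewrite mul1r.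
  have ipsi : intg c d psi = 0 by rewrite /psi intgB// !bump1// subrr.
  have [||||C1 dphi] := @C1c_intg c d (Num.min s t) (Num.max s t + r) psi _ _ _ cpsi _ ipsi.
  - by rewrite lt_min cs.
  - by case: (leP s t); lra.
  - by case: (leP s t).
  - move=> x; rewrite le_min => H; rewrite /psi !bump_out ?subrr//.
      by case: H => [/andP[_ xt]|H]; [left|right; move: H; case: (leP s t); lra].
    by case: H => [/andP[xs _]|H]; [left|right; move: H; case: (leP s t); lra].
  have := vg _ C1; rewrite dphi.
  set phi := fun x => intg c x psi.
  have phip : primitive c d phi psi by apply: primitive_intg; exact/L1_within/continuous_subspaceT.
  have cphi := primitive_within (ltW cd) phip.
  have [B _ HB] : exists2 B, 0 <= B & forall t, c <= t <= d -> `|psi t| <= B.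
    exact/within_bounded/continuous_subspaceT.
  have := (@primitiveM _ c d phi V0 psi g B phip V0g _).
  case=> [u cu|_ /(_ c d (lexx _) (ltW cd) (lexx _))]; first by apply: HB; lra.
  have phid : phi d = 0 by exact: ipsi.
  rewrite phid /V0 intg_pt mul0r mulr0 subrr.
  have gphi : L1 c d (fun x => g x * phi x).
    by under eq_fun do rewrite mulrC; exact: L1M_within.
  have phig : L1 c d (fun x => phi x * g x) by exact: L1M_within.
  have psiV : L1 c d (fun x => psi x * V0 x).
    by apply: L1M_within; [exact/continuous_subspaceT|exact: L1_within].
  have vpsi : L1 c d (fun x => v x * psi x).
    by under eq_fun do rewrite mulrC; apply: L1M_within => //; exact/continuous_subspaceT.
  rewrite (intgD psiV phig) => /esym/eqP; rewrite addr_eq0 => /eqP E1.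
  rewrite -(intg_oo vpsi) -(intg_oo gphi) => E2.
  have gp : intg c d (fun x => g x * phi x) = intg c d (fun x => phi x * g x).
    by congr intg; apply/funext => x; rewrite mulrC.
  have Z : intg c d (fun x => w x * psi x) = 0.
    transitivity (intg c d (fun x => v x * psi x - psi x * V0 x)).
      by congr intg; apply/funext => x; rewrite /w; ring.
    by rewrite (intgB vpsi psiV) E2 gp E1 opprK addNr.
  have Z' : intg c d (fun x => w x * psi x) =
      intg c d (fun x => w x * bump s r x) - intg c d (fun x => w x * bump t r x).
    rewrite -(intgB (bI s r c d (lexx _) (lexx _)) (bI t r c d (lexx _) (lexx _))).
    by congr intg; apply/funext => x; rewrite /psi mulrBr.
  rewrite -(intg_bump_sub wi r0 (ltW cs) (ltW sd)) -(intg_bump_sub wi r0 (ltW ct) (ltW td)).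
  by apply/eqP; rewrite -subr_eq0 -Z' Z.
pose lp t := lebesgue_pt (w \_ [set` `[c, d]]) t.
have wconst s t : c < s < d -> c < t < d -> lp s -> lp t -> w s = w t.
  move=> /andP[cs sd] /andP[ct td] ls lt; apply/eqP; rewrite -subr_eq0 -normr_le0.
  rewrite leNgt; apply/negP => st0; set e := `|_| in st0.
  have e4 : 0 < e / 4 by rewrite divr_gt0.
  have [r1 r10 H1] := lebesgue_bump wi cs sd ls e4.
  have [r2 r20 H2] := lebesgue_bump wi ct td lt e4.
  pose r := Num.min r1 r2 / 2.
  have r0 : 0 < r by rewrite divr_gt0// lt_min r10.
  have [rr1 rr2] : r < r1 /\ r < r2.
    by rewrite /r; case: (leP r1 r2); lra.
  have [sr Hs] := H1 r r0 rr1; have [tr Ht] := H2 r r0 rr2.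
  move: Hs Ht; rewrite (key s t r)//; set I := intg _ _ _ => Hs Ht.
  have : e <= e / 4 + e / 4.
    rewrite {1}/e (_ : w s - w t = (I - w t) - (I - w s)); last by ring.
    by rewrite (le_trans (ler_normB _ _))// lerD.
  lra.
have aelp : {ae mu, forall t, lp t}.
  apply: lebesgue_differentiation.
  exact: integrable_locally_restrict.
have [s [cs ls]] : exists s, c < s < d /\ lp s.
  apply: contrapT => /forallNP H.
  apply: (itv_not_negligible cd).
  by apply: negligibleS aelp => t /=; rewrite in_itv/= => ct lt; apply: (H t).
exists (fun x => w s + V0 x); split.
- exact: primitive_shift.
- apply: ae_imp aelp => t lt ct.
  by rewrite (wconst s t cs ct ls lt) /w subrK.
(* A continuity point of [v] is one of [w], hence a Lebesgue point. This pointwise conclusion later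
   identifies the flux at the Gauss points, which a statement almost everywhere could not do. *)
- move=> t ct vt; suff lt : lp t by rewrite (wconst s t cs ct ls lt) /w subrK.
  have /andP[ct' td] := ct.
  apply: (@lebesgue_pt_restrict R w (BLeft c) t d) => //.
  apply: (@continuous_lebesgue_pt _ _ _ [set` `]c, d[]) => //.
  + exact: L1_meas wi.
  + apply: cvgB => //; apply: (within_continuous_continuous cd cV0).
    by rewrite in_itv.
Qed.

End WeakDerivative.

(** * Lebesgue norms *)

Section LpBounds.
Context {R : realType}.
Local Notation mu := (@lebesgue_measure R).
Implicit Types (a b c d s t x y k M : R) (f g v w : R -> R).

Lemma Lp_meas p c d v : Lp p c d v -> measurable_fun `]c, d[ v.
Proof.
move=> /sub_Lfun_mfun; rewrite inE => mv.
by apply/(measurable_restrictT _ _).2 => //; exact: mv.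
Qed.

Lemma L2norm_ge0 c d v : 0 <= L2norm c d v.
Proof. by rewrite fine_ge0// Lnorm_ge0. Qed.

Lemma L2norm_sqr c d v : L1 c d (fun t => v t ^+ 2) ->
  L2norm c d v ^+ 2 = intg c d (fun t => v t ^+ 2).
Proof.
move=> vi; rewrite /L2norm.
set N := Lnorm _ _ _.
have N0 : (0 <= N)%E by exact: Lnorm_ge0.
have NE : poweR N 2 = (intg c d (fun t => v t ^+ 2))%:E.
  rewrite /N poweR_Lnorm ?pnatr_eq0// intg_oo// /Rintegral fineK; last first.
    by apply: integrable_fin_num => //; exact/L1_oo.
  rewrite [RHS]integral_mkcond; apply: eq_integral => t _ /=.
  rewrite powR_mulrn// real_normK ?num_real//.
  by rewrite !patchE; case: ifP => //=; rewrite expr0n.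
case: N N0 NE => [n||]//=.
  by rewrite lee_fin => n0 [<-]; rewrite powR_mulrn.
by rewrite pnatr_eq0.
Qed.

Lemma Lp2_sqr c d v : Lp 2%:E c d v -> L1 c d (fun t => v t ^+ 2).
Proof.
move=> /Lfun2_integrable_sqr vi; apply/L1_oo/(integrable_mkcond _ _).2 => //.
apply: eq_integrable vi => // t _.
by rewrite /= !patchE; case: ifP => //=; rewrite expr0n.
Qed.

(** From |v| <= 1 + v^2 on an interval of finite length. *)
Lemma Lp2_L1 c d v : Lp 2%:E c d v -> L1 c d v.
Proof.
move=> v2; apply: (L1_le (Lp_meas v2) _ (L1D (L1_cst c d 1) (Lp2_sqr v2))) => t _.
rewrite [leRHS]ger0_norm ?addr_ge0 ?sqr_ge0// -real_normK ?num_real//.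
have := sqr_ge0 (`|v t| - 2^-1); rewrite !expr2; nra.
Qed.

Lemma cauchy_schwarz_sqr c d v : c < d -> L1 c d v -> L1 c d (fun t => v t ^+ 2) ->
  intg c d (fun t => `|v t|) ^+ 2 <= (d - c) * intg c d (fun t => v t ^+ 2).
Proof.
move=> cd vi v2i; set m := intg c d (fun t => `|v t|).
have dc : 0 < d - c by rewrite subr_gt0.
(* The mean of |v|, which minimizes the integral of (|v| - k)^2; that the minimum is nonnegative is
   the inequality sought. *)
pose k := m / (d - c).
have ni := L1_norm vi.
have : 0 <= intg c d (fun t => (v t ^+ 2 - (2 * k) * `|v t|) + k ^+ 2).
  apply: intg_ge0 => t _; rewrite -(real_normK (num_real (v t))).
  rewrite (_ : _ + _ = (`|v t| - k) ^+ 2) ?sqr_ge0//; ring.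
rewrite intgD; [|exact: L1B v2i (L1Z _ ni)|exact: L1_cst].
rewrite intgB//; last exact: L1Z.
rewrite intgZ// intg_cst ?(ltW cd)// -/m.
have -> : intg c d (fun t => v t ^+ 2) - 2 * k * m + k ^+ 2 * (d - c) =
    intg c d (fun t => v t ^+ 2) - m ^+ 2 / (d - c).
  by rewrite /k; field; lra.
by rewrite subr_ge0 ler_pdivrMr// mulrC.
Qed.

Lemma intg_le_L2norm c d v : c < d -> Lp 2%:E c d v ->
  intg c d (fun t => `|v t|) <= Num.sqrt (d - c) * L2norm c d v.
Proof.
move=> cd v2; have dc : 0 < d - c by rewrite subr_gt0.
have := cauchy_schwarz_sqr cd (Lp2_L1 v2) (Lp2_sqr v2).
rewrite -L2norm_sqr; last exact: Lp2_sqr.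
rewrite -{1}(sqr_sqrtr (ltW dc)) -exprMn ler_sqr// nnegrE.
  by apply: intg_ge0 => t _.
by rewrite mulr_ge0 ?sqrtr_ge0 ?L2norm_ge0.
Qed.

Lemma Lpoo_bounded c d v : Lp +oo%E c d v ->
  exists2 M, 0 <= M & {ae mu, forall t, c < t < d -> `|v t| <= M}.
Proof.
move=> /sub_Lfun_finLfun; rewrite inE /= /finite_norm unlock /=.
rewrite ifT; last first.
  rewrite -set_itvNyy /= lebesgue_measure_itv/=.
  by rewrite ltry.
set S := ess_sup _ _ => Soo.
have H : {ae mu, forall t, (`|(v \_ `]c, d[) t|%:E <= S)%E}.
  exact: ess_sup_ge.
exists (Num.max 0 (fine S)); first by rewrite le_max lexx.
apply: ae_imp H => t + ct; rewrite patchE ifT; last by rewrite inE/= in_itv.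
by case: S Soo => [s||]//= _; rewrite ?lee_fin ?leeNy_eq// le_max => ->; rewrite orbT.
Qed.

Lemma within_eq_closed c d g v : c < d -> {within `[c, d], continuous g} ->
  {within `[c, d], continuous v} -> (forall t, c < t < d -> g t = v t) ->
  forall t, c <= t <= d -> g t = v t.
Proof.
move=> cd /(continuous_within_itvP _ cd)[_ gc gd].
move=> /(continuous_within_itvP _ cd)[_ vc vd] gv.
have gvc : g c = v c.
  apply: (@cvg_unique _ (@Rhausdorff R) _ _ _ _ gc); apply: cvg_trans vc.
  apply: near_eq_cvg; near=> t; rewrite gv//; apply/andP; split; near: t.
    exact: nbhs_right_gt.
  exact: nbhs_right_lt.
have gvd : g d = v d.
  apply: (@cvg_unique _ (@Rhausdorff R) _ _ _ _ gd); apply: cvg_trans vd.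
  apply: near_eq_cvg; near=> t; rewrite gv//; apply/andP; split; near: t.
    exact: nbhs_left_gt.
  exact: nbhs_left_lt.
move=> t /andP[]; rewrite le_eqVlt => /predU1P[<-//|ct].
by rewrite le_eqVlt => /predU1P[->//|td]; apply: gv; rewrite ct.
Unshelve. all: by end_near. Qed.

Lemma primitive_derivable c d u v t : primitive c d u v -> c < t < d ->
  {for t, continuous v} -> derivable u t 1 /\ derive1 u t = v t.
Proof.
move=> uv /andP[ct td] vc; have [vi uE] := uv.
have [F [nu dF F']] : exists F : R -> R, [/\ (\near t, u c + F t = u t),
    derivable F t 1 & derive1 F t = v t].
  exists (fun x => intg c x v).
  have [dF F'] := @continuous_FTC1_closed _ v c t d td vi ct vc.
  split=> //; near=> x; have cx : c <= x by apply/ltW; near: x; exact: lt_nbhsr.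
  rewrite -(uE c x)//; first by ring.
  by apply/ltW; near: x; exact: lt_nbhsl.
have ds : derivable (fun x => u c + F x) t 1.
  exact: (@derivableD _ _ _ (cst (u c)) F t 1 (derivable_cst _ _ _) dF).
split; first exact: near_eq_derivable nu ds.
rewrite derive1E -(near_eq_derive _ nu).
rewrite (@deriveD _ _ _ (cst (u c)) F t 1 (derivable_cst (u c) t 1) dF).
by rewrite derive_cst add0r -derive1E.
Unshelve. all: by end_near. Qed.

End LpBounds.

(** * Approximation on one element *)

Opaque intg L2norm wderiv.

Section LocalApproximation.
Context {R : realType}.
Local Notation mu := (@lebesgue_measure R).
Implicit Types (c d t x k K M : R) (g v u : R -> R) (W : nat -> R -> R).

Lemma wderivP c d v : wderivable c d v -> is_wderiv c d v (wderiv c d v).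
Proof. by move=> vd; exact: (getPex vd). Qed.

(** [wderivn] yields arbitrary representatives; [W j] is the absolutely continuous one of the j-th
    derivative. The derivative of order m has none, so in the chain [W j], [W j.+1] the last index
    is dropped. Continuity of [v] upgrades the case j = 0 to equality at every point. *)
Lemma sobolev_chain m c d v : c < d -> sobolev m c d v ->
  (forall t, c < t < d -> {for t, continuous v}) ->
  exists W, [/\ forall j, (j < m)%N -> primitive c d (W j) (wderivn c d j.+1 v),
    forall j, (j.+1 < m)%N -> primitive c d (W j) (W j.+1),
    forall j, (j < m)%N -> {ae mu, forall t, c < t < d -> wderivn c d j v t = W j t} &
    (0 < m)%N -> forall t, c < t < d -> v t = W 0%N t].
Proof.
move=> cd [vD _] vc.
have /choice[W HW] : forall j, exists V, (j < m)%N -> [/\ primitive c d V (wderivn c d j.+1 v),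
    {ae mu, forall t, c < t < d -> wderivn c d j v t = V t} &
    forall t, c < t < d -> {for t, continuous (wderivn c d j v)} -> wderivn c d j v t = V t].
  move=> j; case: (ltnP j m) => [jm|]; last by exists (fun=> 0).
  have [V VP] := weak_primitive cd (wderivP (vD _ jm)).
  by exists V => _.
exists W; split=> [j /HW[]//|j jm|j /HW[]//|m0 t ct].
  have [P1 _ _] := HW _ (ltnW jm); have [P2 E2 _] := HW _ jm.
  apply: primitive_ae P1; first exact: E2.
  have cW := primitive_within (ltW cd) P2.
  exact: L1_meas (L1_within cW).
by have [_ _ H] := HW _ m0; apply: H ct (vc _ ct).
Qed.

Definition taylor W n c : {poly R} :=
  \sum_(k < n.+1) (W k c / k`!%:R) *: ('X - c%:P) ^+ k.

Lemma taylor_base W n c : (taylor W n c).[c] = W 0%N c.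
Proof.
rewrite /taylor big_ord_recl hornerD hornerZ expr0 hornerC fact0 divr1 mulr1.
rewrite horner_sum big1 ?addr0// => i _.
by rewrite hornerZ horner_exp hornerXsubC subrr expr0n mulr0.
Qed.

Lemma taylor_deriv W n c : (taylor W n.+1 c)^`() = taylor (W \o S) n c.
Proof.
rewrite /taylor big_ord_recl expr0 derivD derivZ derivC scaler0 add0r.
rewrite raddf_sum; apply: eq_bigr => i _ /=.
rewrite derivZ deriv_exp derivXsubC mul1r /= /bump/= ?add1n ?add0n.
rewrite -[_ ^+ _ *+ _]scaler_nat scalerA factS natrM; congr (_ *: _).
by rewrite [_.+1%:R * _]mulrC invfM mulrA divfK// pnatr_eq0.
Qed.

Lemma size_taylor W n c : (size (taylor W n c) <= n.+1)%N.
Proof.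
apply: (leq_trans (size_sum _ _ _)); apply/bigmax_leqP => i _.
by rewrite (leq_trans (size_scale_leq _ _))// size_exp_XsubC.
Qed.

Lemma coef_taylor W n c : (taylor W n c)`_n = W n c / n`!%:R.
Proof.
rewrite /taylor big_ord_recr coefD/= coefZ -[LHS]addr0 addrC.
have -> : (('X - c%:P) ^+ n)`_n = 1 :> R.
  have := monicP (monic_exp n (monicXsubC c)).
  by rewrite /lead_coef size_exp_XsubC.
rewrite mulr1 add0r nth_default ?add0r//.
apply: (leq_trans (size_sum _ _ _)); apply/bigmax_leqP => i _.
by rewrite (leq_trans (size_scale_leq _ _))// size_exp_XsubC.
Qed.

(** Induction through the derivative: the Taylor polynomial of W' is the derivative of that of W,
    and integrating its error from c, where both agree, gains a factor d - c. *)
Lemma taylor_error n c d W g : c < d ->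
  (forall j, (j < n)%N -> primitive c d (W j) (W j.+1)) -> primitive c d (W n) g ->
  forall x, c <= x <= d ->
    `|W 0%N x - (taylor W n c).[x]| <= (d - c) ^+ n * intg c d (fun t => `|g t|).
Proof.
move=> cd; elim: n W => [|n IH] W HW Wg x /andP[cx xd].
  rewrite expr0 mul1r /taylor big_ord1 expr0 hornerZ hornerC fact0 divr1 mulr1.
  have [gi WE] := Wg; rewrite WE// (le_trans (intg_norm (L1S (lexx c) xd gi)))//.
  by apply: intg_subset => //; exact: L1_norm.
have W0 := HW 0%N isT.
have {}IH : forall t, c <= t <= d -> `|W 1%N t - (taylor W n.+1 c)^`().[t]| <=
    (d - c) ^+ n * intg c d (fun t => `|g t|).
  by move=> t ct; rewrite taylor_deriv; apply: (IH (W \o S)) => // j jn; exact: HW.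
have [ei eE] := primitiveB W0 (primitive_horner c d (taylor W n.+1 c)).
have := eE c x (lexx _) cx xd; rewrite taylor_base subrr subr0 => ->.
pose B := (d - c) ^+ n * intg c d (fun t => `|g t|).
rewrite (le_trans (@intg_bound _ _ _ _ B cx (L1S (lexx c) xd ei) _))//.
  by move=> t ct; apply: IH; lra.
rewrite [leRHS](_ : _ = B * (d - c)); last by rewrite /B exprSr; ring.
rewrite ler_wpM2l//; last by lra.
by rewrite mulr_ge0 ?exprn_ge0//; [lra|exact: intg_ge0].
Qed.

Lemma local_interpolant (r : nat) (G : nat -> R) : (0 < r)%N -> legendre_zeros r G ->
  exists2 C, 0 < C & forall c d W g, c < d ->
    (forall j, (j < r.+1)%N -> primitive c d (W j) (W j.+1)) ->
    primitive c d (W r.+1) g ->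
    exists p : {poly R}, [/\ (size p <= r.+1)%N, p.[c] = W 0%N c, p.[d] = W 0%N d,
      forall x, c <= x <= d -> `|W 0%N x - p.[x]| <=
        C * (d - c) ^+ r.+1 * (`|W r.+1 c| + intg c d (fun t => `|g t|)) &
      forall j y, (1 <= j <= r)%N -> y = 2^-1 * (d + c + (d - c) * G j) ->
        `|W 1%N y - p^`().[y]| <= C * (d - c) ^+ r * intg c d (fun t => `|g t|)].
Proof.
move=> r0 hG; have [l [M [l0 M0 HL]]] := lobatto_itv r G r0 hG.
(* The 2 accounts for the Taylor error and the linear correction, the quotient for the Lobatto
   term. *)
exists (2 + M / `|l|); first by rewrite addr_gt0// divr_gt0// normr_gt0.
move=> c d W g cd HW Wg; have [L [sL LE [Lc Ld] L' LM]] := HL c d cd.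
set K := intg c d _; have K0 : 0 <= K by exact: intg_ge0.
have h0 : 0 < d - c by rewrite subr_gt0.
set h := d - c in h0 LE *.
have Ml : 0 <= M / `|l| by rewrite divr_ge0// ltW.
pose T := taylor W r.+1 c.
have Terr x : c <= x <= d -> `|W 0%N x - T.[x]| <= h ^+ r.+1 * K.
  exact: taylor_error.
have T'err x : c <= x <= d -> `|W 1%N x - T^`().[x]| <= h ^+ r * K.
  move=> cx; rewrite taylor_deriv; apply: (@taylor_error _ _ _ (W \o S)) => //.
  by move=> j jr; apply: HW.
(* Slope of a linear correction that restores interpolation at d; being of order h^r [K], it is
   harmless in the derivative estimate too. *)
pose dl := (W 0%N d - T.[d]) / h.
have dlE : `|dl| <= h ^+ r * K.
  rewrite normrM normfV (gtr0_norm h0) ler_pdivrMr// mulrAC -exprSr.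
  by apply: Terr; rewrite lexx ltW.
(* Cancels the coefficient of degree r + 1. Subtracting this multiple of [L] changes neither the end
   values nor the derivatives at the Gauss points, so the top Taylor coefficient enters the bound on
   values only. *)
pose s := T`_r.+1 / L`_r.+1.
have Lr0 : L`_r.+1 != 0 by rewrite LE mulf_neq0// expf_neq0// mulf_neq0 ?invr_eq0 ?gt_eqF.
pose p := (T + dl *: ('X - c%:P)) - s *: L.
have pE x : p.[x] = T.[x] + dl * (x - c) - s * L.[x].
  by rewrite /p hornerD hornerN hornerD !hornerZ hornerXsubC.
have p'E x : p^`().[x] = T^`().[x] + dl - s * L^`().[x].
  by rewrite /p derivB derivD !derivZ derivXsubC hornerD hornerN hornerD !hornerZ hornerC mulr1.
have sM : `|s| * M <= M / `|l| * h ^+ r.+1 * `|W r.+1 c|.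
  rewrite /s coef_taylor LE normrM normfV !normrM normfV.
  rewrite (ger0_norm (ler0n _ _)) (ger0_norm (exprn_ge0 _ (divr_ge0 _ (ltW h0))))//.
  rewrite exprMn exprVn invfM invfM invrK.
  have -> : `|W r.+1 c| / (r.+1)`!%:R * (`|l|^-1 * ((2 ^+ r.+1)^-1 * h ^+ r.+1)) * M =
     (M / `|l| * h ^+ r.+1 * `|W r.+1 c|) * (((r.+1)`!%:R)^-1 * (2 ^+ r.+1)^-1) by ring.
  rewrite ler_piMr ?mulr_ge0 ?exprn_ge0 ?(ltW h0) ?(ltW M0)//.
  rewrite -invfM invf_le1 -?natrX -?natrM ?ler1n ?ltr0n ?muln_gt0 ?fact_gt0 ?expn_gt0//.
exists p; split.
- have sT : (size (T + dl *: ('X - c%:P))%R <= r.+2)%N.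
    rewrite (leq_trans (size_polyD _ _))// geq_max size_taylor.
    by rewrite (leq_trans (size_scale_leq _ _))// size_XsubC.
  apply/leq_sizeP => j; rewrite leq_eqVlt => /predU1P[<-|rj].
    rewrite /p coefB coefD !coefZ coefB coefX coefC/=.
    (* Here r >= 1 matters: the linear correction must not reach degree r + 1. *)
    by rewrite (_ : (r.+1 == 1)%N = false) ?subrr ?mulr0 ?addr0 ?divfK ?subrr//; case: (r) r0.
  rewrite nth_default// (leq_trans _ rj)// (leq_trans (size_polyD _ _))// geq_max sT.
  by rewrite size_polyN (leq_trans (size_scale_leq _ _)).
- by rewrite pE Lc subrr taylor_base; ring.
- by rewrite pE Ld -/h /dl divfK ?gt_eqF//; ring.
- move=> x cx; have /andP[cx1 cx2] := cx; rewrite pE.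
  have -> : W 0%N x - (T.[x] + dl * (x - c) - s * L.[x]) =
    (W 0%N x - T.[x]) - dl * (x - c) + s * L.[x] by ring.
  rewrite (le_trans (ler_normD _ _))// [leRHS](_ : _ =
    (2 * (h ^+ r.+1 * K) + 2 * (h ^+ r.+1 * `|W r.+1 c|) + M / `|l| * h ^+ r.+1 * K) +
    M / `|l| * h ^+ r.+1 * `|W r.+1 c|); last by ring.
  apply: lerD; last first.
    by rewrite (le_trans _ sM)// normrM ler_wpM2l// LM.
  rewrite (le_trans (ler_normB _ _))//.
  have hp : 0 <= h ^+ r.+1 by rewrite exprn_ge0// ltW.
  have n1 : 0 <= h ^+ r.+1 * `|W r.+1 c| by rewrite mulr_ge0.
  have n2 := mulr_ge0 (mulr_ge0 Ml hp) K0.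
  have e1 := Terr x cx.
  have e2 : `|dl * (x - c)| <= h ^+ r.+1 * K.
    rewrite normrM (_ : h ^+ r.+1 * K = h ^+ r * K * h); last by rewrite exprSr; ring.
    by rewrite ler_pM// ger0_norm; rewrite /h; lra.
  lra.
- move=> j y jr yh; have yE : c <= y <= d.
    have /andP[G1 G2] := G_itv r G r0 hG j jr.
    by rewrite yh; have := mulr_gt0 h0 (_ : 0 < G j + 1); have := mulr_gt0 h0 (_ : 0 < 1 - G j);
      rewrite /h; lra.
  rewrite p'E yh L'// -yh mulr0 subr0 opprD addrA (le_trans (ler_normB _ _))//.
  have n2 := mulr_ge0 (mulr_ge0 Ml (exprn_ge0 r (ltW h0))) K0.
  rewrite [leRHS](_ : _ = h ^+ r * K + h ^+ r * K + M / `|l| * h ^+ r * K); last by ring.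
  by have := T'err y yE; lra.
Qed.

(** Rewrites the local bounds with L^2 norms over the element. Cauchy-Schwarz turns the integral of
    the derivative of order r + 2 into sqrt(d - c) times its norm, and a trace estimate brings the
    point value [W r.+1 c] to the same form at the cost of one factor d - c. *)
Lemma element_approx (r : nat) (G : nat -> R) : (0 < r)%N -> legendre_zeros r G ->
  exists2 C, 0 < C & forall c d u, c < d -> d - c <= 1 ->
    {within `[c, d], continuous u} -> sobolev r.+2 c d u ->
    let E := L2norm c d (wderivn c d r.+1 u) + L2norm c d (wderivn c d r.+2 u) in
    let e := C * (d - c) ^+ r * Num.sqrt (d - c) * E in
    exists (v : R -> R) (p : {poly R}), [/\ primitive c d u v,
      {within `[c, d], continuous v},
      [/\ (size p <= r.+1)%N, p.[c] = u c & p.[d] = u d],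
      forall x, c <= x <= d -> `|u x - p.[x]| <= e &
      forall j y, (1 <= j <= r)%N -> y = 2^-1 * (d + c + (d - c) * G j) ->
        `|v y - p^`().[y]| <= e].
Proof.
move=> r0 hG; have [C C0 HC] := local_interpolant r0 hG.
exists (2 * C) => [|c d u cd h1 uc us E e]; first by rewrite mulr_gt0.
have uc' t : c < t < d -> {for t, continuous u}.
  by move=> ct; apply: (within_continuous_continuous cd uc); rewrite in_itv.
have [W [HW WW Wae W0]] := sobolev_chain cd us uc'.
pose g := wderivn c d r.+2 u.
have Wg : primitive c d (W r.+1) g by apply: HW.
have [p [sp pc pd pE p'E]] := HC c d W g cd (fun j jr => WW j jr) Wg.
have uW : forall t, c <= t <= d -> u t = W 0%N t.
  apply: within_eq_closed => //; last exact: W0.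
  exact: primitive_within (ltW cd) (WW 0%N isT).
have [_ uL] := us.
set h := d - c in h1 e pE p'E *; have h0 : 0 < h by rewrite subr_gt0.
have q0 : 0 < Num.sqrt h by rewrite sqrtr_gt0.
have qq : Num.sqrt h * Num.sqrt h = h by rewrite -expr2 sqr_sqrtr// ltW.
have q1 : Num.sqrt h <= 1 by rewrite -sqrtr1 ler_wsqrtr.
set q := Num.sqrt h in q0 qq q1 e *.
pose K := intg c d (fun t => `|g t|).
have KE : K <= q * L2norm c d g by apply: intg_le_L2norm cd _; apply: uL.
have K0 : 0 <= K by exact: intg_ge0.
have n1 := L2norm_ge0 c d (wderivn c d r.+1 u); have n2 := L2norm_ge0 c d g.
have gi : L1 c d g := Wg.1.
have Wi : L1 c d (W r.+1) by exact/L1_within/(primitive_within (ltW cd) Wg).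
have uL1 : Lp 2%:E c d (wderivn c d r.+1 u) by exact: uL.
have Wnorm : intg c d (fun t => `|W r.+1 t|) <= q * L2norm c d (wderivn c d r.+1 u).
  apply: le_trans (intg_le_L2norm cd uL1).
  apply: intg_le_ae; [exact: L1_norm|exact/L1_norm/Lp2_L1|].
  by apply: ae_imp (Wae r.+1 (ltnSn _)) => t tE /tE ->.
(* Trace estimate: |W(c)| <= |W(t)| + K for every t, integrated over the element. *)
have Wc : h * `|W r.+1 c| <= q * E.
  have : intg c d (fun=> `|W r.+1 c|) <= intg c d (fun t => `|W r.+1 t| + K).
    apply: intg_le; [exact: L1_cst|by apply: L1D; [exact: L1_norm|exact: L1_cst]|].
    move=> t ct; rewrite -lerBlDl (le_trans (lerB_dist _ _))// distrC.
    have [ct1 ct2] : c <= t /\ t <= d by case/andP: ct => /ltW + /ltW.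
    rewrite (Wg.2 _ _ (lexx c) ct1 ct2).
    apply: (le_trans (intg_norm (L1S (lexx c) ct2 gi))).
    by apply: (intg_subset (L1_norm gi) (lexx c) ct1 ct2).
  rewrite intgD ?intg_cst ?(ltW cd)//; [|exact: L1_norm|exact: L1_cst].
  rewrite -/h => H; rewrite mulrC; apply: (le_trans H); rewrite /E [leRHS]mulrDr.
  apply: lerD; first exact: Wnorm.
  by rewrite -[leRHS]mulr1; apply: ler_pM => //; exact: ltW.
have WK : h * (`|W r.+1 c| + K) <= 2 * q * E.
  rewrite mulrDr (_ : 2 * q * E = q * E + q * E); last by ring.
  rewrite lerD// (@le_trans _ _ (1 * K))// ?ler_wpM2r// mul1r (le_trans KE)//.
  by rewrite ler_wpM2l ?(ltW q0)// /E lerDr.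
have hr0 : 0 <= h ^+ r by rewrite exprn_ge0// ltW.
exists (W 1%N), p; split.
- by apply: primitive_eq (WW 0%N isT) => // t ct; rewrite uW.
- by apply: primitive_within (ltW cd) (HW 1%N _).
- by split=> //; rewrite uW// lexx ltW.
- move=> x cx; rewrite uW// (le_trans (pE x cx))// exprSr.
  rewrite [leLHS](_ : _ = C * h ^+ r * (h * (`|W r.+1 c| + K))); last by rewrite /K; ring.
  rewrite /e [leRHS](_ : _ = C * h ^+ r * (2 * q * E)); last by ring.
  by rewrite ler_wpM2l// mulr_ge0// ltW.
- move=> j y jr yh; rewrite (le_trans (p'E j y jr yh))// /e.
  rewrite [leRHS](_ : _ = C * h ^+ r * (2 * (q * E))); last by ring.
  apply: ler_wpM2l; first by rewrite mulr_ge0// ltW.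
  rewrite (le_trans KE)// (@le_trans _ _ (q * E))//; last first.
    by rewrite ler_peMl ?ler1n// mulr_ge0 ?(ltW q0)// addr_ge0.
  by rewrite ler_wpM2l ?(ltW q0)// /E lerDr.
Qed.

End LocalApproximation.

(** * Orthogonality of the error *)

Transparent intg.

(** * Elements, Gauss points and dual cells *)

Section MeshGeometry.
Context {R : realType} (a b : R) (N : nat) (x : nat -> R) (hx : mesh a b N x).
Implicit Types (r i j k : nat) (G : nat -> R).

Lemma mesh_mono i j : (i <= j)%N -> (j <= N)%N -> x i <= x j.
Proof.
case: hx => _ _ xlt; elim: j => [|j IH]; first by rewrite leqn0 => /eqP ->.
rewrite leq_eqVlt => /predU1P[->//|ij] jN.
by rewrite (le_trans (IH ij (ltnW jN)))// ltW// xlt.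
Qed.

Lemma mesh_step i : (1 <= i <= N)%N -> x i.-1 < x i.
Proof. by case: hx => _ _ xlt; case: i => // i /andP[_ iN]; exact: xlt. Qed.

Lemma mesh_range i : (i <= N)%N -> a <= x i <= b.
Proof.
by case: (hx) => xa xb _ iN; rewrite -xa -xb !mesh_mono.
Qed.

Lemma mesh_elt i : (1 <= i <= N)%N -> a <= x i.-1 /\ x i <= b.
Proof.
move=> /andP[i1 iN]; have /andP[_ ?] := mesh_range iN.
by have /andP[? _] := mesh_range (leq_trans (leq_pred i) iN).
Qed.

Lemma mesh_size_ge i : (1 <= i <= N)%N -> x i - x i.-1 <= mesh_size N x.
Proof.
move=> iN; rewrite /mesh_size.
have : i \in index_iota 1 N.+1 by rewrite mem_index_iota.
elim: (index_iota _ _) => // k s IH; rewrite in_cons big_cons le_max.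
by move=> /predU1P[->|/IH ->]; rewrite ?lexx ?orbT.
Qed.

Lemma mesh_size_ge0 : 0 <= mesh_size N x.
Proof.
rewrite /mesh_size; elim: (index_iota _ _) => [|k s IH]; first by rewrite big_nil.
by rewrite big_cons le_max IH orbT.
Qed.

Lemma sum_mesh_steps : \sum_(1 <= i < N.+1) (x i - x i.-1) = b - a.
Proof. by case: hx => <- <- _; rewrite big_add1 telescope_sumr. Qed.

Context (r : nat) (G : nat -> R) (r_gt0 : (0 < r)%N) (hG : legendre_zeros r G).

Lemma gauss_ptE i j : (j <= r)%N ->
  gauss_pt x G r i j = 2^-1 * (x i + x i.-1 + (x i - x i.-1) * G j).
Proof. by rewrite /gauss_pt => ->. Qed.

Lemma gauss_pt_last i : gauss_pt x G r i r.+1 = gauss_pt x G r i.+1 1.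
Proof. by rewrite /gauss_pt ltnn r_gt0. Qed.

Lemma gauss_pt_itv i j : (1 <= i <= N)%N -> (1 <= j <= r)%N ->
  x i.-1 < gauss_pt x G r i j < x i.
Proof.
move=> iN jr; have h0 : 0 < x i - x i.-1 by rewrite subr_gt0 mesh_step.
rewrite gauss_ptE; last by case/andP: jr.
have /andP[G1 G2] := G_itv r G r_gt0 hG j jr.
have := mulr_gt0 h0 (_ : 0 < G j + 1); have := mulr_gt0 h0 (_ : 0 < 1 - G j).
by move=> /(_ ltac:(lra)) H1 /(_ ltac:(lra)) H2; apply/andP; split; lra.
Qed.

Lemma gauss_pt_range i j : (1 <= i <= N)%N -> (1 <= j <= r)%N ->
  a < gauss_pt x G r i j < b.
Proof.
move=> iN jr; have /andP[g1 g2] := gauss_pt_itv iN jr; have [? ?] := mesh_elt iN.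
by apply/andP; split; lra.
Qed.

Lemma gauss_cell i j : (1 <= i <= N)%N -> (1 <= j <= ncells N r i)%N ->
  [/\ a <= gauss_pt x G r i j, gauss_pt x G r i j <= gauss_pt x G r i j.+1 &
      gauss_pt x G r i j.+1 <= b].
Proof.
move=> iN jr; have jr' : (1 <= j <= r)%N by move: jr; rewrite /ncells; case: ifP; lia.
have /andP[g1 g2] := gauss_pt_itv iN jr'; have [? ?] := mesh_elt iN.
have [jr1|jr1] := ltnP j r.
  have jr2 : (1 <= j.+1 <= r)%N by [].
  have /andP[g3 g4] := gauss_pt_itv iN jr2; split; [lra| |lra].
  have Gm := hG.2 j; rewrite !gauss_ptE//; last exact: ltnW.
  have h0 : 0 < x i - x i.-1 by rewrite subr_gt0 mesh_step.
  by rewrite ler_pM2l ?invr_gt0// lerD2l ler_pM2l// ltW// Gm//; case/andP: jr' => ->.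
(* The last cell of an element straddles the node and ends at the first Gauss point of the next
   element, which exists because the final element has only r - 1 cells. *)
have jE : j = r by apply/eqP; rewrite eqn_leq jr1; case/andP: jr' => _ ->.
have iN' : (1 <= i.+1 <= N)%N by move: jr; rewrite /ncells jE; case: eqP; lia.
have r1 : (1 <= 1 <= r)%N by rewrite r_gt0.
have /andP[g3 g4] := gauss_pt_itv iN' r1.
have [? ?] := mesh_elt iN'.
by rewrite jE gauss_pt_last in g1 g2 *; split; move: g3 g4 => /=; lra.
Qed.

End MeshGeometry.

(** * Summation by parts over the dual cells *)

Section Abel.
Context {R : realType}.
Implicit Types (x G : nat -> R) (w : nat -> nat -> R) (F : R -> R).

(** The cell j = r that the final element lacks is added with coefficient 0. *)
Lemma sum_cells N r w (D : nat -> nat -> R) : (0 < r)%N ->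
  \sum_(1 <= i < N.+1) \sum_(1 <= j < (ncells N r i).+1) w i j * D i j =
  \sum_(1 <= i < N.+1) \sum_(1 <= j < r.+1) coef N r w i j * D i j.
Proof.
move=> r0; apply: eq_big_nat => i iN; rewrite /ncells; case: eqP => [->|/eqP iN'].
  rewrite prednK// big_nat_recr//= /coef !eqxx (gtn_eqF r0) mul0r addr0.
  by apply: eq_big_nat => j jr; rewrite (_ : (j == 0%N) = false) ?(ltn_eqF (andP jr).2)//; lia.
apply: eq_big_nat => j jr; rewrite /coef (negbTE iN') (_ : (j == 0%N) = false)//; lia.
Qed.

(** The difference telescopes inside each element and then across elements, since w_{i,0} =
    w_{i-1,r} and g_{i,r+1} = g_{i+1,1}; the outermost coefficients are 0. *)
Lemma abel_gauss N x G r w F : (0 < r)%N -> (0 < N)%N ->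
  \sum_(1 <= i < N.+1) \sum_(1 <= j < r.+1) jump N r w i j * F (gauss_pt x G r i j) =
  - \sum_(1 <= i < N.+1) \sum_(1 <= j < (ncells N r i).+1)
      w i j * (F (gauss_pt x G r i j.+1) - F (gauss_pt x G r i j)).
Proof.
move=> r0 N0; rewrite sum_cells//; apply/eqP; rewrite -addr_eq0 -big_split/=; apply/eqP.
pose c := coef N r w; pose g i j := F (gauss_pt x G r i j).
under eq_bigr => i _.
  rewrite -big_split/= (_ : \sum_(1 <= j < r.+1) _ =
      c i r * g i r.+1 - c i 0%N * g i 1%N); last first.
    transitivity (\sum_(1 <= j < r.+1) (c i j * g i j.+1 - c i j.-1 * g i j)).
      by apply: eq_bigr => j _; rewrite /jump /c /g/=; ring.
    by rewrite (telescope_sumr (fun j => c i j.-1 * g i j)).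
  over.
have cN : c N r = 0 by rewrite /c /coef !eqxx (gtn_eqF r0).
have c1 : c 1%N 0%N = 0 by rewrite /c /coef !eqxx.
rewrite big_nat_recr//= cN mul0r sub0r.
rewrite (eq_big_nat _ _ (F2 := fun i => c i.+1 0%N * g i.+1 1%N - c i 0%N * g i 1%N)).
  by rewrite (telescope_sumr (fun i => c i 0%N * g i 1%N))// c1; ring.
move=> i /andP[i1 iN]; congr (_ - _); rewrite /g gauss_pt_last//; congr (_ * _).
rewrite /c /coef eqxx (gtn_eqF r0) (ltn_eqF iN)/=.
by rewrite (_ : (i.+1 == 1%N) = false)//; lia.
Qed.

End Abel.

(** * The error equation at the Gauss points *)

Section Orthogonality.
Context {R : realType}.
Local Notation mu := (@lebesgue_measure R).
Implicit Types (c d p q : R) (f g : R -> R).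

Lemma L1_sum c d I (s : seq I) (P : pred I) (F : I -> R -> R) :
  (forall i, P i -> L1 c d (F i)) ->
  L1 c d (fun y => \sum_(i <- s | P i) F i y) /\
  intg c d (fun y => \sum_(i <- s | P i) F i y) = \sum_(i <- s | P i) intg c d (F i).
Proof.
move=> FL; have L0 : L1 c d (fun=> 0) by exact: L1_cst.
elim: s => [|i s [IH1 IH2]].
  under [X in L1 _ _ X]eq_fun do rewrite big_nil.
  under [X in intg _ _ X]eq_fun do rewrite big_nil.
  by rewrite big_nil intg0.
under [X in L1 _ _ X]eq_fun do rewrite big_cons.
under [X in intg _ _ X]eq_fun do rewrite big_cons.
rewrite big_cons; case: ifP => // Pi; split; first by apply: L1D => //; exact: FL.
by rewrite intgD ?IH2//; exact: FL.
Qed.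

Lemma intg_indic c d p q f k : L1 c d f -> c <= p -> p <= q -> q <= d ->
  L1 c d (fun y => f y * (k * \1_`[p, q]%classic y)) /\
  intg c d (fun y => f y * (k * \1_`[p, q]%classic y)) = k * intg p q f.
Proof.
move=> fi cp pq qd; pose g y := f y * (k * \1_`[p, q]%classic y).
have g0 s t : c <= s -> t <= d -> (t <= p \/ q <= s) -> L1 s t g /\ intg s t g = 0.
  move=> cs td H.
  have E y : s < y < t -> 0 = g y.
    move=> sy; rewrite /g indicE memNset ?mulr0//= in_itv/=.
    by apply/negP; rewrite negb_and -!ltNge; case: H => H; apply/orP; [left|right]; lra.
  have L : L1 s t g by apply: (L1_eq E); exact: L1_cst.
  split=> //; rewrite -(intg_eq E); last exact: L1_cst.
  exact: intg0.
have gE y : p < y < q -> k * f y = g y.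
  move=> py; rewrite /g indicE mem_set ?mulr1 1?mulrC//= in_itv/=; lra.
have fpq : L1 p q f by exact: L1S fi.
have gpq : L1 p q g by apply: (L1_eq gE); exact: L1Z.
have [L1a Ia] := g0 c p (lexx _) (le_trans pq qd) (or_introl (lexx _)).
have [L1b Ib] := g0 q d (le_trans cp pq) (lexx _) (or_intror (lexx _)).
have gpd : L1 p d g by exact: L1_cat gpq L1b.
have gcd : L1 c d g by apply: L1_cat L1a gpd => //; exact: le_trans qd.
split=> //; rewrite (intg_split gcd cp (le_trans pq qd)) (intg_split gpd pq qd) Ia Ib.
by rewrite add0r addr0 -(intg_eq gE) ?intgZ//; exact: L1Z.
Qed.

Context (a b : R) (N : nat) (x : nat -> R) (hx : mesh a b N x).
Context (r : nat) (G : nat -> R) (r_gt0 : (0 < r)%N) (hG : legendre_zeros r G).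
Context (hab : a < b).

Lemma mesh_N_gt0 : (0 < N)%N.
Proof. by case: hx => xa xb _; rewrite lt0n; apply: contraTneq hab => N0; rewrite -xa -xb N0 ltxx. Qed.

(** On a cell, the integral of [f] is that of beta u' + gamma u minus the increment of the flux [S].
    Summation by parts converts all cell increments into point values, so the two fluxes are
    compared at Gauss points only. *)
Lemma fv_orthogonality (alpha beta gamma f u uP S : R -> R) :
  L1 a b f ->
  L1 a b (fun y => beta y * derive1 uP y + gamma y * uP y) ->
  primitive a b S (fun y => beta y * derive1 u y + gamma y * u y - f y) ->
  fv_solution a b alpha beta gamma f N x G r uP ->
  exists Z, [/\ primitive a b Z (fun y => (beta y * derive1 u y + gamma y * u y) -
      (beta y * derive1 uP y + gamma y * uP y)), Z a = 0 & forall w,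
  \sum_(1 <= i < N.+1) \sum_(1 <= j < r.+1) jump N r w i j *
    (S (gauss_pt x G r i j) - alpha (gauss_pt x G r i j) * derive1 uP (gauss_pt x G r i j) -
     Z (gauss_pt x G r i j)) = 0].
Proof.
pose HP y := beta y * derive1 uP y + gamma y * uP y.
pose HU y := beta y * derive1 u y + gamma y * u y.
move=> fi HPi [phii SE] [_ fvE].
have {}HPi : L1 a b HP := HPi.
have {}SE : forall y z, a <= y -> y <= z -> z <= b ->
  S z - S y = intg y z (fun t => HU t - f t) := SE.
have HUi : L1 a b HU.
  by apply: L1_eq (L1D phii fi) => t _; rewrite /HU; ring.
have Zi : L1 a b (fun y => HU y - HP y) by exact: L1B.
pose Z t := intg a t (fun y => HU y - HP y).
exists Z; split; [exact: primitive_intg|exact: intg_pt|move=> w].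
have ZE := (primitive_intg Zi).2.
pose g i j := gauss_pt x G r i j.
have fT : intg a b (fun y => f y * test_fun N x G r w y) =
    \sum_(1 <= i < N.+1) \sum_(1 <= j < (ncells N r i).+1) w i j * intg (g i j) (g i j.+1) f.
  have TE : (fun y => f y * test_fun N x G r w y) =
      (fun y => \sum_(1 <= i < N.+1 | (1 <= i <= N)%N)
        \sum_(1 <= j < (ncells N r i).+1 | (1 <= j <= ncells N r i)%N)
        f y * (w i j * \1_(`[g i j, g i j.+1]%classic) y)).
    apply/funext => y; rewrite /test_fun mulr_sumr big_nat; apply: eq_bigr => i _.
    by rewrite mulr_sumr big_nat.
  have cellE i j : (1 <= i <= N)%N -> (1 <= j <= ncells N r i)%N ->
    L1 a b (fun y => f y * (w i j * \1_(`[g i j, g i j.+1]%classic) y)) /\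
    intg a b (fun y => f y * (w i j * \1_(`[g i j, g i j.+1]%classic) y)) =
      w i j * intg (g i j) (g i j.+1) f.
    move=> iN jr; have [h1 h2 h3] := gauss_cell hx r_gt0 hG iN jr.
    exact: intg_indic.
  rewrite TE [in RHS]big_nat.
  have [_ ->] := @L1_sum a b _ (index_iota 1 N.+1) (fun i => (1 <= i <= N)%N) _
    (fun i iN => (@L1_sum a b _ (index_iota 1 (ncells N r i).+1)
      (fun j => (1 <= j <= ncells N r i)%N) _ (fun j jr => (cellE i j iN jr).1)).1).
  apply: eq_bigr => i iN; rewrite [in RHS]big_nat.
  have [_ ->] := @L1_sum a b _ (index_iota 1 (ncells N r i).+1)
      (fun j => (1 <= j <= ncells N r i)%N) _ (fun j jr => (cellE i j iN jr).1).
  by apply: eq_bigr => j jr; exact: (cellE i j iN jr).2.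
have := fvE w; rewrite /fv_form -/(intg a b _) fT.
set A := \sum_(1 <= i < N.+1) _; set B := \sum_(1 <= i < N.+1) _.
set Cf := \sum_(1 <= i < N.+1) _ => AB.
have BE : B = \sum_(1 <= i < N.+1) \sum_(1 <= j < (ncells N r i).+1)
   w i j * intg (g i j) (g i j.+1) HP by [].
have N0 := mesh_N_gt0.
have E1 := abel_gauss x G w S r_gt0 N0.
have E2 := abel_gauss x G w Z r_gt0 N0.
have -> : \sum_(1 <= i < N.+1) \sum_(1 <= j < r.+1) jump N r w i j *
    (S (g i j) - alpha (g i j) * derive1 uP (g i j) - Z (g i j)) =
  \sum_(1 <= i < N.+1) \sum_(1 <= j < r.+1) jump N r w i j * S (g i j) - A -
  \sum_(1 <= i < N.+1) \sum_(1 <= j < r.+1) jump N r w i j * Z (g i j).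
  rewrite /A -!sumrB; apply: eq_bigr => i _; rewrite -!sumrB; apply: eq_bigr => j _.
  by rewrite /g; ring.
rewrite E1 E2 opprK.
have -> : A = Cf - B by rewrite -AB addrK.
rewrite BE /Cf -sumrB -!sumrN -!big_split/= big_nat big1// => i iN.
rewrite -sumrB -!sumrN -!big_split/= big_nat big1// => j jr.
have [h1 h2 h3] := gauss_cell hx r_gt0 hG iN jr.
rewrite (SE _ _ h1 h2 h3) (ZE _ _ h1 h2 h3) -/(g i j) -/(g i j.+1).
have LS h : L1 a b h -> L1 (g i j) (g i j.+1) h by exact: L1S.
by rewrite (intgB (LS _ HUi) (LS _ fi)) (intgB (LS _ HUi) (LS _ HPi)); ring.
Qed.

(** Prescribing the jumps instead of the coefficients: jumps [Q] whose sum over each element is an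
    increment of [th] come from a test function, because [th] vanishes at both ends. *)
Lemma fv_tested (alpha beta gamma f u uP S : R -> R) (Q : nat -> nat -> R) (th : nat -> R) :
  L1 a b f ->
  L1 a b (fun y => beta y * derive1 uP y + gamma y * uP y) ->
  primitive a b S (fun y => beta y * derive1 u y + gamma y * u y - f y) ->
  fv_solution a b alpha beta gamma f N x G r uP ->
  th 0%N = 0 -> th N = 0 ->
  (forall i, (1 <= i <= N)%N -> \sum_(1 <= j < r.+1) Q i j = th i - th i.-1) ->
  exists Z, [/\ primitive a b Z (fun y => (beta y * derive1 u y + gamma y * u y) -
      (beta y * derive1 uP y + gamma y * uP y)), Z a = 0 &
  \sum_(1 <= i < N.+1) \sum_(1 <= j < r.+1) Q i j *
    (S (gauss_pt x G r i j) - alpha (gauss_pt x G r i j) * derive1 uP (gauss_pt x G r i j) -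
     Z (gauss_pt x G r i j)) = 0].
Proof.
move=> fi HPi SE fvs th0 thN HQ.
have [Z [ZE Za H]] := fv_orthogonality fi HPi SE fvs; exists Z; split=> //.
(* After r steps the partial sum is [th i], which matches w_{i+1,0} = w_{i,r}; [th N = 0] gives
   w_{N,r} = 0. *)
pose w i j := th i.-1 + \sum_(1 <= k < j.+1) Q i k.
rewrite -[RHS](H w); apply: eq_big_nat => i iN; apply: eq_big_nat => j jr.
congr (_ * _).
have wr k : (1 <= k <= N)%N -> w k r = th k by move=> kN; rewrite /w HQ// addrC subrK.
have cE k : (k <= r)%N -> coef N r w i k = w i k.
  move=> kr; rewrite /coef; case: eqP => [->|k0].
    have -> : w i 0%N = th i.-1 by rewrite /w big_geq// addr0.
    by case: eqP => [->//|i1]; rewrite wr//; lia.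
  by case: eqP => //= iE; case: eqP => // ->; rewrite iE wr ?thN//; lia.
rewrite /jump !cE; [|lia|lia].
rewrite /w -[X in \sum_(1 <= k < X) Q i k]prednK; last by lia.
case: j jr => // j jr /=; rewrite big_nat_recr//=; ring.
Qed.

End Orthogonality.

(** * The energy estimate *)

Opaque intg L2norm wderiv.

Section FiniteSums.
Context {R : realType}.

Lemma sum_cauchy_schwarz (I : Type) (s : seq I) (Pr : pred I) (A B : I -> R) :
  \sum_(i <- s | Pr i) A i * B i <=
    Num.sqrt (\sum_(i <- s | Pr i) A i ^+ 2) * Num.sqrt (\sum_(i <- s | Pr i) B i ^+ 2).
Proof.
elim: s => [|i s IH]; first by rewrite !big_nil sqrtr0 mulr0.
rewrite !big_cons; case: ifP => // Pi.
have A0 : 0 <= \sum_(i <- s | Pr i) A i ^+ 2 by apply: sumr_ge0 => *; exact: sqr_ge0.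
have B0 : 0 <= \sum_(i <- s | Pr i) B i ^+ 2 by apply: sumr_ge0 => *; exact: sqr_ge0.
move: IH A0 B0; move: (\sum_(i <- s | Pr i) _ * _) => S.
move: (\sum_(i <- s | Pr i) A i ^+ 2) (\sum_(i <- s | Pr i) B i ^+ 2) => X Z SXZ X0 Z0.
apply: (le_trans (lerD (lexx _) SXZ)).
apply: (le_trans (ler_norm _)); rewrite -[leRHS]sqrtrM ?addr_ge0 ?sqr_ge0// -sqrtr_sqr.
apply: ler_wsqrtr.
have := sqr_ge0 (A i * Num.sqrt Z - B i * Num.sqrt X).
have := sqr_sqrtr X0; have := sqr_sqrtr Z0.
move: (Num.sqrt X) (Num.sqrt Z) => p q qE pE.
rewrite -qE -pE !expr2; nra.
Qed.

Lemma sum_cauchy_schwarz_le (I : Type) (s : seq I) (Pr : pred I) (A B : I -> R) U V :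
  0 <= U -> 0 <= V ->
  \sum_(i <- s | Pr i) A i ^+ 2 <= U ^+ 2 -> \sum_(i <- s | Pr i) B i ^+ 2 <= V ^+ 2 ->
  \sum_(i <- s | Pr i) A i * B i <= U * V.
Proof.
move=> U0 V0 AU BV; apply: le_trans (sum_cauchy_schwarz _ _ _ _) _.
by apply: ler_pM; rewrite ?sqrtr_ge0// -[leRHS]ger0_norm// -sqrtr_sqr ler_wsqrtr.
Qed.

End FiniteSums.

(** * Discrete norms on one element *)

Section GaussElement.
Context {R : realType} (r : nat) (G : nat -> R).
Context (r_gt0 : (0 < r)%N) (hG : legendre_zeros r G).
Implicit Types (c d t : R) (p : {poly R}).

Definition gpt c d j : R := 2^-1 * (d + c + (d - c) * G j).

(** Not scaled by the length of the element; the factor d - c that makes its square comparable to a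
    squared L^2 norm enters with [energy]. *)
Definition gauss_norm c d p : R := Num.sqrt (\sum_(1 <= j < r.+1) p.[gpt c d j] ^+ 2).

Lemma gauss_norm_ge0 c d p : 0 <= gauss_norm c d p. Proof. exact: sqrtr_ge0. Qed.

Lemma gauss_norm_sqr c d p : gauss_norm c d p ^+ 2 = \sum_(1 <= j < r.+1) p.[gpt c d j] ^+ 2.
Proof. by rewrite sqr_sqrtr// sumr_ge0// => j _; exact: sqr_ge0. Qed.

Lemma le_gauss_norm c d p j : (1 <= j <= r)%N -> `|p.[gpt c d j]| <= gauss_norm c d p.
Proof.
move=> jr; rewrite -sqrtr_sqr ler_wsqrtr// (bigD1_seq j) ?iota_uniq ?mem_index_iota//=.
by rewrite lerDl sumr_ge0// => i _; exact: sqr_ge0.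
Qed.

Lemma sum_le_gauss_norm c d p : \sum_(1 <= j < r.+1) `|p.[gpt c d j]| <= r%:R * gauss_norm c d p.
Proof.
rewrite (_ : r%:R * _ = \sum_(1 <= j < r.+1) gauss_norm c d p).
  by rewrite big_nat [leRHS]big_nat; apply: ler_sum => j jr; apply: le_gauss_norm.
by rewrite sumr_const_nat subSS subn0 mulr_natl.
Qed.

Lemma gauss_element : exists K1 K2 k0 : R, [/\ 0 < K1, 0 < K2, 0 < k0 &
  forall c d p, c < d -> (size p <= r)%N ->
  [/\ forall t, c <= t <= d -> `|p.[t]| <= K1 * gauss_norm c d p,
      \sum_(1 <= j < r.+1) `|weight r G j * ((d - c) / 2) * p.[gpt c d j]| <=
        K2 * (d - c) * gauss_norm c d p &
      forall (al : nat -> R) al0, 0 <= al0 -> (forall j, (1 <= j <= r)%N -> al0 <= al j) ->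
        k0 * al0 * (d - c) * gauss_norm c d p ^+ 2 <=
        \sum_(1 <= j < r.+1) weight r G j * ((d - c) / 2) * p.[gpt c d j] *
          (al j * p.[gpt c d j])]].
Proof.
have [M M0 HM] := lagr_bound_itv r G r_gt0 hG.
have wpos j : (1 <= j <= r)%N -> 0 < weight r G j by exact: weight_gt0.
have [w1 w10 Hw1] : exists2 w1, 0 < w1 & forall j, (1 <= j <= r)%N -> w1 <= weight r G j.
  (* A sum dominates each of its nonnegative terms; bounding the inverses of the weights in this way
     yields a positive lower bound for the weights. *)
  have [k k0 Hk] : exists2 k, 0 < k & forall j, (1 <= j <= r)%N -> (weight r G j)^-1 <= k.
    exists (1 + \sum_(1 <= j < r.+1) (weight r G j)^-1).
      rewrite ltr_pwDl// big_nat sumr_ge0// => j jr; rewrite invr_ge0 ltW// wpos//.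
    move=> j jr; rewrite (bigD1_seq j) ?iota_uniq ?mem_index_iota//= addrCA lerDl.
    rewrite addr_ge0// big_nat_cond sumr_ge0// => i /andP[ir _].
    by rewrite invr_ge0 ltW// wpos.
  exists k^-1 => [|j jr]; first by rewrite invr_gt0.
  by rewrite invf_ple ?posrE// ?Hk// wpos.
have [w2 w20 Hw2] : exists2 w2, 0 < w2 & forall j, (1 <= j <= r)%N -> weight r G j <= w2.
  exists (1 + \sum_(1 <= j < r.+1) weight r G j).
    by rewrite ltr_pwDl// big_nat sumr_ge0// => j jr; rewrite ltW// wpos.
  move=> j jr; rewrite (bigD1_seq j) ?iota_uniq ?mem_index_iota//= addrCA lerDl.
  by rewrite addr_ge0// big_nat_cond sumr_ge0// => i /andP[ir _]; rewrite ltW// wpos.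
exists (M * r%:R), (w2 / 2 * r%:R), (w1 / 2).
have r0 : 0 < r%:R :> R by rewrite ltr0n.
split; [by rewrite mulr_gt0|by rewrite !mulr_gt0 ?invr_gt0|by rewrite divr_gt0|].
move=> c d p cd sp; have dc : 0 < d - c by rewrite subr_gt0.
have dc2 : 0 < (d - c) / 2 by rewrite divr_gt0.
split.
- move=> t ct; rewrite (le_trans (HM c d p t cd sp ct))// -mulrA ler_wpM2l ?(ltW M0)//.
  exact: sum_le_gauss_norm.
- rewrite [leRHS](_ : _ = w2 * ((d - c) / 2) * (r%:R * gauss_norm c d p)); last by field.
  have wd : 0 <= w2 * ((d - c) / 2) by rewrite mulr_ge0// ltW.
  apply: le_trans (ler_wpM2l wd (sum_le_gauss_norm c d p)); rewrite mulr_sumr.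
  rewrite big_nat [leRHS]big_nat; apply: ler_sum => j jr.
  have wj := wpos _ jr.
  rewrite normrM ler_wpM2r// normrM (gtr0_norm wj) (gtr0_norm dc2).
  by rewrite ler_wpM2r ?(ltW dc2)// Hw2.
- move=> al al0 al00 Hal.
  rewrite gauss_norm_sqr mulr_sumr big_nat [leRHS]big_nat; apply: ler_sum => j jr.
  rewrite [leLHS](_ : _ = w1 * al0 * ((d - c) / 2 * p.[gpt c d j] ^+ 2)); last by field.
  rewrite [leRHS](_ : _ = weight r G j * al j * ((d - c) / 2 * p.[gpt c d j] ^+ 2)); last by ring.
  apply: ler_wpM2r; first by apply: mulr_ge0; [exact: ltW|exact: sqr_ge0].
  by apply: ler_pM; rewrite ?(ltW w10) ?Hw1 ?Hal.
Qed.

End GaussElement.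

Section MeshIntegrals.
Context {R : realType} (a b : R) (N : nat) (x : nat -> R) (hx : mesh a b N x).
Implicit Types (F f g : R -> R).

Lemma primitive_elt V v : (forall i, (1 <= i <= N)%N -> primitive (x i.-1) (x i) V v) ->
  primitive a b V v.
Proof.
case: (hx) => xa xb xlt H; rewrite -xa -xb; apply: primitive_mesh => i iN.
  exact/ltW/xlt.
exact: (H i.+1).
Qed.

Lemma intg_mesh g : L1 a b g -> intg a b g = \sum_(1 <= i < N.+1) intg (x i.-1) (x i) g.
Proof.
move=> gi; case: (hx) => xa xb _.
suff H n : (n <= N)%N -> intg a (x n) g = \sum_(1 <= i < n.+1) intg (x i.-1) (x i) g.
  by rewrite -H// xb.
elim: n => [|n IH] nN; first by rewrite xa intg_pt big_geq.
have nN' : (1 <= n.+1 <= N)%N by [].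
have [h1 h2] := mesh_elt hx nN'.
have gi' : L1 a (x n.+1) g by exact: L1S gi.
rewrite big_nat_recr//= -IH ?(ltnW nN)// (intg_split gi' h1)//.
exact/ltW/(mesh_step hx nN').
Qed.

(** The bound on [f] is asked inside the elements only, since the derivatives in question are not
    controlled at the nodes. *)
Lemma primitiveM_mesh F G f g : primitive a b F f -> primitive a b G g ->
  (forall i, (1 <= i <= N)%N -> exists M, forall t, x i.-1 < t < x i -> `|f t| <= M) ->
  primitive a b (fun t => F t * G t) (fun t => f t * G t + F t * g t).
Proof.
move=> Ff Gg fM; apply: primitive_elt => i iN; have [M HM] := fM i iN.
have [h1 h2] := mesh_elt hx iN.
by apply: (primitiveM (primitiveS h1 h2 Ff) (primitiveS h1 h2 Gg) HM).
Qed.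

End MeshIntegrals.

(** * The energy argument for abstract data *)

Section Core.
Context {R : realType} (a b : R) (N : nat) (x : nat -> R) (hx : mesh a b N x).
Context (r : nat) (G : nat -> R) (r_gt0 : (0 < r)%N) (hG : legendre_zeros r G).
Context (hab : a < b).
Local Notation mu := (@lebesgue_measure R).
Local Notation h i := (x i - x i.-1).
Local Notation hm := (mesh_size N x).
Local Notation g i j := (gauss_pt x G r i j).
Context (K1 K2 MB MG : R) (P : nat -> {poly R}) (n : nat -> R) (Q : nat -> nat -> R).
Context (K1_gt0 : 0 < K1) (K2_gt0 : 0 < K2) (MB_ge0 : 0 <= MB) (MG_ge0 : 0 <= MG).
Context (n_ge0 : forall i, 0 <= n i).
Context (P_le : forall i t, (1 <= i <= N)%N -> x i.-1 <= t <= x i ->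
  `|(P i).[t]| <= K1 * n i).
Context (Q_le : forall i, (1 <= i <= N)%N ->
  \sum_(1 <= j < r.+1) `|Q i j| <= K2 * h i * n i).
Context (th tp B b' gam : R -> R).
Context (thP : primitive a b th tp) (th_a : th a = 0) (th_b : th b = 0).
Context (tpE : forall i t, (1 <= i <= N)%N -> x i.-1 < t < x i -> tp t = (P i).[t]).
Context (Q_sum : forall i, (1 <= i <= N)%N ->
  \sum_(1 <= j < r.+1) Q i j = th (x i) - th (x i.-1)).
Context (BP : primitive a b B b') (B_le : forall t, a <= t <= b -> `|B t| <= MB).
Context (gam_meas : measurable_fun `]a, b[ gam).
Context (gam_le : forall t, a < t < b -> `|gam t| <= MG).
Context (coercive : {ae mu, forall t, a < t < b -> 0 <= gam t - 2^-1 * b' t}).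

(** The discrete H^1 norm of theta. In the application [P i] is theta' on element i, [n i] its
    [gauss_norm], and [Q i j] its weighted Gauss values. *)
Definition energy : R := Num.sqrt (\sum_(1 <= i < N.+1) h i * n i ^+ 2).
Local Notation Y := energy.
Local Notation L := (Num.sqrt (b - a)).

Let h_gt0 i : (1 <= i <= N)%N -> 0 < h i.
Proof. by move=> iN; rewrite subr_gt0 (mesh_step hx iN). Qed.

Let L_sqr : L ^+ 2 = b - a. Proof. by rewrite sqr_sqrtr// subr_ge0 ltW. Qed.

Lemma energy_ge0 : 0 <= Y. Proof. exact: sqrtr_ge0. Qed.

Lemma energy_sqr : Y ^+ 2 = \sum_(1 <= i < N.+1) h i * n i ^+ 2.
Proof.
rewrite sqr_sqrtr// big_nat; apply: sumr_ge0 => i iN.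
by rewrite mulr_ge0 ?sqr_ge0// ltW// h_gt0.
Qed.

Lemma sum_sqrt_energy (V : nat -> R) U : 0 <= U ->
  \sum_(1 <= i < N.+1) V i ^+ 2 <= U ^+ 2 ->
  \sum_(1 <= i < N.+1) Num.sqrt (h i) * n i * V i <= Y * U.
Proof.
move=> U0 VU; apply: sum_cauchy_schwarz_le => //; first exact: energy_ge0.
rewrite energy_sqr big_nat [leRHS]big_nat; apply: ler_sum => i iN.
by rewrite exprMn sqr_sqrtr// ltW// h_gt0.
Qed.

Lemma sum_h_n : \sum_(1 <= i < N.+1) h i * n i <= L * Y.
Proof.
rewrite mulrC (eq_big_nat _ _ (F2 := fun i => Num.sqrt (h i) * n i * Num.sqrt (h i))).
  apply: sum_sqrt_energy; first exact: sqrtr_ge0.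
  rewrite L_sqr -(sum_mesh_steps hx) big_nat [leRHS]big_nat; apply: ler_sum => i iN.
  by rewrite sqr_sqrtr// ltW// h_gt0.
by move=> i iN; rewrite mulrAC -expr2 sqr_sqrtr// ltW// h_gt0.
Qed.

Lemma intg_elt_le f M i : (1 <= i <= N)%N -> L1 a b f ->
  (forall t, x i.-1 < t < x i -> `|f t| <= M) ->
  `|intg (x i.-1) (x i) f| <= M * h i.
Proof.
move=> iN fi fM; have [h1 h2] := mesh_elt hx iN.
by apply: intg_bound => //; [exact/ltW/(mesh_step hx iN)|exact: L1S fi].
Qed.

Lemma intg_norm_mesh_le f (M : nat -> R) : L1 a b f ->
  (forall i t, (1 <= i <= N)%N -> x i.-1 < t < x i -> `|f t| <= M i) ->
  intg a b (fun t => `|f t|) <= \sum_(1 <= i < N.+1) M i * h i.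
Proof.
move=> fi fM; rewrite (intg_mesh hx (L1_norm fi)) big_nat [leRHS]big_nat.
apply: ler_sum => i iN; apply: le_trans (ler_norm _) _.
apply: intg_elt_le => //; first exact: L1_norm.
by move=> t xt; rewrite normr_id; exact: fM xt.
Qed.

Lemma primitive_norm_le V v t : primitive a b V v -> V a = 0 -> a <= t <= b ->
  `|V t| <= intg a b (fun t => `|v t|).
Proof.
move=> [vi VE] Va /andP[ta tb].
have := VE a t (lexx _) ta tb; rewrite Va subr0 => ->.
apply: (le_trans (intg_norm (L1S (lexx _) tb vi))).
exact: (intg_subset (L1_norm vi) (lexx _) ta tb).
Qed.

(** [th] vanishes at a, so its sup norm is at most the L^1 norm of its derivative, which is bounded
    by K1 times the sum of h_i n_i. *)
Lemma theta_le t : a <= t <= b -> `|th t| <= K1 * (L * Y).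
Proof.
move=> tab; apply: (le_trans (primitive_norm_le thP th_a tab)).
apply: (le_trans (intg_norm_mesh_le (M := fun i => K1 * n i) thP.1 _)).
  by move=> i s iN xs; rewrite (tpE iN xs) P_le//; lra.
rewrite (_ : \sum_(_ <= _ < _) _ = K1 * \sum_(1 <= i < N.+1) h i * n i).
  by rewrite ler_wpM2l ?(ltW K1_gt0)//; exact: sum_h_n.
by rewrite mulr_sumr; apply: eq_bigr => i _; ring.
Qed.

Let B_within : {within `[a, b], continuous B}.
Proof. exact: primitive_within (ltW hab) BP. Qed.

Let gam_L1 f : L1 a b f -> L1 a b (fun t => gam t * f t).
Proof. exact: L1M gam_meas gam_le. Qed.

Let th_within : {within `[a, b], continuous th}.
Proof. exact: primitive_within (ltW hab) thP. Qed.

Let th_L1 : L1 a b th. Proof. exact: L1_within. Qed.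

Lemma lower_order_L1 : L1 a b (fun t => B t * tp t + gam t * th t).
Proof. by apply: L1D; [exact: L1M_within thP.1|exact: gam_L1]. Qed.

Lemma tp_le i t : (1 <= i <= N)%N -> x i.-1 < t < x i -> `|tp t| <= K1 * n i.
Proof. by move=> iN xt; rewrite (tpE iN xt) P_le//; lra. Qed.

Lemma tp_bounded i : (1 <= i <= N)%N -> exists M, forall t, x i.-1 < t < x i -> `|tp t| <= M.
Proof. by move=> iN; exists (K1 * n i) => t; exact: tp_le. Qed.

(* Coercivity: [int th (B th' + gam th) = int (gam - B'/2) th^2]. *)
Lemma theta_coercive : 0 <= intg a b (fun t => th t * (B t * tp t + gam t * th t)).
Proof.
have thth := primitiveM_mesh hx thP thP tp_bounded.
have tt_within := primitive_within (ltW hab) thth.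
(* The derivative of th^2 B has integral 0, as [th] vanishes at both ends; half of it absorbs the
   term th B th'. *)
have ttB := primitiveM_mesh hx thth BP _.
have [i iN|I1 I2] := ttB.
  exists (2 * (K1 * n i) * (K1 * (L * Y))) => t xt.
  have [h1 h2] := mesh_elt hx iN.
  have e1 := tp_le iN xt; have e2 := theta_le (_ : a <= t <= b).
  rewrite (_ : _ + _ = 2 * (tp t * th t)); last by ring.
  rewrite -mulrA !normrM (ger0_norm (ler0n _ 2)) ler_wpM2l//; apply: ler_pM => //.
  by apply: e2; lra.
have := I2 a b (lexx _) (ltW hab) (lexx _).
rewrite th_a th_b !mul0r subrr.
have i1 : L1 a b (fun t => 2^-1 * ((tp t * th t + th t * tp t) * B t + th t * th t * b' t)).
  exact: L1Z.
have i2 : L1 a b (fun t => (gam t - 2^-1 * b' t) * (th t * th t)).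
  have j1 : L1 a b (fun t => gam t * (th t * th t)) by apply: gam_L1; exact: L1M_within.
  have j2 : L1 a b (fun t => 2^-1 * (th t * th t * b' t)).
    by apply: L1Z; exact: L1M_within tt_within BP.1.
  apply: L1_eq (L1B j1 j2) => t _; ring.
move=> I0.
have -> : intg a b (fun t => th t * (B t * tp t + gam t * th t)) =
  intg a b (fun t => 2^-1 * ((tp t * th t + th t * tp t) * B t + th t * th t * b' t) +
    (gam t - 2^-1 * b' t) * (th t * th t)).
  by congr intg; apply/funext => t; field.
rewrite (intgD i1 i2) (intgZ _ I1) -I0 mulr0 add0r; apply: (intg_ge0_ae i2).
apply: ae_imp coercive => t ct tab; rewrite mulr_ge0 ?ct// -expr2 sqr_ge0//.
Qed.

Context (Zt : R -> R).
Context (ZtP : primitive a b Zt (fun t => B t * tp t + gam t * th t)).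

(** K1 and K2 stem from the integral and from the quadrature sum respectively; the other factor
    measures the oscillation of [Zt] on an element. *)
Definition quad_const : R := (K1 + K2) * (K1 * (MB + MG * L ^+ 2)).

(* On each element [Zt] is replaced by its value at the left node, for which the
   quadrature is exact. *)
Lemma quadrature_error :
  \sum_(1 <= i < N.+1) \sum_(1 <= j < r.+1) Q i j * Zt (g i j) <=
  intg a b (fun t => tp t * Zt t) + quad_const * hm * Y ^+ 2.
Proof.
have Zc := primitive_within (ltW hab) ZtP.
have tpZ : L1 a b (fun t => tp t * Zt t).
  by under eq_fun do rewrite mulrC; exact: L1M_within Zc thP.1.
(* Bound for the oscillation of [Zt] on element i: its derivative is at most MB K1 n_i from B th'
   plus MG K1 L Y from gam th. *)
pose D i := K1 * (MB * n i + MG * (L * Y)) * h i.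
have D0 i : (1 <= i <= N)%N -> 0 <= D i.
  move=> iN; rewrite !mulr_ge0 ?(ltW K1_gt0) ?(ltW (h_gt0 iN))// addr_ge0// mulr_ge0//.
  by rewrite mulr_ge0 ?sqrtr_ge0// energy_ge0.
have ZD i t : (1 <= i <= N)%N -> x i.-1 <= t <= x i -> `|Zt t - Zt (x i.-1)| <= D i.
  move=> iN /andP[xt tx]; have [h1 h2] := mesh_elt hx iN.
  have [Xi ZE] := ZtP; rewrite (ZE _ _ h1 xt (le_trans tx h2)).
  apply: (@le_trans _ _ (K1 * (MB * n i + MG * (L * Y)) * (t - x i.-1))).
    apply: intg_bound => //; first by apply: L1S Xi => //; exact: le_trans h2.
    move=> s xs; have xs' : x i.-1 < s < x i by lra.
    have sab : a <= s <= b by lra.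
    have sab' : a < s < b by lra.
    apply: le_trans (ler_normD _ _) _; rewrite !normrM mulrDr; apply: lerD.
      by rewrite mulrCA; apply: ler_pM => //; [exact: B_le|exact: tp_le].
    by rewrite mulrCA; apply: ler_pM => //; [exact: gam_le|exact: theta_le].
  rewrite /D; apply: ler_wpM2l; last by rewrite lerD2r.
  have := D0 i iN; rewrite /D pmulr_lge0// h_gt0//.
rewrite (intg_mesh hx tpZ) energy_sqr.
have step i : (1 <= i <= N)%N -> \sum_(1 <= j < r.+1) Q i j * Zt (g i j) <=
    intg (x i.-1) (x i) (fun t => tp t * Zt t) + (K1 + K2) * (h i * n i) * D i.
  move=> iN; have [h1 h2] := mesh_elt hx iN; have hi := h_gt0 iN.
  have xx := ltW (mesh_step hx iN).
  have tpi : L1 (x i.-1) (x i) tp by exact: L1S thP.1.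
  have tpZi : L1 (x i.-1) (x i) (fun t => tp t * Zt t) by exact: L1S tpZ.
  have kt : L1 (x i.-1) (x i) (fun t => Zt (x i.-1) * tp t) by exact: L1Z.
  have -> : \sum_(1 <= j < r.+1) Q i j * Zt (g i j) =
    Zt (x i.-1) * \sum_(1 <= j < r.+1) Q i j +
    \sum_(1 <= j < r.+1) Q i j * (Zt (g i j) - Zt (x i.-1)).
    by rewrite mulr_sumr -big_split/=; apply: eq_bigr => j _; ring.
  have -> : Zt (x i.-1) * \sum_(1 <= j < r.+1) Q i j =
      intg (x i.-1) (x i) (fun t => tp t * Zt t) -
      intg (x i.-1) (x i) (fun t => tp t * Zt t - Zt (x i.-1) * tp t).
    by rewrite (intgB tpZi kt) (intgZ _ tpi) Q_sum// (thP.2 _ _ h1 xx h2); ring.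
  rewrite -addrA lerD2l (_ : _ * (h i * n i) * D i =
    K1 * n i * D i * h i + (K2 * h i * n i) * D i); last by ring.
  apply: lerD.
    rewrite (le_trans (ler_norm _))// normrN; apply: intg_bound => //; first exact: L1B.
    move=> t xt; rewrite (_ : _ - _ = tp t * (Zt t - Zt (x i.-1))); last by ring.
    by rewrite normrM; apply: ler_pM => //; [exact: tp_le|apply: ZD => //; lra].
  apply: le_trans (ler_norm _) _; apply: le_trans (ler_norm_sum _ _ _) _.
  apply: le_trans (ler_wpM2r (D0 i iN) (Q_le iN)); rewrite mulr_suml.
  rewrite big_nat [leRHS]big_nat; apply: ler_sum => j jr.
  rewrite normrM ler_wpM2l// ZD//.
  by have /andP[g1 g2] := gauss_pt_itv hx r_gt0 hG iN jr; rewrite !ltW.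
apply: (@le_trans _ _ (\sum_(1 <= i < N.+1) (intg (x i.-1) (x i) (fun t => tp t * Zt t) +
    (K1 + K2) * (h i * n i) * D i))).
  by rewrite big_nat [leRHS]big_nat; apply: ler_sum => i iN; exact: step.
rewrite big_split/= lerD2l -energy_sqr.
have KK : 0 < K1 + K2 by rewrite addr_gt0.
apply: (@le_trans _ _ ((K1 + K2) * K1 * hm * (MB * \sum_(1 <= i < N.+1) h i * n i ^+ 2 +
    MG * (L * Y) * \sum_(1 <= i < N.+1) h i * n i))).
  rewrite !mulr_sumr -big_split/= mulr_sumr big_nat [leRHS]big_nat; apply: ler_sum => i iN.
  rewrite /D [leLHS](_ : _ = (K1 + K2) * K1 * (MB * (h i * n i ^+ 2) +
    MG * (L * Y) * (h i * n i)) * h i); last by ring.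
  rewrite [leRHS](_ : _ = (K1 + K2) * K1 * (MB * (h i * n i ^+ 2) +
    MG * (L * Y) * (h i * n i)) * hm); last by ring.
  have hi := ltW (h_gt0 iN); apply: ler_wpM2l; last exact: mesh_size_ge iN.
  rewrite !mulr_ge0 ?(ltW KK) ?(ltW K1_gt0)// addr_ge0// !mulr_ge0 ?sqr_ge0//.
  exact: sqrtr_ge0.
rewrite -energy_sqr /quad_const [leRHS](_ : _ = (K1 + K2) * K1 * hm *
  (MB * Y ^+ 2 + MG * (L * Y) * (L * Y))); last by ring.
apply: ler_wpM2l; first by rewrite !mulr_ge0 ?(ltW KK) ?(ltW K1_gt0)//; exact: mesh_size_ge0.
rewrite lerD2l ler_wpM2l ?sum_h_n// !mulr_ge0 ?sqrtr_ge0//; exact: energy_ge0.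
Qed.

Lemma quadrature_theta :
  \sum_(1 <= i < N.+1) \sum_(1 <= j < r.+1) Q i j * Zt (g i j) <= quad_const * hm * Y ^+ 2.
Proof.
apply: (le_trans quadrature_error); rewrite -[leRHS]add0r lerD2r.
have [I1 I2] := primitiveM_mesh hx thP ZtP tp_bounded.
have Zc := primitive_within (ltW hab) ZtP.
have tpZ : L1 a b (fun t => tp t * Zt t).
  by under eq_fun do rewrite mulrC; exact: L1M_within Zc thP.1.
have := I2 a b (lexx _) (ltW hab) (lexx _).
rewrite th_a th_b !mul0r subrr (intgD tpZ (L1M_within th_within lower_order_L1)) => /esym/eqP.
by rewrite addr_eq0 => /eqP ->; rewrite oppr_le0 theta_coercive.
Qed.

Context (rho rp Zr : R -> R) (e : nat -> R).
Context (rhoP : primitive a b rho rp) (rho_a : rho a = 0).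
Context (rp_bounded : forall i, (1 <= i <= N)%N ->
  exists M, forall t, x i.-1 < t < x i -> `|rp t| <= M).
Context (rho_le : forall i t, (1 <= i <= N)%N -> x i.-1 <= t <= x i -> `|rho t| <= e i).
Context (ZrP : primitive a b Zr (fun t => B t * rp t + gam t * rho t)) (Zr_a : Zr a = 0).

Lemma Zr_le i t : (1 <= i <= N)%N -> x i.-1 <= t <= x i ->
  `|Zr t| <= MB * e i +
    \sum_(1 <= k < N.+1) e k * intg (x k.-1) (x k) (fun t => `|gam t - b' t|).
Proof.
move=> iN xt; have [h1 h2] := mesh_elt hx iN.
have tab : a <= t <= b by lra.
have rc := primitive_within (ltW hab) rhoP.
have rhoB := primitiveM_mesh hx rhoP BP rp_bounded.
have gb : L1 a b (fun t => gam t - b' t).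
  apply: L1B BP.1; apply: L1_eq (gam_L1 (L1_cst a b 1)) => s _; exact: mulr1.
pose v t := (gam t - b' t) * rho t.
have vi : L1 a b v.
  rewrite /v; under eq_fun do rewrite mulrC; exact: L1M_within.
(* Integration by parts of B rho': the derivative of [V] is (gam - b') rho, free of [rp]. *)
pose V t := Zr t - rho t * B t.
have VP : primitive a b V v.
  apply: primitive_eq (primitiveB ZrP rhoB) => // s _; rewrite /v; ring.
have Va : V a = 0 by rewrite /V Zr_a rho_a mul0r subrr.
rewrite (_ : Zr t = rho t * B t + V t); last by rewrite /V; ring.
apply: le_trans (ler_normD _ _) _; apply: lerD.
  by rewrite normrM mulrC; apply: ler_pM => //; [exact: B_le|exact: rho_le xt].
apply: (le_trans (primitive_norm_le VP Va tab)).
rewrite (intg_mesh hx (L1_norm vi)) big_nat [leRHS]big_nat; apply: ler_sum => k kN.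
have [k1 k2] := mesh_elt hx kN.
have gbk : L1 (x k.-1) (x k) (fun t => `|gam t - b' t|) by apply: L1S (L1_norm gb).
rewrite -(intgZ _ gbk); apply: intg_le.
- exact: L1S (L1_norm vi).
- exact: L1Z.
- move=> s ks; rewrite normrM mulrC ler_wpM2r//; apply: (rho_le kN); lra.
Qed.

Context (C0 MA al0 k0 EE : R) (E : nat -> R) (al rpg : nat -> nat -> R).
Context (C0_ge0 : 0 <= C0) (MA_ge0 : 0 <= MA) (al0_gt0 : 0 < al0) (k0_gt0 : 0 < k0).
Context (E_ge0 : forall i, 0 <= E i) (EE_ge0 : 0 <= EE).
Context (E_sum : \sum_(1 <= i < N.+1) E i ^+ 2 <= EE ^+ 2).
Context (eE : forall i, e i = C0 * h i ^+ r * Num.sqrt (h i) * E i).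
Context (al_le : forall i j, (1 <= i <= N)%N -> (1 <= j <= r)%N -> `|al i j| <= MA).
Context (rpg_le : forall i j, (1 <= i <= N)%N -> (1 <= j <= r)%N -> `|rpg i j| <= e i).
Context (Q_coercive : forall i, (1 <= i <= N)%N -> k0 * al0 * h i * n i ^+ 2 <=
  \sum_(1 <= j < r.+1) Q i j * (al i j * (P i).[g i j])).
Context (orthogonal : \sum_(1 <= i < N.+1) \sum_(1 <= j < r.+1) Q i j *
  (al i j * (rpg i j - (P i).[g i j]) - (Zr (g i j) - Zt (g i j))) = 0).
Context (gb_sqr : L1 a b (fun t => (gam t - b' t) ^+ 2)).

Local Notation DD := (Num.sqrt (intg a b (fun t => (gam t - b' t) ^+ 2))).

Lemma e_ge0 i : (1 <= i <= N)%N -> 0 <= e i.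
Proof.
move=> iN; have hi := ltW (h_gt0 iN).
by rewrite eE !mulr_ge0 ?exprn_ge0 ?sqrtr_ge0.
Qed.

Lemma hpow_le i : (1 <= i <= N)%N -> h i ^+ r.+1 <= hm ^+ r.+1.
Proof.
move=> iN; have hi := ltW (h_gt0 iN); have hh := mesh_size_ge x iN.
by rewrite lerXn2r ?nnegrE// (le_trans hi hh).
Qed.

(** The weight h_i raises h_i^r to h_i^(r+1), while Cauchy-Schwarz pairs sqrt(h_i) n_i with E_i. *)
Lemma sum_h_n_e : \sum_(1 <= i < N.+1) h i * n i * e i <= C0 * hm ^+ r.+1 * (Y * EE).
Proof.
apply: le_trans (ler_wpM2l _ (sum_sqrt_energy EE_ge0 E_sum)); last first.
  by rewrite mulr_ge0 ?exprn_ge0//; exact: mesh_size_ge0.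
rewrite mulr_sumr big_nat [leRHS]big_nat; apply: ler_sum => i iN.
rewrite eE [leLHS](_ : _ = C0 * (h i ^+ r.+1) * (Num.sqrt (h i) * n i * E i)); last first.
  by rewrite exprS; ring.
apply: ler_wpM2r; first by rewrite !mulr_ge0 ?sqrtr_ge0.
by rewrite ler_wpM2l// hpow_le.
Qed.

(** As gam - b' is only square integrable, Cauchy-Schwarz on element k yields sqrt(h_k), which meets
    the sqrt(h_k) in e_k to form the missing power of h_k. *)
Lemma sum_e_intg :
  \sum_(1 <= k < N.+1) e k * intg (x k.-1) (x k) (fun t => `|gam t - b' t|) <=
  C0 * hm ^+ r.+1 * (EE * DD).
Proof.
have gb : L1 a b (fun t => gam t - b' t).
  apply: L1B BP.1; apply: L1_eq (gam_L1 (L1_cst a b 1)) => s _; exact: mulr1.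
pose D k := Num.sqrt (intg (x k.-1) (x k) (fun t => (gam t - b' t) ^+ 2)).
have sq0 k : 0 <= intg (x k.-1) (x k) (fun t => (gam t - b' t) ^+ 2).
  by apply: intg_ge0 => t _; exact: sqr_ge0.
have CS : \sum_(1 <= k < N.+1) E k * D k <= EE * DD.
  apply: sum_cauchy_schwarz_le => //.
  rewrite sqr_sqrtr; last by apply: intg_ge0 => t _; exact: sqr_ge0.
  by rewrite (intg_mesh hx gb_sqr); apply: ler_sum => k _; rewrite sqr_sqrtr.
apply: le_trans (ler_wpM2l _ CS); last first.
  by rewrite mulr_ge0 ?exprn_ge0//; exact: mesh_size_ge0.
rewrite mulr_sumr big_nat [leRHS]big_nat; apply: ler_sum => k kN.
have hk := ltW (h_gt0 kN); have [k1 k2] := mesh_elt hx kN.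
have ID : intg (x k.-1) (x k) (fun t => `|gam t - b' t|) <= Num.sqrt (h k) * D k.
  have H := cauchy_schwarz_sqr (mesh_step hx kN) (L1S k1 k2 gb) (L1S k1 k2 gb_sqr).
  have i0 : 0 <= intg (x k.-1) (x k) (fun t => `|gam t - b' t|).
    by apply: intg_ge0 => t _; exact: normr_ge0.
  rewrite -(ler_sqr (i0 : _ \is Num.nneg)) ?nnegrE ?mulr_ge0 ?sqrtr_ge0//.
  by rewrite exprMn /D (sqr_sqrtr (sq0 k)) (sqr_sqrtr hk).
apply: le_trans (ler_wpM2l (e_ge0 kN) ID) _.
rewrite eE [leLHS](_ : _ = C0 * h k ^+ r * (Num.sqrt (h k) ^+ 2) * (E k * D k)); last by ring.
rewrite sqr_sqrtr// -(mulrA C0) -exprSr.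
apply: ler_wpM2r; first by rewrite mulr_ge0// sqrtr_ge0.
by rewrite ler_wpM2l// hpow_le.
Qed.

(** MA belongs to alpha rho', MB to the boundary term B rho of [Zr], and L times the root of the
    integral to the remaining part of [Zr]. *)
Definition data_const : R := K2 * C0 * (MA + MB + L * DD).

Lemma energy_quadratic :
  k0 * al0 * Y ^+ 2 <= data_const * hm ^+ r.+1 * EE * Y + quad_const * hm * Y ^+ 2.
Proof.
set J := \sum_(1 <= k < N.+1) e k * intg (x k.-1) (x k) (fun t => `|gam t - b' t|).
have J0 : 0 <= J.
  rewrite /J big_nat; apply: sumr_ge0 => k kN; rewrite mulr_ge0 ?e_ge0//.
  by apply: intg_ge0 => t _.
have lhs : k0 * al0 * Y ^+ 2 <=
    \sum_(1 <= i < N.+1) \sum_(1 <= j < r.+1) Q i j * (al i j * (P i).[g i j]).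
  rewrite energy_sqr mulr_sumr big_nat [leRHS]big_nat; apply: ler_sum => i iN.
  by rewrite mulrA; exact: Q_coercive.
apply: (le_trans lhs).
(* Orthogonality exchanges the coercive sum in alpha theta' for the approximation terms in [rho] and
   the sum in [Zt]. *)
have -> : \sum_(1 <= i < N.+1) \sum_(1 <= j < r.+1) Q i j * (al i j * (P i).[g i j]) =
    \sum_(1 <= i < N.+1) \sum_(1 <= j < r.+1) Q i j * (al i j * rpg i j - Zr (g i j)) +
    \sum_(1 <= i < N.+1) \sum_(1 <= j < r.+1) Q i j * Zt (g i j).
  apply/esym/eqP; rewrite -subr_eq0; apply/eqP; rewrite -[RHS]orthogonal.
  rewrite -big_split/= -sumrB; apply: eq_bigr => i _.
  by rewrite -big_split/= -sumrB; apply: eq_bigr => j _; ring.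
apply: lerD; last exact: quadrature_theta.
apply: (@le_trans _ _ (\sum_(1 <= i < N.+1) K2 * (h i * n i) * ((MA + MB) * e i + J))).
  rewrite big_nat [leRHS]big_nat; apply: ler_sum => i iN.
  apply: le_trans (ler_norm _) _; apply: le_trans (ler_norm_sum _ _ _) _.
  have c0 : 0 <= (MA + MB) * e i + J by rewrite addr_ge0// mulr_ge0 ?e_ge0// addr_ge0.
  rewrite mulrA; apply: le_trans (ler_wpM2r c0 (Q_le iN)); rewrite mulr_suml.
  rewrite big_nat [leRHS]big_nat; apply: ler_sum => j jr.
  rewrite normrM ler_wpM2l// (le_trans (ler_normB _ _))// mulrDl -addrA; apply: lerD.
    by rewrite normrM; apply: ler_pM => //; [exact: al_le|exact: rpg_le].
  apply: Zr_le => //.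
  by have /andP[g1 g2] := gauss_pt_itv hx r_gt0 hG iN jr; rewrite !ltW.
have -> : \sum_(1 <= i < N.+1) K2 * (h i * n i) * ((MA + MB) * e i + J) =
    K2 * (MA + MB) * \sum_(1 <= i < N.+1) h i * n i * e i +
    K2 * J * \sum_(1 <= i < N.+1) h i * n i.
  rewrite [X in _ = X + _]mulr_sumr [X in _ = _ + X]mulr_sumr -big_split/=.
  by apply: eq_bigr => i _; ring.
rewrite /data_const [leRHS](_ : _ = K2 * (MA + MB) * (C0 * hm ^+ r.+1 * (Y * EE)) +
  K2 * (C0 * hm ^+ r.+1 * (EE * DD)) * (L * Y)); last by ring.
have K20 := ltW K2_gt0.
apply: lerD; first by apply: ler_wpM2l sum_h_n_e; rewrite mulr_ge0// addr_ge0.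
apply: ler_pM; rewrite ?sum_h_n//.
- by rewrite mulr_ge0.
- by rewrite big_nat; apply: sumr_ge0 => i iN; rewrite mulr_ge0// ltW// h_gt0.
- by rewrite ler_wpM2l//; exact: sum_e_intg.
Qed.

Context (h_small : quad_const * hm <= k0 * al0 / 2).

Lemma data_const_ge0 : 0 <= data_const.
Proof. by rewrite !mulr_ge0 ?(ltW K2_gt0)// !addr_ge0// mulr_ge0 ?sqrtr_ge0. Qed.

(** By [h_small] half of the coercive term absorbs the quadrature error; the remaining quadratic
    inequality is divided by Y. *)
Lemma energy_le : Y <= 2 * data_const / (k0 * al0) * (hm ^+ r.+1 * EE).
Proof.
have ka : 0 < k0 * al0 by rewrite mulr_gt0.
have h0 : 0 <= hm ^+ r.+1 * EE by rewrite mulr_ge0 ?exprn_ge0//; exact: mesh_size_ge0.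
have d0 := data_const_ge0.
have [Y0|Y0] := leP Y 0.
  apply: (le_trans Y0).
  exact: mulr_ge0 (divr_ge0 (mulr_ge0 (ler0n _ 2) d0) (ltW ka)) h0.
have H := energy_quadratic.
have H2 : k0 * al0 / 2 * Y ^+ 2 <= data_const * hm ^+ r.+1 * EE * Y.
  have := ler_wpM2r (sqr_ge0 Y) h_small; move: H; lra.
have ka2 : 0 < k0 * al0 / 2 by rewrite divr_gt0.
rewrite -(ler_pM2l ka2) -(ler_pM2r Y0).
rewrite [leLHS](_ : _ = k0 * al0 / 2 * Y ^+ 2); last by ring.
rewrite [leRHS](_ : _ = data_const * hm ^+ r.+1 * EE * Y)//.
by field; rewrite !gt_eqF.
Qed.

(** C0 bounds rho and the second summand theta. One factor L comes from [theta_le], the other from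
    integrating a sup bound over (a, b). The outer 2 serves for 2(p^2 + q^2) <= (2(p + q))^2. *)
Definition error_const : R :=
  2 * (C0 + K1 * L ^+ 2 * (2 * data_const / (k0 * al0))).

Lemma error_sqr_le : intg a b (fun t => (rho t - th t) ^+ 2) <=
  (error_const * hm ^+ r.+1 * EE) ^+ 2.
Proof.
have rc := primitive_within (ltW hab) rhoP.
pose d t := rho t - th t.
have dc : {within `[a, b], continuous d}.
  exact: primitive_within (ltW hab) (primitiveB rhoP thP).
have d2i : L1 a b (fun t => d t ^+ 2) by exact: L1M_within (L1_within dc).
set S := hm ^+ r.+1 * EE.
have S0 : 0 <= S by rewrite mulr_ge0 ?exprn_ge0//; exact: mesh_size_ge0.
set k := 2 * data_const / (k0 * al0).
have k_ge0 : 0 <= k.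
  exact: divr_ge0 (mulr_ge0 (ler0n _ 2) data_const_ge0) (ltW (mulr_gt0 k0_gt0 al0_gt0)).
have YS : Y <= k * S := energy_le.
pose T := K1 * (L * (k * S)).
have T0 : 0 <= T := mulr_ge0 (ltW K1_gt0) (mulr_ge0 (sqrtr_ge0 _) (mulr_ge0 k_ge0 S0)).
have thT t : a <= t <= b -> `|th t| <= T.
  move=> tab; apply: (le_trans (theta_le tab)).
  by rewrite !ler_wpM2l ?sqrtr_ge0// ltW.
apply: (@le_trans _ _ (\sum_(1 <= i < N.+1) (2 * (e i ^+ 2 * h i) + 2 * T ^+ 2 * h i))).
  rewrite (intg_mesh hx d2i) big_nat [leRHS]big_nat; apply: ler_sum => i iN.
  apply: le_trans (ler_norm _) _.
  rewrite [leRHS](_ : _ = (2 * e i ^+ 2 + 2 * T ^+ 2) * h i); last by ring.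
  apply: intg_elt_le => // t xt; have [h1 h2] := mesh_elt hx iN.
  have e1 : `|rho t| <= e i by apply: (rho_le iN); lra.
  have e2 : `|th t| <= T by apply: thT; lra.
  rewrite normrX /d; apply: (@le_trans _ _ ((e i + T) ^+ 2)).
    have eT := addr_ge0 (e_ge0 iN) T0.
    have dT := le_trans (ler_normB (rho t) (th t)) (lerD e1 e2).
    by rewrite lerXn2r// nnegrE.
  by have := sqr_ge0 (e i - T); rewrite !expr2; nra.
rewrite big_split/= -!mulr_sumr (sum_mesh_steps hx).
apply: (@le_trans _ _ (2 * (C0 ^+ 2 * S ^+ 2) + 2 * T ^+ 2 * (b - a))).
  rewrite lerD2r ler_wpM2l//.
  apply: (@le_trans _ _ (C0 ^+ 2 * (hm ^+ r.+1) ^+ 2 * \sum_(1 <= i < N.+1) E i ^+ 2)).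
    rewrite mulr_sumr big_nat [leRHS]big_nat; apply: ler_sum => i iN.
    have hi := ltW (h_gt0 iN).
    (* The factor sqrt(h_i) of [e i], once squared, joins the length h_i of the element; together
       they complete (h_i^(r+1))^2. *)
    rewrite eE [leLHS](_ : _ = C0 ^+ 2 * (h i ^+ r * h i) ^+ 2 * E i ^+ 2); last first.
      rewrite (_ : _ ^+ 2 = C0 ^+ 2 * (h i ^+ r) ^+ 2 * Num.sqrt (h i) ^+ 2 * E i ^+ 2).
        by rewrite (sqr_sqrtr hi); ring.
      by rewrite !exprMn.
    rewrite -exprSr; apply: ler_wpM2r; first exact: sqr_ge0.
    apply: ler_wpM2l; first exact: sqr_ge0.
    by rewrite lerXn2r ?nnegrE ?hpow_le ?exprn_ge0//; exact: mesh_size_ge0.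
  have -> : S ^+ 2 = (hm ^+ r.+1) ^+ 2 * EE ^+ 2 by exact: exprMn.
  rewrite mulrA; apply: ler_wpM2l => //.
  exact: mulr_ge0 (sqr_ge0 _) (sqr_ge0 _).
rewrite -mulrA -/S -L_sqr /error_const -/k.
rewrite [leLHS](_ : _ = 2 * ((C0 * S) ^+ 2 + (K1 * L ^+ 2 * k * S) ^+ 2)); last first.
  by rewrite /T; ring.
rewrite [leRHS](_ : _ = (2 * (C0 * S + K1 * L ^+ 2 * k * S)) ^+ 2); last first.
  by rewrite /S; move: (hm ^+ r.+1) => s; ring.
have c1 : 0 <= C0 * S by rewrite mulr_ge0.
have c2 : 0 <= K1 * L ^+ 2 * k * S.
  exact: mulr_ge0 (mulr_ge0 (mulr_ge0 (ltW K1_gt0) (sqr_ge0 _)) k_ge0) S0.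
move: c1 c2; move: (C0 * S) (K1 * L ^+ 2 * k * S) => p q p0 q0.
by rewrite !expr2; nra.
Qed.

End Core.

(** * Passage to the scheme *)

Section Gluing.
Context {R : realType} (a b : R) (N : nat) (x : nat -> R) (hx : mesh a b N x).
Implicit Types (g : R -> R).

Lemma L1_mesh g : (forall i, (1 <= i <= N)%N -> L1 (x i.-1) (x i) g) -> L1 a b g.
Proof.
move=> gi; case: (hx) => xa xb _; rewrite -xb.
suff H n : (n <= N)%N -> L1 a (x n) g by exact: H.
elim: n => [|n IH] nN.
  by rewrite xa; apply: L1_eq (L1_cst a a 0) => t; lra.
have nN' : (1 <= n.+1 <= N)%N by [].
have [h1 h2] := mesh_elt hx nN'.
exact: L1_cat h1 (ltW (mesh_step hx nN')) (IH (ltnW nN)) (gi _ nN').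
Qed.

Lemma glue_mesh (F : nat -> R -> R) : exists g,
  forall i t, (1 <= i <= N)%N -> x i.-1 < t < x i -> g t = F i t.
Proof.
exists (fun t : R => \sum_(1 <= k < N.+1) if x k.-1 < t < x k then F k t else 0) => i t iN xt.
rewrite (bigD1_seq i) ?iota_uniq ?mem_index_iota//= xt.
rewrite big_nat_cond big1 ?addr0// => k /andP[kN ki].
suff -> : (x k.-1 < t < x k) = false by [].
have [ki'|ik] := ltnP k i.
  have kk : (k <= i.-1)%N by lia.
  have iN' : (i.-1 <= N)%N by lia.
  have H := mesh_mono hx kk iN'.
  by apply/negbTE; rewrite negb_and -!leNgt orbC (le_trans H)//; lra.
have kk : (i <= k.-1)%N by lia.
have kN' : (k.-1 <= N)%N by lia.
have H := mesh_mono hx kk kN'.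
by apply/negbTE; rewrite negb_and -!leNgt (le_trans _ H)//; lra.
Qed.

End Gluing.

Section TrialSpace.
Context {R : realType} (a b : R) (N : nat) (x : nat -> R) (hx : mesh a b N x) (r : nat).
Implicit Types (u v : R -> R).

Lemma trial_space_poly v : trial_space r a b N x v ->
  exists p : nat -> {poly R}, (forall i, (1 <= i <= N)%N ->
    [/\ (size (p i) <= r.+1)%N, forall t, x i.-1 <= t <= x i -> v t = (p i).[t] &
        forall t, x i.-1 < t < x i -> derive1 v t = (p i)^`().[t]]) /\
  primitive a b v (derive1 v).
Proof.
case=> _ pv _ _.
have /choice[p Hp] : forall i, exists q : {poly R}, (1 <= i <= N)%N ->
    (size q <= r.+1)%N /\ forall t, x i.-1 <= t <= x i -> v t = q.[t].
  move=> i; have [iN|iN] := boolP (1 <= i <= N)%N; last by exists 0.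
  by have [q sq qv] := pv i iN; exists q => _; split=> // t xt; rewrite qv// in_itv.
have pr i : (1 <= i <= N)%N -> primitive (x i.-1) (x i) v (horner (p i)^`()).
  move=> iN; have [_ H] := Hp i iN.
  by apply: primitive_eq (primitive_horner _ _ (p i)) => // t xt; rewrite H.
have d i t : (1 <= i <= N)%N -> x i.-1 < t < x i -> derive1 v t = (p i)^`().[t].
  move=> iN xt; apply: (primitive_derivable (pr i iN) xt _).2.
  exact: continuous_horner.
exists p; split=> [i iN|]; first by have [] := Hp i iN; split=> // t; exact: d.
apply: (primitive_elt hx) => i iN.
by apply: primitive_eq (pr i iN) => // t xt; rewrite (d _ _ iN xt).
Qed.

(** Bridge from weak to classical derivatives: the scheme and the equation are written with
    [derive1 u], while the approximation theory produces the functions [v i]. *)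
Lemma primitive_piecewise_C1 u (v : nat -> R -> R) :
  (forall i, (1 <= i <= N)%N -> primitive (x i.-1) (x i) u (v i) /\
    {within `[x i.-1, x i], continuous (v i)}) ->
  (forall i t, (1 <= i <= N)%N -> x i.-1 < t < x i ->
    derivable u t 1 /\ derive1 u t = v i t) /\ primitive a b u (derive1 u).
Proof.
move=> H.
have d i t : (1 <= i <= N)%N -> x i.-1 < t < x i -> derivable u t 1 /\ derive1 u t = v i t.
  move=> iN xt; have [uv vc] := H i iN; apply: (primitive_derivable uv xt).
  by apply: (within_continuous_continuous (mesh_step hx iN) vc); rewrite in_itv.
split=> //; apply: (primitive_elt hx) => i iN; have [uv _] := H i iN.
by apply: primitive_eq uv => // t xt; rewrite (d _ _ iN xt).2.
Qed.

End TrialSpace.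

(** * The error bound on a given mesh *)

Section Assembly.
Context {R : realType} (a b : R) (N : nat) (x : nat -> R) (hx : mesh a b N x).
Context (r : nat) (G : nat -> R) (r_gt0 : (0 < r)%N) (hG : legendre_zeros r G).
Context (hab : a < b).
Local Notation mu := (@lebesgue_measure R).
Local Notation h i := (x i - x i.-1).
Local Notation hm := (mesh_size N x).
Local Notation g i j := (gauss_pt x G r i j).
Context (alpha beta gamma : R -> R) (MA al0 : R).
Context (al0_gt0 : 0 < al0) (MA_ge0 : 0 <= MA).
Context (alpha_le : forall t, a <= t <= b -> `|alpha t| <= MA).
Context (alpha_ge : forall t, a <= t <= b -> al0 <= alpha t).
Context (beta_meas : measurable_fun `]a, b[ beta).
Context (gamma_meas : measurable_fun `]a, b[ gamma).
Context (B b' gam : R -> R) (MB MG : R) (MB_ge0 : 0 <= MB) (MG_ge0 : 0 <= MG).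
Context (BP : primitive a b B b') (B_le : forall t, a <= t <= b -> `|B t| <= MB).
Context (gam_meas : measurable_fun `]a, b[ gam).
Context (gam_le : forall t, a < t < b -> `|gam t| <= MG).
Context (gb_sqr : L1 a b (fun t => (gam t - b' t) ^+ 2)).
Context (coef_ae : {ae mu, forall t, a < t < b -> beta t = B t /\ gamma t = gam t}).
Context (coercive : {ae mu, forall t, a < t < b -> 0 <= gam t - 2^-1 * b' t}).
Context (K1 K2 k0 C0 : R).
Context (K1_gt0 : 0 < K1) (K2_gt0 : 0 < K2) (k0_gt0 : 0 < k0) (C0_gt0 : 0 < C0).
Context (element_bounds : forall (c d : R) (p : {poly R}), c < d -> (size p <= r)%N ->
  [/\ forall t, c <= t <= d -> `|p.[t]| <= K1 * gauss_norm r G c d p,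
      \sum_(1 <= j < r.+1) `|weight r G j * ((d - c) / 2) * p.[gpt G c d j]| <=
        K2 * (d - c) * gauss_norm r G c d p &
      forall (al : nat -> R) al0, 0 <= al0 -> (forall j, (1 <= j <= r)%N -> al0 <= al j) ->
        k0 * al0 * (d - c) * gauss_norm r G c d p ^+ 2 <=
        \sum_(1 <= j < r.+1) weight r G j * ((d - c) / 2) * p.[gpt G c d j] *
          (al j * p.[gpt G c d j])]).
Context (f u uP : R -> R) (EE : R) (EE_ge0 : 0 <= EE).
Context (e E : nat -> R) (eE : forall i, e i = C0 * h i ^+ r * Num.sqrt (h i) * E i).
Context (E_ge0 : forall i, 0 <= E i) (E_sum : \sum_(1 <= i < N.+1) E i ^+ 2 <= EE ^+ 2).
Context (v : nat -> R -> R) (p : nat -> {poly R}).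
Context (approx : forall i, (1 <= i <= N)%N -> [/\ primitive (x i.-1) (x i) u (v i),
    {within `[x i.-1, x i], continuous (v i)},
    [/\ (size (p i) <= r.+1)%N, (p i).[x i.-1] = u (x i.-1) & (p i).[x i] = u (x i)],
    forall t, x i.-1 <= t <= x i -> `|u t - (p i).[t]| <= e i &
    forall j y, (1 <= j <= r)%N -> y = 2^-1 * (x i + x i.-1 + (x i - x i.-1) * G j) ->
      `|v i y - (p i)^`().[y]| <= e i]).
Context (f_L1 : L1 a b f) (u_sol : bvp_solution a b alpha beta gamma f u).
Context (uP_sol : fv_solution a b alpha beta gamma f N x G r uP).
Context (h_small : quad_const a b K1 K2 MB MG * hm <= k0 * al0 / 2).

Lemma error_const_gt0 : 0 < error_const a b K1 K2 MB b' gam C0 MA al0 k0.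
Proof.
have d0 := data_const_ge0 a b K2_gt0 MB_ge0 b' gam (ltW C0_gt0) MA_ge0.
have k_ge0 := divr_ge0 (mulr_ge0 (ler0n R 2) d0) (ltW (mulr_gt0 k0_gt0 al0_gt0)).
rewrite /error_const mulr_gt0// ltr_pwDl//.
exact: mulr_ge0 (mulr_ge0 (ltW K1_gt0) (sqr_ge0 _)) k_ge0.
Qed.

Lemma fv_error_le :
  L2norm a b (u \- uP) <=
  error_const a b K1 K2 MB b' gam C0 MA al0 k0 * hm ^+ r.+1 * EE.
Proof.
have [[uc _ ua ub] [sigma [sigma_c sigmaE sigma_w]]] := u_sol.
have [q [qE uP_prim]] := trial_space_poly hx uP_sol.1.
have [_ _ uPa uPb] := uP_sol.1.
have [uD u_prim] : (forall i t, (1 <= i <= N)%N -> x i.-1 < t < x i ->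
    derivable u t 1 /\ derive1 u t = v i t) /\ primitive a b u (derive1 u).
  by apply: (primitive_piecewise_C1 hx) => i iN; have [] := approx iN.
have [xa xb _] := hx; have N_gt0 := mesh_N_gt0 hx hab.
pose P i := (q i - p i)^`().
have [tp tpE] := glue_mesh hx (fun i => horner (P i)).
have tp_L1 : L1 a b tp.
  apply: (L1_mesh hx) => i iN.
  by apply: L1_eq (primitive_horner (x i.-1) (x i) (q i - p i)).1 => t xt; rewrite (tpE i).
(* The interpolant exists only as a family of polynomials, so theta is recovered from its
   derivative; agreement at the nodes then propagates into each element. *)
pose th t := intg a t tp.
have thP : primitive a b th tp := primitive_intg tp_L1.
have th_a : th a = 0 by exact: intg_pt.
have node n : (n <= N)%N -> th (x n) = uP (x n) - u (x n).
  elim: n => [|n IH] nN; first by rewrite xa th_a uPa ua subrr.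
  have nN' : (1 <= n.+1 <= N)%N by [].
  have [h1 h2] := mesh_elt hx nN'; have st := ltW (mesh_step hx nN').
  have [_ qu _] := qE _ nN'; have [_ _ [_ pu pu'] _ _] := approx nN'.
  have [_ H] : primitive (x n) (x n.+1) (horner (q n.+1 - p n.+1)) tp.
    apply: primitive_eq (primitive_horner _ _ (q n.+1 - p n.+1)) => // s xs.
    by rewrite (tpE n.+1).
  have := H _ _ (lexx _) st (lexx _); have := thP.2 _ _ h1 st h2.
  rewrite /= (IH (ltnW nN)) !hornerE pu pu' /= -!qu ?lexx ?st//; lra.
have th_b : th b = 0 by rewrite -xb node// xb uPb ub subrr.
have thE i t : (1 <= i <= N)%N -> x i.-1 <= t <= x i -> th t = (q i).[t] - (p i).[t].
  move=> iN xt; have [h1 h2] := mesh_elt hx iN.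
  have [_ qu _] := qE i iN; have [_ _ [_ pu _] _ _] := approx iN.
  have H := primitive_horner (x i.-1) (x i) (q i - p i).
  rewrite -hornerN -hornerD; apply: (primitive_uniq (primitiveS h1 h2 thP) _ _ xt).
    by apply: primitive_eq H => // s xs; rewrite (tpE i).
  rewrite node; last by have /andP[_ /(leq_trans (leq_pred i))] := iN.
  by rewrite !hornerE pu qu// lexx ltW// (mesh_step hx iN).
(* This is u - uI, written so that absolute continuity is inherited from [u], [uP] and [th]. *)
pose rho t := u t - uP t + th t.
pose rp t : R := derive1 u t - derive1 uP t + tp t.
have rhoP : primitive a b rho rp by exact: primitiveD (primitiveB u_prim uP_prim) thP.
have rho_a : rho a = 0 by rewrite /rho ua uPa th_a subrr add0r.
have rhoE i t : (1 <= i <= N)%N -> x i.-1 <= t <= x i -> rho t = u t - (p i).[t].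
  move=> iN xt; have [_ qu _] := qE i iN.
  by rewrite /rho (thE i t iN xt) (qu t xt); ring.
have rpE i t : (1 <= i <= N)%N -> x i.-1 < t < x i -> rp t = v i t - (p i)^`().[t].
  move=> iN xt; have [_ _ qu] := qE i iN.
  by rewrite /rp (uD i t iN xt).2 (qu t xt) (tpE i t iN xt) /P derivB hornerD hornerN addrA subrK.
have gE i j : (1 <= j <= r)%N -> g i j = gpt G (x i.-1) (x i) j.
  by move=> /andP[_ jr]; rewrite gauss_ptE.
pose n i := gauss_norm r G (x i.-1) (x i) (P i).
pose Q i j := weight r G j * (h i / 2) * (P i).[gpt G (x i.-1) (x i) j].
have sP i : (1 <= i <= N)%N -> (size (P i) <= r)%N.
  move=> iN; have [sq _ _] := qE i iN; have [_ _ [sp _ _] _ _] := approx iN.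
  have s : (size (q i - p i)%R <= r.+1)%N.
    by rewrite (leq_trans (size_polyD _ _))// size_polyN geq_max sq sp.
  by rewrite (leq_trans (size_poly _ _))// -subn1 leq_subLR.
have bounds i (iN : (1 <= i <= N)%N) := element_bounds (mesh_step hx iN) (sP i iN).
have Q_sum i : (1 <= i <= N)%N -> \sum_(1 <= j < r.+1) Q i j = th (x i) - th (x i.-1).
  move=> iN; have [sq _ _] := qE i iN; have [_ _ [sp _ _] _ _] := approx iN.
  have st := ltW (mesh_step hx iN).
  rewrite !(thE i) ?lexx ?st// -!hornerN -!hornerD.
  rewrite (quadrature_itv r G r_gt0 hG (x i.-1) (x i) (q i - p i))//.
  by rewrite (leq_trans (size_polyD _ _))// size_polyN geq_max sq sp.
have gam_L1 w : L1 a b w -> L1 a b (fun t => gam t * w t) by exact: L1M gam_meas gam_le.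
have B_within := primitive_within (ltW hab) BP.
have lower W w : primitive a b W w -> L1 a b (fun t => B t * w t + gam t * W t).
  move=> WP; apply: L1D; first exact: L1M_within WP.1.
  exact/gam_L1/L1_within/(primitive_within (ltW hab) WP).
have uP_L1 : L1 a b (fun y => beta y * derive1 uP y + gamma y * uP y).
  apply: L1_eq_ae (lower _ _ uP_prim); last first.
    apply: measurable_funD; apply: measurable_funM => //; first exact: L1_meas uP_prim.1.
    exact: L1_meas (L1_within (primitive_within (ltW hab) uP_prim)).
  by apply: (ae_imp _ coef_ae) => t H /H[-> ->].
have [S [SP _ Ssigma]] := weak_primitive hab sigma_w.
(* The only place where fluxes are identified pointwise: [sigma] is continuous, hence equal to [S]
   there, and [u] is differentiable at Gauss points because they lie inside elements. *)
have Sg i j : (1 <= i <= N)%N -> (1 <= j <= r)%N -> S (g i j) = alpha (g i j) * derive1 u (g i j).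
  move=> iN jr; have gab := gauss_pt_range hx r_gt0 hG iN jr.
  have gx := gauss_pt_itv hx r_gt0 hG iN jr.
  rewrite -sigmaE ?in_itv//; last exact: (uD i _ iN gx).1.
  rewrite Ssigma//.
  have := sigma_c; rewrite continuous_open_subspace; last exact: interval_open.
  by apply; rewrite inE/= in_itv.
have th_x0 : th (x 0%N) = 0 by rewrite xa.
have th_xN : th (x N) = 0 by rewrite xb.
have [Z [ZP Z_a orth]] := fv_tested hx r_gt0 hG hab f_L1 uP_L1 SP uP_sol
  (th := fun i => th (x i)) th_x0 th_xN Q_sum.
have eP := primitiveB u_prim uP_prim.
have ZP' : primitive a b Z (fun t => B t * (derive1 u t - derive1 uP t) +
    gam t * (u t - uP t)).
  apply: primitive_ae ZP; last exact: L1_meas (lower _ _ eP).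
  by apply: (ae_imp _ coef_ae) => t H /H[-> ->]; ring.
pose Zt t := intg a t (fun s => B s * tp s + gam s * th s).
pose Zr t := intg a t (fun s => B s * rp s + gam s * rho s).
have ZtP : primitive a b Zt _ := primitive_intg (lower _ _ thP).
have ZrP : primitive a b Zr _ := primitive_intg (lower _ _ rhoP).
have Zr_a : Zr a = 0 by exact: intg_pt.
have ZE t : a <= t <= b -> Z t = Zr t - Zt t.
  move=> tab; apply: (primitive_uniq (W := fun s => Zr s - Zt s) ZP' _ _ tab); last by rewrite Z_a Zr_a /Zt intg_pt subrr.
  by apply: primitive_eq (primitiveB ZrP ZtP) => // s _; rewrite /rp /rho; ring.
have n_ge0 i : 0 <= n i by exact: gauss_norm_ge0.
have P_le i t : (1 <= i <= N)%N -> x i.-1 <= t <= x i -> `|(P i).[t]| <= K1 * n i.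
  by move=> iN; have [H _ _] := bounds i iN; exact: H.
have Q_le i : (1 <= i <= N)%N -> \sum_(1 <= j < r.+1) `|Q i j| <= K2 * h i * n i.
  by move=> iN; have [_ H _] := bounds i iN.
have rp_bdd i : (1 <= i <= N)%N -> exists M, forall t, x i.-1 < t < x i -> `|rp t| <= M.
  move=> iN; have [_ vc _ _ _] := approx iN.
  have [M1 _ H1] := within_bounded vc.
  have [M2 _ H2] : exists2 M, 0 <= M & forall t, x i.-1 <= t <= x i -> `|(p i)^`().[t]| <= M.
    exact/within_bounded/continuous_subspaceT/continuous_horner.
  exists (M1 + M2) => t xt; rewrite (rpE i t iN xt).
  have xt' : x i.-1 <= t <= x i by case/andP: xt => /ltW -> /ltW ->.
  exact: le_trans (ler_normB _ _) (lerD (H1 t xt') (H2 t xt')).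
have rho_le i t : (1 <= i <= N)%N -> x i.-1 <= t <= x i -> `|rho t| <= e i.
  by move=> iN xt; rewrite (rhoE i t iN xt); have [_ _ _ H _] := approx iN; exact: H.
pose al i j := alpha (g i j).
pose rpg i j := derive1 u (g i j) - (p i)^`().[g i j].
have g_ab i j : (1 <= i <= N)%N -> (1 <= j <= r)%N -> a <= g i j <= b.
  by move=> iN jr; have /andP[g1 g2] := gauss_pt_range hx r_gt0 hG iN jr; rewrite !ltW.
have al_le i j : (1 <= i <= N)%N -> (1 <= j <= r)%N -> `|al i j| <= MA.
  by move=> iN jr; exact/alpha_le/g_ab.
have rpg_le i j : (1 <= i <= N)%N -> (1 <= j <= r)%N -> `|rpg i j| <= e i.
  move=> iN jr; have gx := gauss_pt_itv hx r_gt0 hG iN jr.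
  rewrite /rpg (uD i _ iN gx).2; have [_ _ _ _ H] := approx iN; apply: (H j _ jr).
  by rewrite gE.
have Q_coer i : (1 <= i <= N)%N -> k0 * al0 * h i * n i ^+ 2 <=
    \sum_(1 <= j < r.+1) Q i j * (al i j * (P i).[g i j]).
  move=> iN; have [_ _ H] := bounds i iN.
  have := H (al i) al0 (ltW al0_gt0) (fun j jr => alpha_ge (g_ab i j iN jr)).
  move/le_trans; apply; rewrite big_nat [leRHS]big_nat le_eqVlt; apply/orP; left; apply/eqP.
  by apply: eq_bigr => j jr; rewrite gE.
have orth' : \sum_(1 <= i < N.+1) \sum_(1 <= j < r.+1) Q i j *
    (al i j * (rpg i j - (P i).[g i j]) - (Zr (g i j) - Zt (g i j))) = 0.
  rewrite -[RHS]orth; apply: eq_big_nat => i iN; apply: eq_big_nat => j jr.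
  have [_ _ qu] := qE i iN; have gx := gauss_pt_itv hx r_gt0 hG iN jr.
  rewrite (Sg i j iN jr) (qu _ gx) (ZE _ (g_ab i j iN jr)) /al /rpg /P derivB hornerD hornerN.
  ring.
have main := error_sqr_le hx r_gt0 hG hab K1_gt0 K2_gt0 MB_ge0 MG_ge0 n_ge0 P_le Q_le thP
  th_a th_b tpE Q_sum BP B_le gam_meas gam_le coercive ZtP rhoP rho_a rp_bdd rho_le ZrP
  Zr_a (ltW C0_gt0) MA_ge0 al0_gt0 k0_gt0 E_ge0 EE_ge0 E_sum eE al_le rpg_le Q_coer orth'
  gb_sqr h_small.
have e_within := primitive_within (ltW hab) eP.
have e2 : L1 a b (fun t => (u t - uP t) ^+ 2) by exact: L1M_within (L1_within e_within).
rewrite -ler_sqr ?nnegrE ?L2norm_ge0//; last first.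
  apply: mulr_ge0 EE_ge0; apply: mulr_ge0; last by rewrite exprn_ge0//; exact: mesh_size_ge0.
  exact/ltW/error_const_gt0.
rewrite (L2norm_sqr (v := u \- uP) e2); apply: le_trans main.
rewrite le_eqVlt; apply/orP; left; apply/eqP; congr intg; apply/funext => t.
by rewrite /rho /=; ring.
Qed.

End Assembly.

(** From (s + t)^2 <= 2 s^2 + 2 t^2; the factor 2, rather than its square root, keeps the constant
    rational. *)
Lemma sum_top_norms_le (R : realType) (N : nat) (x : nat -> R) (r : nat) (u : R -> R)
    (n := fun j i : nat => L2norm (x i.-1) (x i) (wderivn (x i.-1) (x i) j u)) :
  \sum_(1 <= i < N.+1) (n r.+1 i + n r.+2 i) ^+ 2 <= (2 * broken_norm r.+2 N x u) ^+ 2.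
Proof.
have S0 j : 0 <= \sum_(1 <= i < N.+1) n j i ^+ 2.
  by apply: sumr_ge0 => i _; exact: sqr_ge0.
have T0 m : 0 <= \sum_(0 <= j < m) \sum_(1 <= i < N.+1) n j i ^+ 2.
  by apply: sumr_ge0 => j _; exact: S0.
rewrite exprMn /broken_norm sqr_sqrtr; last exact: (T0 r.+3).
rewrite (big_nat_recr r.+2)//= (big_nat_recr r.+1)//=.
apply: (@le_trans _ _ (\sum_(1 <= i < N.+1) (2 * n r.+1 i ^+ 2 + 2 * n r.+2 i ^+ 2))).
  by apply: ler_sum => i _; have := sqr_ge0 (n r.+1 i - n r.+2 i); rewrite !expr2; nra.
rewrite big_split/= -!mulr_sumr.
by have := T0 r.+1; have := S0 r.+1; have := S0 r.+2; rewrite /n !expr2; lra.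
Qed.

Theorem corollary4p2 (R : realType) (a b : R) (alpha beta gamma : R -> R)
    (alpha0 kappa : R) (r : nat) (G : nat -> R)
    (hab : a < b)
    (halpha : Lp +oo%E a b alpha) (hbeta : Lp +oo%E a b beta)
    (hgamma : Lp +oo%E a b gamma)
    (halpha_bounded : exists M : R, forall y, y \in `[a, b] -> `|alpha y| <= M)
    (hbeta_H1 : sobolev 1 a b beta)
    (halpha0 : 0 < alpha0)
    (halpha_ge : forall y, y \in `[a, b] -> alpha0 <= alpha y)
    (hkappa : 0 < kappa)
    (hcoercive : {ae lebesgue_measure, forall y : R, y \in `]a, b[ ->
       kappa <= gamma y - 2^-1 * wderiv a b beta y})
    (hr : (1 <= r)%N) (hG : legendre_zeros r G) :
  exists C h0 : R, [/\ 0 < C, 0 < h0 &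
    forall (N : nat) (x : nat -> R), mesh a b N x -> mesh_size N x < h0 ->
    forall f u uP : R -> R,
      Lp 1%E a b f ->
      bvp_solution a b alpha beta gamma f u ->
      broken_sobolev r.+2 a b N x u ->
      fv_solution a b alpha beta gamma f N x G r uP ->
      L2norm a b (u \- uP) <=
        C * mesh_size N x ^+ r.+1 * broken_norm r.+2 N x u].
Proof.
have [K1 [K2 [k0 [K1_gt0 K2_gt0 k0_gt0 element_bounds]]]] := gauss_element hr hG.
have [C0 C0_gt0 approx] := element_approx hr hG.
have [M HM] := halpha_bounded.
have alpha_le t : a <= t <= b -> `|alpha t| <= `|M|.
  by move=> tab; rewrite (le_trans (HM t _)) ?ler_norm// in_itv.
have alpha_ge t : a <= t <= b -> alpha0 <= alpha t by move=> ?; rewrite halpha_ge ?in_itv.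
have [MG MG_ge0 gamma_le] := Lpoo_bounded hgamma.
set b' := wderiv a b beta in hcoercive.
have [B [BP beta_ae _]] := weak_primitive hab (wderivP (hbeta_H1.1 0%N isT)).
have [MB MB_ge0 B_le] := within_bounded (primitive_within (ltW hab) BP).
(* Truncation at the essential bound: equal to [gamma] almost everywhere, but bounded at every
   point, as the energy argument demands. *)
pose gam t : R := Num.max (- MG) (Num.min MG (gamma t)).
have gam_meas : measurable_fun `]a, b[ gam.
  apply: measurable_maxr; first exact: measurable_cst.
  by apply: measurable_minr; [exact: measurable_cst|exact: Lp_meas hgamma].
have gam_le t : a < t < b -> `|gam t| <= MG.
  by move=> _; rewrite ler_norml /gam le_max lexx /= ge_max ge_min lexx/= andbT ge0_cp.
have gam_ae : {ae lebesgue_measure, forall t, a < t < b -> gamma t = gam t}.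
  apply: (ae_imp _ gamma_le) => t H /H; rewrite ler_norml => /andP[h1 h2].
  by rewrite /gam (min_idPr h2) (max_idPr h1).
have coef_ae : {ae lebesgue_measure, forall t, a < t < b -> beta t = B t /\ gamma t = gam t}.
  apply: (ae_imp _ (ae_and beta_ae gam_ae)) => t [H1 H2] tab.
  by split; [exact: H1|exact: H2].
have coercive : {ae lebesgue_measure, forall t, a < t < b -> 0 <= gam t - 2^-1 * b' t}.
  apply: (ae_imp _ (ae_and hcoercive gam_ae)) => t [H1 H2] tab.
  by rewrite -(H2 tab) (le_trans (ltW hkappa))// H1// in_itv.
(* Here beta in H^1 is used in full: b' is square integrable, and (gam - b')^2 <= 2 MG^2 + 2
   b'^2. *)
have gb_sqr : L1 a b (fun t => (gam t - b' t) ^+ 2).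
  apply: (L1_le _ _ (L1D (L1_cst a b (2 * MG ^+ 2)) (L1Z 2 (Lp2_sqr (hbeta_H1.2 1%N isT))))).
    by apply: measurable_funX; apply: measurable_funB => //; exact: L1_meas BP.1.
  move=> t /gam_le gM.
  have gM2 : gam t ^+ 2 <= MG ^+ 2 by rewrite -real_normK ?num_real// lerXn2r ?nnegrE.
  rewrite (ger0_norm (sqr_ge0 _)) ger0_norm; last by rewrite addr_ge0// mulr_ge0 ?sqr_ge0.
  change (wderivn a b 1 beta t) with (b' t).
  by have := sqr_ge0 (gam t + b' t); move: gM2; rewrite !expr2; lra.
have ec_gt0 := error_const_gt0 a b halpha0 (normr_ge0 M) b' gam MB_ge0 K1_gt0 K2_gt0 k0_gt0
  C0_gt0.
set ec := error_const _ _ _ _ _ _ _ _ _ _ _ in ec_gt0.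
pose qc := quad_const a b K1 K2 MB MG.
have qc_ge0 : 0 <= qc.
  by rewrite /qc /quad_const !mulr_ge0 ?addr_ge0 ?mulr_ge0 ?sqr_ge0 ?(ltW K1_gt0) ?(ltW K2_gt0).
have ka : 0 < k0 * alpha0 / 2 by rewrite divr_gt0// mulr_gt0.
have qc1 : 0 < qc + 1 by rewrite ltr_wpDl.
(* The 2 in front of [ec] comes from [sum_top_norms_le]. The threshold 1 is for [element_approx],
   the other one for absorbing the quadrature error; qc + 1 avoids a division by 0. *)
exists (2 * ec), (Num.min 1 (k0 * alpha0 / 2 / (qc + 1))); split.
- by rewrite mulr_gt0.
- by rewrite lt_min ltr01 divr_gt0.
move=> N x hx; rewrite lt_min => /andP[h_lt1 h_lt] f u uP f1 u_sol u_broken uP_sol.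
have hm0 := mesh_size_ge0 N x.
have h_small : qc * mesh_size N x <= k0 * alpha0 / 2.
  rewrite ltr_pdivlMr// mulrC in h_lt; apply: le_trans (ltW h_lt).
  by rewrite ler_wpM2r// lerDl.
pose n j i := L2norm (x i.-1) (x i) (wderivn (x i.-1) (x i) j u).
have [[uc _ _ _] _] := u_sol.
pose e i := C0 * (x i - x i.-1) ^+ r * Num.sqrt (x i - x i.-1) * (n r.+1 i + n r.+2 i).
have /choice[vp Hvp] : forall i, exists vp : (R -> R) * {poly R}, (1 <= i <= N)%N ->
    [/\ primitive (x i.-1) (x i) u vp.1, {within `[x i.-1, x i], continuous vp.1},
      [/\ (size vp.2 <= r.+1)%N, vp.2.[x i.-1] = u (x i.-1) & vp.2.[x i] = u (x i)],
      forall t, x i.-1 <= t <= x i -> `|u t - vp.2.[t]| <= e i &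
      forall j y, (1 <= j <= r)%N -> y = 2^-1 * (x i + x i.-1 + (x i - x i.-1) * G j) ->
        `|vp.1 y - vp.2^`().[y]| <= e i].
  move=> i; have [iN|iN] := boolP (1 <= i <= N)%N; last by exists (id, 0).
  have [h1 h2] := mesh_elt hx iN.
  have ui : {within `[x i.-1, x i], continuous u}.
    by apply: continuous_subspaceW uc; apply: subset_itv; rewrite bnd_simp.
  have hi : x i - x i.-1 <= 1 := le_trans (mesh_size_ge x iN) (ltW h_lt1).
  have [v [p H]] := approx _ _ _ (mesh_step hx iN) hi ui (u_broken.2 i iN).
  by exists (v, p) => _; exact: H.
have bn0 : 0 <= 2 * broken_norm r.+2 N x u by rewrite mulr_ge0// sqrtr_ge0.
have E_ge0 i : 0 <= n r.+1 i + n r.+2 i by rewrite addr_ge0// L2norm_ge0.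
have -> : 2 * ec * mesh_size N x ^+ r.+1 * broken_norm r.+2 N x u =
  ec * mesh_size N x ^+ r.+1 * (2 * broken_norm r.+2 N x u) by ring.
exact: (fv_error_le hx hr hG hab halpha0 (normr_ge0 M) alpha_le alpha_ge
  (Lp_meas hbeta) (Lp_meas hgamma) MB_ge0 MG_ge0 BP B_le gam_meas gam_le gb_sqr coef_ae
  coercive K1_gt0 K2_gt0 k0_gt0 C0_gt0 element_bounds bn0 (fun=> erefl) E_ge0
  (sum_top_norms_le N x r u) Hvp ((Lp1_L1 _ _ _).1 f1) u_sol uP_sol h_small).
Qed.
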